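(* Let $k$ be an algebraically closed field of characteristic zero. Let $X\subset\mathbb{P}^4$ be an irreducible cubic threefold over $k$, not a cone, which is singular along a line, i.e. a line is an irreducible component of $\mathrm{Sing}(X)$. Let $G\subseteq\mathrm{Aut}(X)$ be a finite subgroup. Then the $G$-action on $X$ is linearizable.
   Context: $\mathrm{Sing}(X)$ denotes the singular locus of $X$. A $G$-action on $\mathbb{P}^n$ is called linear if it arises from the projectivization $\mathbb{P}(V)$ of a $G$-representation $V$. A $G$-action on an $n$-dimensional projective variety $X$ is linearizable if $X$ is $G$-equivariantly birational to $\mathbb{P}^n$ with a linear $G$-action. *)

(* Defs.v *)
From HB Require Import structures.
From mathcomp Require Import all_boot all_order all_algebra all_fingroup.
From mathcomp Require Import all_character.
From mathcomp Require Import mpoly.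

Set Implicit Arguments.
Unset Strict Implicit.
Unset Printing Implicit Defensive.

Import GRing.Theory.
Local Open Scope ring_scope.

(* Varieties over an algebraically closed field are handled classically,      *)
(* through their sets of k-points in P^n(k); such a set is a predicate        *)
(* 'P[k]_n -> Prop.                                                           *)

Section ProjectiveSpace.
Variables (k : fieldType) (n : nat).

Record pspace := PSpace {
  pline :> {vspace 'cV[k]_n.+1};
  _ : \dim pline == 1%N
}.

HB.instance Definition _ := [isSub for pline].
HB.instance Definition _ := [Choice of pspace by <:].

End ProjectiveSpace.

Notation "''P[' k ]_ n" := (pspace k n)
  (at level 0, n at level 2, format "''P[' k ]_ n").

Section ZariskiTopology.
Variables (k : fieldType) (n : nat).
Implicit Types (p q : 'P[k]_n) (f : {mpoly k[n.+1]}) (X Y Z U : 'P[k]_n -> Prop).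

Definition peval f (v : 'cV[k]_n.+1) : k := f.@[fun i => v i 0].

Definition vanishes_at f p : Prop :=
  forall v : 'cV[k]_n.+1, v \in (p : {vspace _}) -> peval f v = 0.

Definition psubset X Y : Prop := forall p, X p -> Y p.

Definition zariski_closed Z : Prop :=
  exists2 S : {mpoly k[n.+1]} -> Prop,
    (forall f, S f -> exists d : nat, f \is d.-homog)
    & forall p, Z p <-> (forall f, S f -> vanishes_at f p).

Definition irreducible_set Z : Prop :=
  (exists p, Z p) /\
  (forall A B : 'P[k]_n -> Prop, zariski_closed A -> zariski_closed B ->
     (forall p, Z p -> A p \/ B p) -> psubset Z A \/ psubset Z B).

Definition irreducible_component C Z : Prop :=
  [/\ irreducible_set C, psubset C Z
    & forall D : 'P[k]_n -> Prop,
        irreducible_set D -> psubset D Z -> psubset C D -> psubset D C].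

Definition dense_open X U : Prop :=
  (exists2 Z, zariski_closed Z & forall p, U p <-> X p /\ ~ Z p) /\
  (forall Z, zariski_closed Z -> psubset U Z -> psubset X Z).

Definition is_line L : Prop :=
  exists2 W : {vspace 'cV[k]_n.+1},
    \dim W = 2%N & forall p, L p <-> (p <= W)%VS.

(* X is a union of lines through one of its points, the vertex; the points    *)
(* of the line joining p and q are those of the span p + q.                   *)
Definition is_cone X : Prop :=
  exists2 vertex, X vertex &
    forall p, X p -> forall q, (q <= vertex + p)%VS -> X q.

Definition hypersurface f : 'P[k]_n -> Prop := vanishes_at f.

(* Jacobian criterion; it describes the singular locus of the scheme f = 0.   *)
Definition Sing f : 'P[k]_n -> Prop :=
  fun p => hypersurface f p /\ forall i : 'I_n.+1, vanishes_at f^`M(i) p.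

End ZariskiTopology.

Section RegularMaps.
Variables (k : fieldType).

Definition forms_eval n m (F : 'I_m.+1 -> {mpoly k[n.+1]}) (v : 'cV[k]_n.+1) :
  'cV[k]_m.+1 := \col_i peval (F i) v.

(* Near every point of U, phi is given by forms F_0, ..., F_m of one degree.  *)
(* No smaller neighbourhood than U minus the common zeros of the F_i is       *)
(* needed: multiply the F_i by a form vanishing off a given neighbourhood.    *)
(* The values of phi off U are irrelevant.                                    *)
Definition regular_on n m (U : 'P[k]_n -> Prop) (phi : 'P[k]_n -> 'P[k]_m) :=
  forall p, U p -> exists (d : nat) (F : 'I_m.+1 -> {mpoly k[n.+1]}),
    [/\ forall i, F i \is d.-homog,
        exists2 v, v \in (p : {vspace _}) & forms_eval F v != 0
      & forall q v, U q -> v \in (q : {vspace _}) -> forms_eval F v != 0 ->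
          phi q = <[forms_eval F v]>%VS :> {vspace 'cV[k]_m.+1}].

Definition is_automorphism n (X : 'P[k]_n -> Prop) (s : 'P[k]_n -> 'P[k]_n) :=
  [/\ forall p, X p -> X (s p), regular_on X s
    & exists t : 'P[k]_n -> 'P[k]_n,
        [/\ forall p, X p -> X (t p), regular_on X t,
            forall p, X p -> t (s p) = p & forall p, X p -> s (t p) = p]].

End RegularMaps.

Section GroupActions.
Variables (k : fieldType) (gT : finGroupType).

(* act is an injective group homomorphism from gT to Aut(X), which presents   *)
(* gT as a finite subgroup of Aut(X). Automorphisms are compared on X only.   *)
Definition subgroup_of_Aut n (X : 'P[k]_n -> Prop)
    (act : gT -> 'P[k]_n -> 'P[k]_n) : Prop :=
  [/\ forall g, is_automorphism X (act g),
      forall g h p, X p -> act (g * h)%g p = act g (act h p)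
    & forall g h, (forall p, X p -> act g p = act h p) -> g = h].

Section LinearAction.
Variables (n : nat) (rG : mx_representation k [set: gT] n.+1).

Fact lin_act_subproof (g : gT) (p : 'P[k]_n) :
  \dim (linfun (mulmx (rG g) : 'cV[k]_n.+1 -> 'cV[k]_n.+1) @: p)%VS == 1%N.
Proof.
rewrite limg_dim_eq ?(valP p) //; apply/eqP; rewrite -subv0.
apply/subvP => v; rewrite memv_cap => /andP[_]; rewrite memv_ker lfunE /=.
move/eqP => rGv0; have := mulKmx (repr_mx_unit rG (in_setT g)) v.
by rewrite rGv0 mulmx0 => <-; rewrite mem0v.
Qed.

(* The action of gT on P(V), V = k^(n+1) the space of column vectors.         *)
Definition lin_act (g : gT) (p : 'P[k]_n) : 'P[k]_n :=
  PSpace (lin_act_subproof g p).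

End LinearAction.

Definition linear_action n (act : gT -> 'P[k]_n -> 'P[k]_n) : Prop :=
  exists rG : mx_representation k [set: gT] n.+1,
    forall g p, act g p = lin_act rG g p.

(* phi and psi are inverse isomorphisms between the dense opens U and V;      *)
(* equivariance of the rational map phi is required wherever both sides of    *)
(* phi (g x) = g (phi x) are defined.                                         *)
Definition equivariantly_birational n m
    (X : 'P[k]_n -> Prop) (actX : gT -> 'P[k]_n -> 'P[k]_n)
    (Y : 'P[k]_m -> Prop) (actY : gT -> 'P[k]_m -> 'P[k]_m) : Prop :=
  exists (U : 'P[k]_n -> Prop) (V : 'P[k]_m -> Prop)
         (phi : 'P[k]_n -> 'P[k]_m) (psi : 'P[k]_m -> 'P[k]_n),
    [/\ dense_open X U /\ dense_open Y V,
        regular_on U phi /\ regular_on V psi,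
        forall x, U x -> V (phi x) /\ psi (phi x) = x,
        forall y, V y -> U (psi y) /\ phi (psi y) = y
      & forall g x, U x -> U (actX g x) -> phi (actX g x) = actY g (phi x)].

(* d is meant to be the dimension of X, as birationality to P^d forces.       *)
Definition linearizable d n (X : 'P[k]_n -> Prop)
    (act : gT -> 'P[k]_n -> 'P[k]_n) : Prop :=
  exists2 lact : gT -> 'P[k]_d -> 'P[k]_d,
    linear_action lact
    & equivariantly_birational X act (fun _ => True) lact.

End GroupActions.

(* Main.v *)
Require Import Defs.
From mathcomp Require Import all_boot all_order all_algebra all_fingroup.
From mathcomp Require Import all_character.
From mathcomp Require Import mpoly.
From mathcomp Require Import ring zify.
From Stdlib Require Import Classical.

Set Implicit Arguments.
Unset Strict Implicit.
Unset Printing Implicit Defensive.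

Import GRing.Theory.
Local Open Scope ring_scope.

(** A cubic threefold that is singular along a line has the equation
  3 T w y y + T y y y = 0 in the coordinates (w, y) given by the plane W over the
  line L and a complement of W, where T is the polar form: products of two
  elements of W drop out because L is singular. Over a general y this is a line,
  residual to L in the plane through L and y; it meets L in the point P y, the zero
  of T w y y in W. If the group fixes a point p of L, projecting from p is
  birational, since p is a double point of a cubic. If the group only preserves L,
  then X is birational to a family of affine lines over the plane P(V / W) whose
  translations are the multiples of P y; a coordinate along these lines, averaged
  over the group, trivializes the family equivariantly.

  These constructions need an action on the space V and not only on X. The group
  acts by abstract automorphisms of X, and the main work is to show that they are
  linear (automorphism_linear). Polynomial paths in X take the place of infinitesimal
  arguments and of dimension theory.
   - The derivatives of such paths at a general point of L span V (tangent_span), so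
     the differential of a local lift of an automorphism is invertible there
     (jacobian_unit) and L is mapped into the singular locus.
   - A curve of singular points is part of L or of a line that meets L, because two
     singular points in different directions would force a hyperplane into X
     (singular_path). With a parametrization of the image curve that has no base
     points this shows that L is mapped linearly to a line (double_line_image).
   - In a one-parameter family of lines of X the degree of the image curves is
     constant (family_lift, which rests on the lemma of Gauss for k[t]). Every
     residual line can be deformed to L, possibly inside a plane contained in X, so
     an automorphism is linear on residual lines (linear_on_residual).
   - The image of L and the derivative in the normal directions along L, which is
     constant because it is regular everywhere on L, define a matrix M
     (linear_model). On each residual line the automorphism differs from M by a
     shift in W. The shift is polynomial along lines of V / W (shift_line), hence
     additive (shift_add) and linear (shift_linear), and a correction of M by this
     linear shift represents the automorphism on all of X.

  A linear automorphism that is the identity on X is scalar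
  (scalar_of_collinear), so the matrices form a projective representation. The
  images of L under the group are lines of singular points, and if they are not all
  equal to L, then they all pass through the same point of L, which is fixed
  (fixed_or_invariant). In the first case project_fixed_point applies. In the
  second one the matrices multiply T w y y by a scalar for w in W
  (residual_scalar), so they permute the points P y and can be normalized to do so
  exactly; this turns them into a linear representation
  (normalized_representation), and average_coordinate gives the birational map to
  the projective space of V / W plus a trivial summand. *)


(** * Polynomial functions of one variable *)

Section OneVariable.
Variable k : closedFieldType.
Implicit Types (p q e : {poly k}) (g h : k -> k).

Let horE := (hornerD, hornerN, hornerM, hornerZ, hornerXn, hornerX, hornerC).

Lemma poly_nonroot p : p != 0 -> exists t, p.[t] != 0.
Proof. by move/closed_nonrootP=> [t ht]; exists t. Qed.

Lemma poly_fun_eq0 p : (forall t, p.[t] = 0) -> p = 0.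
Proof.
move=> p0; apply/eqP; apply/negPn/negP => /poly_nonroot[t].
by rewrite p0 eqxx.
Qed.

Lemma poly_fun_inj p q : (forall t, p.[t] = q.[t]) -> p = q.
Proof.
move=> pq; apply/eqP; rewrite -subr_eq0; apply/eqP/poly_fun_eq0 => t.
by rewrite hornerD hornerN pq subrr.
Qed.

(** For all but finitely many t. The exceptions are the zeros of a polynomial, so
  that finite intersections are products and no cardinality occurs. *)
Definition generically (Q : k -> Prop) : Prop :=
  exists2 e : {poly k}, e != 0 & forall t, e.[t] != 0 -> Q t.

Lemma generically_and Q R :
  generically Q -> generically R -> generically (fun t => Q t /\ R t).
Proof.
move=> [e e0 he] [d d0 hd]; exists (e * d); first by rewrite mulf_neq0.
by move=> t; rewrite hornerM mulf_eq0 negb_or => /andP[/he ? /hd].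
Qed.

Lemma generically_imp (Q R : k -> Prop) :
  (forall t, Q t -> R t) -> generically Q -> generically R.
Proof. by move=> QR [e e0 he]; exists e => // t /he /QR. Qed.

Lemma generically_all (Q : k -> Prop) : (forall t, Q t) -> generically Q.
Proof. by move=> hQ; exists 1; rewrite ?oner_neq0. Qed.

Lemma generically_ex Q : generically Q -> exists t, Q t.
Proof. by case=> e /poly_nonroot[t et] /(_ _ et) ?; exists t. Qed.

Lemma generically_neq c : generically (fun t => t != c).
Proof.
exists ('X - c%:P); first by rewrite polyXsubC_eq0.
by move=> t; rewrite hornerXsubC subr_eq0.
Qed.

Definition polyfun g : Prop := exists p : {poly k}, forall t, g t = p.[t].

Lemma polyfun_eq g h : (forall t, g t = h t) -> polyfun g -> polyfun h.
Proof. by move=> gh [p hp]; exists p => t; rewrite -gh. Qed.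

Lemma polyfun_horner p : polyfun (fun t => p.[t]).
Proof. by exists p. Qed.

Lemma polyfunC c : polyfun (fun=> c).
Proof. by exists c%:P => t; rewrite hornerC. Qed.

Lemma polyfunX : polyfun (fun t => t).
Proof. by exists 'X => t; rewrite hornerX. Qed.

Lemma polyfunD g h : polyfun g -> polyfun h -> polyfun (fun t => g t + h t).
Proof. by move=> [p hp] [q hq]; exists (p + q) => t; rewrite hornerD hp hq. Qed.

Lemma polyfunM g h : polyfun g -> polyfun h -> polyfun (fun t => g t * h t).
Proof. by move=> [p hp] [q hq]; exists (p * q) => t; rewrite hornerM hp hq. Qed.

Lemma polyfunN g : polyfun g -> polyfun (fun t => - g t).
Proof. by move=> [p hp]; exists (- p) => t; rewrite hornerN hp. Qed.

Lemma polyfunB g h : polyfun g -> polyfun h -> polyfun (fun t => g t - h t).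
Proof. by move=> pg ph; apply: polyfunD => //; apply: polyfunN. Qed.

Lemma polyfun_exp g n : polyfun g -> polyfun (fun t => g t ^+ n).
Proof. by move=> [p hp]; exists (p ^+ n) => t; rewrite horner_exp hp. Qed.

Lemma polyfun_sum (I : Type) (r : seq I) (P : pred I) (G : I -> k -> k) :
  (forall i, polyfun (G i)) -> polyfun (fun t => \sum_(i <- r | P i) G i t).
Proof.
move=> hG; elim: r => [|i r IH].
  by apply: polyfun_eq (polyfunC 0) => t; rewrite big_nil.
case Pi: (P i); last by apply: polyfun_eq IH => t; rewrite big_cons Pi.
by apply: polyfun_eq (polyfunD (hG i) IH) => t; rewrite big_cons Pi.
Qed.

Lemma polyfun_generic g : polyfun g -> (exists t, g t != 0) ->
  generically (fun t => g t != 0).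
Proof.
move=> [p hp] [t ht]; exists p; last by move=> s; rewrite hp.
by apply: contraNneq ht => p0; rewrite hp p0 horner0.
Qed.

Lemma polyfun_eq0 g : polyfun g -> generically (fun t => g t = 0) ->
  forall t, g t = 0.
Proof.
move=> [p hp] [e e0 he]; suff p0 : p = 0 by move=> t; rewrite hp p0 horner0.
have /eqP : p * e = 0.
  apply: poly_fun_eq0 => t; rewrite hornerM -hp.
  by have [->|/he->] := eqVneq e.[t] 0; rewrite ?mulr0 ?mul0r.
by rewrite mulf_eq0 (negPf e0) orbF => /eqP.
Qed.

Lemma polyfun_ext g h : polyfun g -> polyfun h ->
  generically (fun t => g t = h t) -> forall t, g t = h t.
Proof.
move=> pg ph gh t; apply/eqP; rewrite -subr_eq0; apply/eqP; move: t.
apply: polyfun_eq0; first exact: polyfunB.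
by apply: generically_imp gh => t ->; rewrite subrr.
Qed.

Lemma polyfun_prod_eq0 g h : polyfun g -> polyfun h ->
  (forall t, g t * h t = 0) -> (forall t, g t = 0) \/ (forall t, h t = 0).
Proof.
move=> pg ph gh; have [[t gt]|no] := classic (exists t, g t != 0).
  right; apply: polyfun_eq0 => //.
  apply: generically_imp (polyfun_generic pg (ex_intro _ t gt)) => s gs.
  by apply/eqP; have := gh s; move/eqP; rewrite mulf_eq0 (negPf gs).
by left=> t; apply/eqP/negPn/negP => gt; apply: no; exists t.
Qed.

Lemma polyfun_root g t0 : polyfun g -> g t0 = 0 ->
  exists2 h, polyfun h & forall t, g t = (t - t0) * h t.
Proof.
move=> [p hp] g0; have /factor_theorem[q def_p] : root p t0.
  by apply/rootP; rewrite -hp.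
exists (horner q); first exact: polyfun_horner.
by move=> t; rewrite hp def_p hornerM hornerXsubC mulrC.
Qed.

(** * First-order jets *)

(** The function is a + b t up to order two at t = 0. Derivatives are handled
  through such expansions, which are unique and multiplicative. *)
Definition jet g a b : Prop :=
  exists p : {poly k}, forall t, g t = a + b * t + t ^+ 2 * p.[t].

Lemma jet_polyfun g a b : jet g a b -> polyfun g.
Proof.
move=> [p hp]; exists (a%:P + b *: 'X + 'X^2 * p) => t.
by rewrite !horE hp.
Qed.

Lemma jet0 g a b : jet g a b -> g 0 = a.
Proof. by case=> p ->; rewrite mulr0 expr0n mul0r !addr0. Qed.

Lemma jet_uniq g a b a' b' : jet g a b -> jet g a' b' -> a = a' /\ b = b'.
Proof.
move=> j1 j2; have aa : a = a' by rewrite -(jet0 j1) -(jet0 j2).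
split=> //; case: j1 j2 => p hp [q hq].
have key : forall t, t * ((b - b')%:P + 'X * (p - q)).[t] = 0.
  move=> t; rewrite !horE.
  have : g t - g t = 0 by rewrite subrr.
  by rewrite {1}hp hq aa => <-; ring.
have h0 : (b - b')%:P + 'X * (p - q) = 0.
  apply/eqP; have /eqP : 'X * ((b - b')%:P + 'X * (p - q)) = 0.
    by apply: poly_fun_eq0 => t; rewrite hornerM hornerX key.
  by rewrite mulf_eq0 polyX_eq0.
have := congr1 (fun r => r.[0]) h0.
by rewrite !horE mul0r addr0 => /eqP; rewrite subr_eq0 => /eqP.
Qed.

Lemma jet_eq g h a b : (forall t, g t = h t) -> jet g a b -> jet h a b.
Proof. by move=> gh [p hp]; exists p => t; rewrite -gh. Qed.

Lemma jetC c : jet (fun=> c) c 0.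
Proof. by exists 0 => t; rewrite mul0r horner0 mulr0 !addr0. Qed.

Lemma jet_affine a b : jet (fun t => a + t * b) a b.
Proof. by exists 0 => t; rewrite horner0 mulr0 addr0 mulrC. Qed.

Lemma jetD g h a b c d :
  jet g a b -> jet h c d -> jet (fun t => g t + h t) (a + c) (b + d).
Proof.
move=> [p hp] [q hq]; exists (p + q) => t; rewrite hp hq !horE. ring.
Qed.

Lemma jetM g h a b c d :
  jet g a b -> jet h c d -> jet (fun t => g t * h t) (a * c) (a * d + b * c).
Proof.
move=> [p hp] [q hq].
exists (a *: q + c *: p + (b * d)%:P + 'X * (b *: q + d *: p)
  + 'X^2 * (p * q)) => t.
by rewrite hp hq !horE; ring.
Qed.

Lemma polyfun_jet g : polyfun g -> exists b, jet g (g 0) b.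
Proof.
move=> pg; have pg0 : polyfun (fun t => g t - g 0).
  by apply: polyfunB pg _; apply: polyfunC.
have [h ph hh] := polyfun_root pg0 (subrr _).
have ph0 : polyfun (fun t => h t - h 0) by apply: polyfunB ph (polyfunC _).
have [l [p hp] hl] := polyfun_root ph0 (subrr _).
exists (h 0), p => t; rewrite -hp.
have := hh t; have := hl t; rewrite subr0 => e1 e2.
have -> : g t = g 0 + t * h t by rewrite -e2 addrC subrK.
have -> : h t = h 0 + t * l t by rewrite -e1 addrC subrK.
by ring.
Qed.

End OneVariable.

(** * Evaluation of multivariate polynomials *)

Section AlgebraInduction.
Variables (n : nat) (R : comNzRingType).

Lemma mpoly_algebra_ind (P : {mpoly R[n]} -> Prop) :
  (forall c, P c%:MP) -> (forall i, P 'X_i) ->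
  (forall p q, P p -> P q -> P (p + q)) ->
  (forall p q, P p -> P q -> P (p * q)) -> forall p, P p.
Proof.
move=> hC hX hD hM; elim/mpolyind => [|c m p _ _ hp]; first exact: (hC 0).
apply: (hD) => //; rewrite -mul_mpolyC; apply: (hM) => //.
rewrite mpolyXE_id; elim/big_ind: _ => [|p1 p2|i _]; first exact: (hC 1).
  exact: hM.
elim: (m i) => [|j IH]; first exact: (hC 1).
by rewrite exprS; apply: hM.
Qed.

End AlgebraInduction.

Section Evaluation.
Variables (k : closedFieldType) (n : nat).
Implicit Types (F : {mpoly k[n.+1]}) (v w : 'cV[k]_n.+1).
Implicit Types (P : k -> 'cV[k]_n.+1).

Definition polypath m (P : k -> 'cV[k]_m) : Prop :=
  forall i, polyfun (fun t => P t i 0).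

Definition pathjet m (P : k -> 'cV[k]_m) (p w : 'cV[k]_m) : Prop :=
  forall i, jet (fun t => P t i 0) (p i 0) (w i 0).

Definition diff F v w : k := \sum_i w i 0 * peval F^`M(i) v.

Lemma pevalD F G v : peval (F + G) v = peval F v + peval G v.
Proof. exact: mevalD. Qed.
Lemma pevalM F G v : peval (F * G) v = peval F v * peval G v.
Proof. exact: mevalM. Qed.
Lemma pevalC c v : peval c%:MP v = c.
Proof. exact: mevalC. Qed.
Lemma pevalX i v : peval 'X_i v = v i 0.
Proof. exact: mevalXU. Qed.

Lemma polyfun_peval F P : polypath P -> polyfun (fun t => peval F (P t)).
Proof.
move=> hP; elim/mpoly_algebra_ind: F => [c|i|F G hF hG|F G hF hG].
- by apply: polyfun_eq (polyfunC c) => t; rewrite pevalC.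
- by apply: polyfun_eq (hP i) => t; rewrite pevalX.
- by apply: polyfun_eq (polyfunD hF hG) => t; rewrite pevalD.
- by apply: polyfun_eq (polyfunM hF hG) => t; rewrite pevalM.
Qed.

Lemma diffD F G v w : diff (F + G) v w = diff F v w + diff G v w.
Proof.
by rewrite -big_split; apply: eq_bigr => i _; rewrite mderivD pevalD mulrDr.
Qed.

Lemma diffM F G v w :
  diff (F * G) v w = peval F v * diff G v w + diff F v w * peval G v.
Proof.
rewrite mulr_sumr mulr_suml -big_split /=; apply: eq_bigr => i _.
by rewrite mderivM pevalD !pevalM; ring.
Qed.

Lemma diffC c v w : diff c%:MP v w = 0.
Proof. by rewrite /diff big1 // => i _; rewrite mderivC pevalC mulr0. Qed.

Lemma diffX i v w : diff 'X_i v w = w i 0.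
Proof.
rewrite /diff (bigD1 i) //= big1 => [|j ji]; rewrite mderivX mnm1E.
  rewrite eqxx scale1r -[X in (X - _)%MM]add0m addmK addr0.
  by rewrite mpolyX0 (_ : peval 1 v = 1) ?mulr1 //; apply: meval1.
by rewrite eq_sym (negPf ji) scale0r (_ : peval 0 v = 0) ?mulr0 //; apply: meval0.
Qed.

(** The chain rule along a polynomial path. *)
Lemma jet_peval F P p w :
  pathjet P p w -> jet (fun t => peval F (P t)) (peval F p) (diff F p w).
Proof.
move=> hP; elim/mpoly_algebra_ind: F => [c|i|F G hF hG|F G hF hG].
- by rewrite pevalC diffC; apply: jet_eq (jetC c) => t; rewrite pevalC.
- by rewrite pevalX diffX; apply: jet_eq (hP i) => t; rewrite pevalX.
- by rewrite pevalD diffD; apply: jet_eq (jetD hF hG) => t; rewrite pevalD.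
- by rewrite pevalM diffM; apply: jet_eq (jetM hF hG) => t; rewrite pevalM.
Qed.

Lemma mderiv_homog F d i : F \is d.-homog -> F^`M(i) \is d.-1.-homog.
Proof.
move=> /dhomogP hF; apply/dhomogP => m; rewrite mcoeff_msupp mcoeff_mderiv.
move=> nz; have : (m + U_(i))%MM \in msupp F.
  by rewrite mcoeff_msupp; apply: contraNneq nz => ->; rewrite mul0rn.
by move/hF => /= <-; rewrite mdegD mdeg1 addn1.
Qed.

Lemma peval_homogZ F d c v :
  F \is d.-homog -> peval F (c *: v) = c ^+ d * peval F v.
Proof.
move=> /dhomogP hF; rewrite /peval !mevalE mulr_sumr big_seq [RHS]big_seq.
apply: eq_bigr => m /hF hm; rewrite mulrCA; congr (_ * _).
have -> : c ^+ d = \prod_(i < n.+1) c ^+ m i.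
  by rewrite -hm /= mdegE; elim/big_rec2: _ => // i x y _ <-; rewrite exprD.
by rewrite -big_split /=; apply: eq_bigr => i _; rewrite mxE exprMn.
Qed.

End Evaluation.

Lemma coef_mul_top (R : nzRingType) (p q : {poly R}) d e :
  (size p <= d.+1)%N -> (size q <= e.+1)%N -> (p * q)`_(d + e) = p`_d * q`_e.
Proof.
move=> sp sq; have lt_d : (d < (d + e).+1)%N by rewrite ltnS leq_addr.
rewrite coefM (bigD1 (Ordinal lt_d)) //= addKn big1 ?addr0 // => i id.
have [lt|ge] := ltnP d i.
  by rewrite nth_default ?mul0r //; apply: leq_trans sp lt.
rewrite [q`__]nth_default ?mulr0 //; apply: leq_trans sq _.
have ltid : (i < d)%N.
  by rewrite ltn_neqAle ge andbT; apply: contra id => /eqP id; apply/eqP/val_inj.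
lia.
Qed.

Section FormOnLine.
Variables (k A : comNzRingType) (iota : {rmorphism k -> A}) (n : nat).

(** The restriction of F to the line through a and b. When F is a form of degree d,
  the coefficient of degree d is the value at b, the point at infinity. The
  coefficients are extended along iota so that a and b may depend on a
  parameter. *)
Definition line_poly (a b : 'I_n -> A) (F : {mpoly k[n]}) : {poly A} :=
  mmap (polyC \o iota) (fun i => (a i)%:P + b i *: 'X) F.

Let degle (p : {poly A}) e c := (size p <= e.+1)%N /\ p`_e = c.

Let degleM p q e e' c c' :
  degle p e c -> degle q e' c' -> degle (p * q) (e + e') (c * c').
Proof.
move=> [sp pe] [sq qe]; split.
  apply: leq_trans (size_polyMleq _ _) _.
  rewrite -subn1 leq_subLR add1n -addSn -addnS; exact: leq_add.
by rewrite coef_mul_top // pe qe.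
Qed.

Let degleD p q e c c' :
  degle p e c -> degle q e c' -> degle (p + q) e (c + c').
Proof.
move=> [sp pe] [sq qe]; split; last by rewrite coefD pe qe.
by apply: leq_trans (size_polyD _ _) _; rewrite geq_max sp sq.
Qed.

Let degleC c : degle c%:P 0 c.
Proof. by split; [exact: size_polyC_leq1 | rewrite coefC]. Qed.

Lemma line_poly_homog a b F d : F \is d.-homog ->
  (size (line_poly a b F) <= d.+1)%N /\ (line_poly a b F)`_d = mmap iota b F.
Proof.
move=> /dhomogP hF; rewrite -/(degle _ _ _) /line_poly /mmap.
rewrite big_seq [X in degle _ _ X]big_seq.
elim/big_ind2: _ => [|p c q c' hp hq|m /hF /= hm].
- by split; rewrite ?size_poly0 ?coef0.
- exact: degleD.
rewrite -hm -[mdeg m]add0n; apply: degleM; first exact: degleC.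
rewrite /mmap1 mdegE; elim/big_rec3: _ => [|i p c e _ IH]; first exact: degleC.
apply: degleM IH; elim: (m i) => [|j IH]; first exact: degleC.
rewrite !exprS -add1n; apply: degleM IH; split.
  apply: leq_trans (size_polyD _ _) _; rewrite geq_max.
  rewrite (leq_trans (size_polyC_leq1 _)) //=.
  by apply: leq_trans (size_scale_leq _ _) _; rewrite size_polyX.
by rewrite coefD coefC coefZ coefX /= add0r mulr1.
Qed.

End FormOnLine.

Lemma rmorph_mmap (k A B : comNzRingType) (phi : {rmorphism A -> B})
    (iota : {rmorphism k -> A}) n (h : 'I_n -> A) (F : {mpoly k[n]}) :
  phi (mmap iota h F) = mmap (phi \o iota) (fun i => phi (h i)) F.
Proof.
elim/mpoly_algebra_ind: F => [c|i|F G hF hG|F G hF hG].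
- by rewrite !mmapC.
- by rewrite !mmapX !mmap1U.
- by rewrite !mmapD rmorphD hF hG.
- by rewrite !rmorphM /= hF hG.
Qed.

(** * Proportional vectors and forms *)

(** Equality of points of projective space, by the vanishing of the 2 x 2 minors.
  These are polynomials, so the relation passes to limits; it is vacuous when one
  of the vectors is 0. *)
Definition collinear (R : comNzRingType) m (a b : 'cV[R]_m) : Prop :=
  forall i j, a i 0 * b j 0 = a j 0 * b i 0.

Section Collinear.
Variables (k : fieldType) (m : nat).
Implicit Types (a b c : 'cV[k]_m).

Lemma collinear_sym a b : collinear a b -> collinear b a.
Proof. by move=> h i j; rewrite mulrC -h mulrC. Qed.

Lemma collinear_refl a : collinear a a.
Proof. by move=> i j; rewrite mulrC. Qed.

Lemma collinear0 a : collinear 0 a.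
Proof. by move=> i j; rewrite !mxE !mul0r. Qed.

Lemma collinearZ x a b : collinear a b -> collinear (x *: a) b.
Proof. by move=> h i j; rewrite !mxE -!mulrA h. Qed.

Lemma cV_neq0 a : a != 0 -> exists i, a i 0 != 0.
Proof.
move=> a0; apply/existsP; apply: contraNT a0; rewrite negb_exists => /forallP h.
apply/eqP/matrixP => i j; rewrite mxE (ord1 j); apply/eqP.
by move: (h i); rewrite negbK.
Qed.

Lemma collinearP a b : b != 0 -> collinear a b -> exists x, a = x *: b.
Proof.
move=> /cV_neq0[i bi] h; exists (a i 0 / b i 0); apply/matrixP => j l.
by rewrite (ord1 l) mxE; apply: (mulIf bi); rewrite mulrAC divfK.
Qed.

Lemma collinearP_neq0 a b : b != 0 -> a != 0 -> collinear a b ->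
  exists2 x, x != 0 & a = x *: b.
Proof.
move=> b0 a0 /(collinearP b0)[x ax]; exists x => //.
by apply: contraNneq a0 => x0; rewrite ax x0 scale0r.
Qed.

Lemma collinear_trans b a c : b != 0 ->
  collinear a b -> collinear b c -> collinear a c.
Proof. by move=> b0 /(collinearP b0)[x ->]; apply: collinearZ. Qed.

Lemma collinearZ_neq0 x a b : x != 0 -> collinear (x *: a) b -> collinear a b.
Proof.
move=> x0 h; rewrite -[a]scale1r -(mulVf x0) -scalerA; exact: collinearZ.
Qed.

End Collinear.

Section Forms.
Variables (k : closedFieldType) (n : nat).
Implicit Types (g h : 'cV[k]_n.+1 -> k).

(** Forms are identified with the functions that they define. This loses nothing
  because k is infinite, and it makes equality of forms a pointwise statement. *)
Definition formfun d g : Prop :=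
  exists2 F : {mpoly k[n.+1]}, F \is d.-homog & forall v, peval F v = g v.

Lemma formfun_eq d g h : (forall v, g v = h v) -> formfun d g -> formfun d h.
Proof. by move=> gh [F hF eF]; exists F => // v; rewrite eF. Qed.

Lemma formfunC c : formfun 0 (fun=> c).
Proof.
exists c%:MP => [|v]; last exact: pevalC.
by rewrite -[_%:MP]mulr1 mul_mpolyC dhomogZ ?dhomog1.
Qed.

Lemma formfun_coord i : formfun 1 (fun v => v i 0).
Proof. by exists 'X_i => [|v]; rewrite ?pevalX // dhomogX /= mdeg1. Qed.

Lemma formfunD d g h : formfun d g -> formfun d h -> formfun d (fun v => g v + h v).
Proof.
by move=> [F hF eF] [G hG eG]; exists (F + G) => [|v]; rewrite ?dhomogD // pevalD eF eG.
Qed.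

Lemma formfunM d e g h :
  formfun d g -> formfun e h -> formfun (d + e) (fun v => g v * h v).
Proof.
move=> [F hF eF] [G hG eG]; exists (F * G) => [|v]; last by rewrite pevalM eF eG.
exact: dhomogM.
Qed.

Lemma formfun0 d : formfun d (fun=> 0).
Proof. by exists 0 => [|v]; [apply: dhomog0 | apply: meval0]. Qed.

Lemma formfunZ d c g : formfun d g -> formfun d (fun v => c * g v).
Proof. by move=> hg; rewrite -[d]add0n; apply: formfunM hg; apply: formfunC. Qed.

Lemma formfunN d g : formfun d g -> formfun d (fun v => - g v).
Proof. by move=> /(formfunZ (-1)); apply: formfun_eq => v; rewrite mulN1r. Qed.

Lemma formfunB d g h : formfun d g -> formfun d h -> formfun d (fun v => g v - h v).
Proof. by move=> hg /formfunN; apply: formfunD. Qed.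

Lemma formfun_sum d (I : Type) (r : seq I) (P : pred I) (G : I -> _ -> k) :
  (forall i, formfun d (G i)) -> formfun d (fun v => \sum_(i <- r | P i) G i v).
Proof.
move=> hG; elim: r => [|i r IH].
  by apply: formfun_eq (formfun0 d) => v; rewrite big_nil.
case Pi: (P i); last by apply: formfun_eq IH => t; rewrite big_cons Pi.
by apply: formfun_eq (formfunD (hG i) IH) => t; rewrite big_cons Pi.
Qed.

Lemma formfun_prod d (I : finType) (P : pred I) (G : I -> _ -> k) :
  (forall i, formfun d (G i)) ->
  formfun (d * #|P|) (fun v => \prod_(i | P i) G i v).
Proof.
move=> hG; rewrite -sum1_card big_distrr /=.
suff hs (r : seq I) :
    formfun (\sum_(i <- r | P i) d * 1)%N (fun v => \prod_(i <- r | P i) G i v).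
  by have := hs (index_enum I).
elim: r => [|i r IH].
  by rewrite big_nil; apply: formfun_eq (formfunC 1) => v; rewrite big_nil.
rewrite big_cons; case Pi: (P i).
  have hGi : formfun (d * 1) (G i) by rewrite muln1.
  by apply: formfun_eq (formfunM hGi IH) => v; rewrite big_cons Pi.
by apply: formfun_eq IH => v; rewrite big_cons Pi.
Qed.

Lemma formfun_mulmx m (M : 'M[k]_(m, n.+1)) i : formfun 1 (fun v => (M *m v) i 0).
Proof.
apply: (@formfun_eq _ (fun v => \sum_j M i j * v j 0)) => [v|].
  by rewrite mxE.
by apply: formfun_sum => j; apply/formfunZ/formfun_coord.
Qed.

Lemma formfun_homog d g c v : formfun d g -> g (c *: v) = c ^+ d * g v.
Proof. by move=> [F hF eF]; rewrite -!eF (peval_homogZ _ _ hF). Qed.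

Lemma polyfun_formfun d g (P : k -> 'cV[k]_n.+1) :
  formfun d g -> polypath P -> polyfun (fun t => g (P t)).
Proof. by move=> [F _ eF] hP; apply: polyfun_eq (polyfun_peval F hP). Qed.

Lemma formfun_scale d g : formfun d g -> forall v w, v != 0 ->
  collinear w v -> g v = 0 -> g w = 0.
Proof.
move=> hg v w v0 /(collinearP v0)[x ->] gv.
by rewrite (formfun_homog _ _ hg) gv mulr0.
Qed.

Lemma polypath_line m (a b : 'cV[k]_m) : polypath (fun t => a + t *: b).
Proof.
move=> i; apply: (@polyfun_eq _ (fun t => a i 0 + t * b i 0)) => [t|].
  by rewrite !mxE.
by apply/polyfunD/polyfunM; [apply: polyfunC | apply: polyfunX | apply: polyfunC].
Qed.

End Forms.

(** Two forms are both nonzero at a general point of a line that joins a point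
  where the first is nonzero to a point where the second is. *)
Lemma formfun_common_nonzero (k : closedFieldType) n d e
    (g h : 'cV[k]_n.+1 -> k) :
  formfun d g -> formfun e h ->
  (exists v, g v != 0) -> (exists v, h v != 0) -> exists v, g v * h v != 0.
Proof.
move=> hg hh [a ga] [b hb]; have pl := polypath_line a (b - a).
have gg : generically (fun t => g (a + t *: (b - a)) != 0).
  apply: polyfun_generic (polyfun_formfun hg pl) _.
  by exists 0; rewrite scale0r addr0.
have gh : generically (fun t => h (a + t *: (b - a)) != 0).
  apply: polyfun_generic (polyfun_formfun hh pl) _.
  by exists 1; rewrite scale1r addrC subrK.
have [t [gt ht]] := generically_ex (generically_and gg gh).
by exists (a + t *: (b - a)); rewrite mulf_neq0.
Qed.

(** * Linear forms and quadratic forms *)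

Section LinearForms.
Variables (k : fieldType) (m : nat).
Implicit Types (E : {vspace 'cV[k]_m}) (v n : 'cV[k]_m) (xi : 'rV[k]_m).

Definition lform xi v : k := (xi *m v) 0 0.

Lemma lformD xi v w : lform xi (v + w) = lform xi v + lform xi w.
Proof. by rewrite /lform mulmxDr mxE. Qed.
Lemma lformZ xi c v : lform xi (c *: v) = c * lform xi v.
Proof. by rewrite /lform -scalemxAr mxE. Qed.
Lemma lform0 xi : lform xi 0 = 0.
Proof. by rewrite /lform mulmx0 mxE. Qed.
Lemma lformB xi v w : lform xi (v - w) = lform xi v - lform xi w.
Proof. by rewrite /lform mulmxBr !mxE. Qed.

Lemma cV_sum v : v = \sum_i v i 0 *: delta_mx i 0.
Proof.
apply/matrixP => i j; rewrite (ord1 j) summxE (bigD1 i) //= big1 => [|l li].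
  by rewrite !mxE !eqxx mulr1 addr0.
by rewrite !mxE eq_sym (negPf li) mulr0.
Qed.

Lemma lform_of (l : 'cV[k]_m -> k) :
  (forall v w, l (v + w) = l v + l w) -> (forall c v, l (c *: v) = c * l v) ->
  exists xi, forall v, lform xi v = l v.
Proof.
move=> lD lZ; exists (\row_j l (delta_mx j 0)) => v.
have l0 : l 0 = 0 by rewrite -[0 in LHS](scale0r 0) lZ mul0r.
rewrite [in RHS](cV_sum v) (big_morph l lD l0) /lform mxE.
by apply: eq_bigr => j _; rewrite mxE lZ mulrC.
Qed.

Lemma separating_form E n : n \notin E ->
  exists2 xi, forall v, v \in E -> lform xi v = 0 & lform xi n = 1.
Proof.
move=> nE; have n0 : n != 0 by apply: contraNneq nE => ->; rewrite mem0v.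
have [i ni] := cV_neq0 n0.
have disj : (<[n]> :&: E = 0)%VS.
  apply/eqP; rewrite -subv0; apply/subvP => v; rewrite memv_cap memv0.
  case/andP=> /vlineP[c ->] cE; apply: contraR nE.
  rewrite scaler_eq0 negb_or => /andP[c0 _].
  by rewrite -[n]scale1r -(mulVf c0) -scalerA memvZ.
pose pr := daddv_pi <[n]> E.
have [xi hxi] : exists xi, forall v, lform xi v = (pr v) i 0 / n i 0.
  apply: lform_of => [v w|c v]; first by rewrite linearD mxE mulrDl.
  by rewrite linearZ mxE mulrA.
exists xi => [v vE|].
  have disj' : (E :&: <[n]> = 0)%VS by rewrite capvC.
  have := daddv_pi_add disj (subvP (addvSr _ E) _ vE).
  rewrite (daddv_pi_id disj' vE) -/pr => /(canRL (addrK _)).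
  by rewrite subrr => prv; rewrite hxi prv mxE mul0r.
by rewrite hxi /pr daddv_pi_id ?memv_line // divff.
Qed.

Lemma dim_add_vector E n : n \notin E -> \dim (E + <[n]>)%VS = (\dim E).+1.
Proof.
move=> nE; have n0 : n != 0 by apply: contraNneq nE => ->; rewrite mem0v.
rewrite dimv_disjoint_sum ?dim_vline ?n0 ?addn1 //.
apply/eqP; rewrite -subv0; apply/subvP => v; rewrite memv_cap memv0.
case/andP=> vE /vlineP[c def_v]; move: vE; rewrite def_v => vE.
apply: contraR nE; rewrite scaler_eq0 negb_or => /andP[c0 _].
by rewrite -[n]scale1r -(mulVf c0) -scalerA memvZ.
Qed.

Lemma mem_add_vector E n v : v \in (E + <[n]>)%VS ->
  exists2 e, e \in E & exists r, v = e + r *: n.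
Proof. by case/memv_addP=> e eE [_ /vlineP[r ->] ->]; exists e => //; exists r. Qed.

Lemma dim_plane_basis E : \dim E = 2%N -> exists a b,
  [/\ a != 0, b \notin <[a]>%VS & E = (<[a]> + <[b]>)%VS].
Proof.
move=> dE; have E0 : E != 0%VS by rewrite -dimv_eq0 dE.
have a0 : vpick E != 0 by rewrite vpick0.
have aE : (<[vpick E]> <= E)%VS by rewrite -memvE memv_pick.
have : ~~ (E <= <[vpick E]>)%VS.
  by apply/negP => /dimvS; rewrite dE dim_vline a0.
case/subvPn => b bE b_a; exists (vpick E), b; split=> //.
apply/esym/eqP; rewrite eqEdim subv_add aE -memvE bE /=.
by rewrite dim_add_vector // dim_vline a0 dE.
Qed.

Lemma vspace_fullP E : \dim E = m -> forall v, v \in E.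
Proof.
move=> dE v; suff -> : E = fullv by rewrite memvf.
by apply/eqP; rewrite eqEdim subvf dimvf /dim /= dE muln1.
Qed.

End LinearForms.

Section Bilinear.
Variables (k : closedFieldType) (two_neq0 : 2%:R != 0 :> k) (m : nat).
Implicit Types (B : 'cV[k]_m -> 'cV[k]_m -> k) (a b c v w z : 'cV[k]_m).

Record symmetric_bilinear B : Prop := SymmetricBilinear {
  bil_sym : forall a b, B a b = B b a;
  bil_Dl : forall a b c, B (a + b) c = B a c + B b c;
  bil_Zl : forall x a b, B (x *: a) b = x * B a b }.

Lemma exists_sqrt (x : k) : exists y, y ^+ 2 = x.
Proof.
have [|y] := closed_rootP ('X^2 - x%:P) _; first by rewrite size_XnsubC.
by rewrite /root !hornerE subr_eq0 => /eqP <-; exists y.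
Qed.

Variables (B : 'cV[k]_m -> 'cV[k]_m -> k) (HB : symmetric_bilinear B).

Lemma bil_Dr a b c : B a (b + c) = B a b + B a c.
Proof. by rewrite !(bil_sym HB a) (bil_Dl HB). Qed.
Lemma bil_Zr x a b : B a (x *: b) = x * B a b.
Proof. by rewrite !(bil_sym HB a) (bil_Zl HB). Qed.

Definition bilE := (bil_Dl HB, bil_Zl HB, bil_Dr, bil_Zr).

(** The discriminant of the restriction of B to the span of v and w; it is
  nonzero for some v and w exactly when the quadratic form has rank at least
  two. *)
Definition disc v w : k := B v w ^+ 2 - B v v * B w w.

(** The two isotropic vectors are the roots of the restriction of B to the plane of
  v and w, which are distinct because the discriminant is a nonzero square. *)
Lemma hyperbolic_pair v w : disc v w != 0 ->
  exists a b, [/\ B a a = 0, B b b = 0 & B a b != 0].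
Proof.
rewrite /disc => D0; have [vv0|vv0] := eqVneq (B v v) 0.
  have vw0 : B v w != 0.
    by apply: contraNneq D0 => ->; rewrite vv0 mul0r expr0n subr0.
  exists v, (w + (- (B w w) / (2%:R * B v w)) *: v).
  have vw' : B v (w + (- B w w / (2%:R * B v w)) *: v) = B v w.
    by rewrite !bilE vv0 mulr0 addr0.
  split=> //; last by rewrite vw'.
  rewrite !bilE vv0 (bil_sym HB w v); field; exact/andP.
have [d dD] := exists_sqrt (B v w ^+ 2 - B v v * B w w).
have d0 : d != 0 by apply: contraNneq D0 => d0; rewrite -dD d0 expr0n.
exists (w + ((- B v w + d) / B v v) *: v), (w + ((- B v w - d) / B v v) *: v).
have D2 : B w w = (B v w ^+ 2 - d ^+ 2) / B v v.
  by apply: (mulIf vv0); rewrite divfK // dD; ring.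
split; rewrite !bilE (bil_sym HB w v) D2.
- by field.
- by field.
rewrite [X in X != 0](_ : _ = - (2%:R * d ^+ 2 / B v v)); last by field.
by rewrite oppr_eq0 !mulf_neq0 ?invr_eq0 ?expf_neq0.
Qed.

Lemma orthogonal_part a b z : B a a = 0 -> B b b = 0 -> B a b != 0 ->
  exists c, [/\ B a c = 0, B b c = 0 &
    exists x y, z = x *: a + y *: b + c].
Proof.
move=> aa bb ab.
exists (z - ((B z b / B a b) *: a + (B z a / B a b) *: b)); split.
- rewrite -scaleN1r !bilE aa (bil_sym HB a z); field; exact: ab.
- rewrite -scaleN1r !bilE bb (bil_sym HB b z) (bil_sym HB b a); field; exact: ab.
by exists (B z b / B a b), (B z a / B a b); rewrite addrC subrK.
Qed.

End Bilinear.

(** * Symmetric trilinear forms *)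

Lemma mulf_cancel0 (R : idomainType) (a b : R) : a != 0 -> a * b = 0 -> b = 0.
Proof. by move=> a0 /eqP; rewrite mulf_eq0 (negPf a0) => /eqP. Qed.

Lemma lin_comb2 (R : comNzRingType) (a b c x y : R) :
  a = 0 -> b = 0 -> c = x * a + y * b -> c = 0.
Proof. by move=> -> -> ->; rewrite !mulr0 addr0. Qed.

Section Trilinear.
Variables (k : closedFieldType) (n : nat).
Notation V := 'cV[k]_n.+1.

Record symmetric_trilinear (T : V -> V -> V -> k) : Prop := SymmetricTrilinear {
  tri12 : forall a b c, T a b c = T b a c;
  tri23 : forall a b c, T a b c = T a c b;
  triD1 : forall a b c d, T (a + b) c d = T a c d + T b c d;
  triZ1 : forall x a b c, T (x *: a) b c = x * T a b c }.

Variables (T : V -> V -> V -> k) (HT : symmetric_trilinear T).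

Lemma triD2 a b c d : T a (b + c) d = T a b d + T a c d.
Proof. by rewrite !(tri12 HT a) (triD1 HT). Qed.
Lemma triD3 a b c d : T a b (c + d) = T a b c + T a b d.
Proof. by rewrite !(tri23 HT a b) triD2. Qed.
Lemma triZ2 x a b c : T a (x *: b) c = x * T a b c.
Proof. by rewrite !(tri12 HT a) (triZ1 HT). Qed.
Lemma triZ3 x a b c : T a b (x *: c) = x * T a b c.
Proof. by rewrite !(tri23 HT a b) triZ2. Qed.
Lemma tri01 a b : T 0 a b = 0.
Proof. by rewrite -(scale0r 0) (triZ1 HT) mul0r. Qed.
Lemma tri13 a b c : T a b c = T c b a.
Proof. by rewrite (tri12 HT) (tri23 HT) (tri12 HT). Qed.
Lemma tri_rot a b c : T a b c = T b c a.
Proof. by rewrite (tri12 HT) (tri23 HT). Qed.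

Definition triE := (triD1 HT, triZ1 HT, triD2, triZ2, triD3, triZ3).

Lemma tri_bilinear a : symmetric_bilinear (T a).
Proof. by split; [apply: tri23 | move=> b c d; rewrite triD2 | move=> x b c; rewrite triZ2]. Qed.

Lemma tri_cubeD a b :
  T (a + b) (a + b) (a + b) =
  T a a a + 3%:R * T a a b + 3%:R * T a b b + T b b b.
Proof.
rewrite !triE (tri13 b a a) (tri23 HT a b a) (tri12 HT b a b) (tri13 b b a).
by ring.
Qed.

Lemma tri_sum1 a b c : T a b c = \sum_i a i 0 * T (delta_mx i 0) b c.
Proof.
rewrite {1}(cV_sum a) (big_morph (fun x => T x b c) (fun x y => triD1 HT x y b c) (tri01 b c)).
by apply: eq_bigr => i _; rewrite (triZ1 HT).
Qed.

Lemma tri_sum2 a b c : T a b c = \sum_i b i 0 * T a (delta_mx i 0) c.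
Proof.
by rewrite (tri12 HT) tri_sum1; apply: eq_bigr => i _; rewrite (tri12 HT).
Qed.

Lemma tri_sum3 a b c : T a b c = \sum_i c i 0 * T a b (delta_mx i 0).
Proof.
by rewrite (tri23 HT) tri_sum2; apply: eq_bigr => i _; rewrite (tri23 HT).
Qed.

Lemma polyfun_tri (P Q R : k -> V) : polypath P -> polypath Q -> polypath R ->
  polyfun (fun t => T (P t) (Q t) (R t)).
Proof.
move=> hP hQ hR; apply: (@polyfun_eq _ (fun t => \sum_i P t i 0 *
   \sum_j Q t j 0 * \sum_l R t l 0 * T (delta_mx i 0) (delta_mx j 0) (delta_mx l 0))).
  move=> t; rewrite tri_sum1; apply: eq_bigr => i _; congr (_ * _).
  by rewrite tri_sum2; apply: eq_bigr => j _; rewrite -tri_sum3.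
apply: polyfun_sum => i; apply: polyfunM (hP i) _.
apply: polyfun_sum => j; apply: polyfunM (hQ j) _.
by apply: polyfun_sum => l; apply: polyfunM (hR l) _; apply: polyfunC.
Qed.

Definition formmap m d (F : 'cV[k]_m.+1 -> V) : Prop :=
  forall i, formfun d (fun v => F v i 0).

Lemma formfun_tri m d1 d2 d3 (F G H : 'cV[k]_m.+1 -> V) :
  formmap d1 F -> formmap d2 G -> formmap d3 H ->
  formfun (d1 + (d2 + d3)) (fun v => T (F v) (G v) (H v)).
Proof.
move=> hF hG hH; apply: (@formfun_eq _ _ _ (fun v => \sum_i F v i 0 *
   \sum_j G v j 0 * \sum_l H v l 0 * T (delta_mx i 0) (delta_mx j 0) (delta_mx l 0))).
  move=> v; rewrite tri_sum1; apply: eq_bigr => i _; congr (_ * _).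
  by rewrite tri_sum2; apply: eq_bigr => j _; rewrite -tri_sum3.
apply: formfun_sum => i; apply: formfunM (hF i) _.
apply: formfun_sum => j; apply: formfunM (hG j) _.
apply: formfun_sum => l; rewrite -[d3]addn0; apply: formfunM (hH l) _.
exact: formfunC.
Qed.

Lemma formmap_id : formmap 1 (fun v : V => v).
Proof. by move=> i; apply: formfun_coord. Qed.

Lemma formmap_cst m (c : V) : formmap 0 (fun _ : 'cV[k]_m.+1 => c).
Proof. by move=> i; apply: formfunC. Qed.

Lemma formmapD m d (F G : 'cV[k]_m.+1 -> V) :
  formmap d F -> formmap d G -> formmap d (fun v => F v + G v).
Proof.
by move=> hF hG i; apply: formfun_eq (formfunD (hF i) (hG i)) => v; rewrite mxE.
Qed.

Lemma formmapZ m d e (g : 'cV[k]_m.+1 -> k) (F : 'cV[k]_m.+1 -> V) :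
  formfun d g -> formmap e F -> formmap (d + e) (fun v => g v *: F v).
Proof.
by move=> hg hF i; apply: formfun_eq (formfunM hg (hF i)) => v; rewrite mxE.
Qed.

Lemma formfun_lform xi : formfun 1 (fun v : V => lform xi v).
Proof. exact: formfun_mulmx. Qed.

Lemma pathjet_expand m (P : k -> 'cV[k]_m) p w : pathjet P p w ->
  exists2 R, polypath R & forall t, P t = p + t *: (w + t *: R t).
Proof.
move=> /fin_all_exists[q hq]; exists (fun t => \col_i (q i).[t]) => [i|t].
  by exists (q i) => t; rewrite mxE.
by apply/matrixP => i j; rewrite (ord1 j) !mxE hq; ring.
Qed.

Lemma polypathD m (P Q : k -> 'cV[k]_m) :
  polypath P -> polypath Q -> polypath (fun t => P t + Q t).
Proof.
by move=> hP hQ i; apply: polyfun_eq (polyfunD (hP i) (hQ i)) => t; rewrite mxE.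
Qed.

Lemma polypathZ m g (P : k -> 'cV[k]_m) :
  polyfun g -> polypath P -> polypath (fun t => g t *: P t).
Proof.
by move=> hg hP i; apply: polyfun_eq (polyfunM hg (hP i)) => t; rewrite mxE.
Qed.

Lemma polypathC m (c : 'cV[k]_m) : polypath (fun=> c).
Proof. by move=> i; apply: polyfunC. Qed.

Lemma jet_tri_cube (P : k -> V) p w : pathjet P p w ->
  jet (fun t => T (P t) (P t) (P t)) (T p p p) (3%:R * T p p w).
Proof.
move=> /pathjet_expand[R hR eP]; pose u t := w + t *: R t.
have hu : polypath u.
  by apply: polypathD (polypathC _) (polypathZ (polyfunX _) hR).
have [q hq] : polyfun (fun t => 3%:R * T p p (R t) + 3%:R * T p (u t) (u t)
    + t * T (u t) (u t) (u t)).
  apply: polyfunD; last by apply: polyfunM (polyfunX _) (polyfun_tri _ _ _).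
  by apply: polyfunD; apply: polyfunM (polyfunC _) _; apply: polyfun_tri => //;
    apply: polypathC.
exists q => t; rewrite -hq eP -/(u t) tri_cubeD !triE.
by ring.
Qed.

Lemma pathjet_line m (p w : 'cV[k]_m) : pathjet (fun t => p + t *: w) p w.
Proof. by move=> i; apply: jet_eq (jet_affine (p i 0) (w i 0)) => t; rewrite !mxE. Qed.

End Trilinear.

(** * Cubic threefolds with a double line *)

Section DoubleLine.
Variables (k : closedFieldType) (char0 : [pchar k] =i pred0).
Notation V := 'cV[k]_5.
Implicit Types (T : V -> V -> V -> k) (E W : {vspace V}) (a b c n p v w x y z : V).

Lemma natS_neq0 m : m.+1%:R != 0 :> k.
Proof. by move/pcharf0P: char0 => ->. Qed.

(** The cubic form is v |-> T v v v; X is its zero set and P(W) the double line.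
  The second field is the irreducibility of X, and the third says that X is not a
  cone. The last one says that P(W) is a component of the singular locus: the plane
  spanned by P(W) and a further singular point z is not singular. Indeed the
  derivatives of the cubic form at x + c z, with x in W, are multiples of the
  products T x z v. *)
Record double_line_cubic T W : Prop := DoubleLineCubic {
  dl_tri : symmetric_trilinear T;
  dl_irr : forall d e g h, formfun d g -> formfun e h ->
    (forall v, T v v v = 0 -> g v * h v = 0) ->
    (forall v, T v v v = 0 -> g v = 0) \/ (forall v, T v v v = 0 -> h v = 0);
  dl_cone : forall w, w != 0 -> exists y, T w y y != 0;
  dl_dim : \dim W = 2%N;
  dl_sing : forall w w' v, w \in W -> w' \in W -> T w w' v = 0;
  dl_component : forall z, z \notin W -> (forall v, T z z v = 0) ->
    exists x v, x \in W /\ T x z v != 0 }.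

Variables (T : V -> V -> V -> k) (W : {vspace V}).
Hypothesis HX : double_line_cubic T W.
Let HT := dl_tri HX.
Let TE := triE HT.

Lemma tri_polarize E : (forall v, v \in E -> T v v v = 0) ->
  forall v w, v \in E -> w \in E -> T v w w = 0.
Proof.
move=> h v w vE wE; have h1 := h _ (memvD vE wE).
have h2 := h _ (memvB vE wE).
move: h1 h2; rewrite -scaleN1r !(tri_cubeD HT) !TE (h v vE) (h w wE) => h1 h2.
apply: (mulf_cancel0 (natS_neq0 5)); apply: (lin_comb2 h1 h2 (x := 1) (y := 1)).
by ring.
Qed.

(** If X contained a hyperplane it would be equal to it, and the cubic form
  would be a cube; then X would be a cone. *)
Lemma no_hyperplane E : \dim E = 4%N -> (forall v, v \in E -> T v v v = 0) -> False.
Proof.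
move=> dE fE.
have [n nE] : exists n, n \notin E.
  apply: NNPP => no; have : \dim E = 5%N.
    suff -> : E = fullv by rewrite dimvf.
    apply/eqP; rewrite eqEsubv subvf; apply/subvP => v _.
    by apply: contraT => vE; case: no; exists v.
  by rewrite dE.
have [l lE ln] := separating_form nE.
pose v0 v := v - lform l v *: n.
have v0E v : v0 v \in E.
  have : v \in (E + <[n]>)%VS by apply: vspace_fullP; rewrite dim_add_vector ?dE.
  case/mem_add_vector=> e eE [r ->].
  by rewrite /v0 lformD lformZ ln lE // add0r mulr1 addrK.
have v0n v : v = v0 v + lform l v *: n by rewrite subrK.
have lin v : v \in E -> forall t, T (v + t *: n) (v + t *: n) (v + t *: n) =
    t * (3%:R * T v v n + 3%:R * t * T v n n + t ^+ 2 * T n n n).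
  by move=> vE t; rewrite (tri_cubeD HT) !TE fE //; ring.
pose g v := 3%:R * T (v0 v) (v0 v) n + 3%:R * (lform l v * T (v0 v) n n) +
  lform l v * (lform l v * T n n n).
have fg v : T v v v = lform l v * g v.
  by rewrite {1 2 3}(v0n v) lin // /g; ring.
have fl : formfun 1 (fun v : V => lform l v) by apply: formfun_lform.
have fv0 : formmap 1 v0.
  move=> i; apply: (@formfun_eq _ _ _ (fun v => v i 0 - n i 0 * lform l v)).
    by move=> v; rewrite !mxE mulrC.
  by apply: formfunB (formfun_coord _ _) (formfunZ _ fl).
have fn : formmap 0 (fun _ : V => n) by apply: formmap_cst.
have fgf : formfun 2 g.
  apply: formfunD; first apply: formfunD.
  - exact: formfunZ (formfun_tri HT fv0 fv0 fn).
  - exact: formfunZ (formfunM fl (formfun_tri HT fv0 fn fn)).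
  - exact: formfunM fl (formfunM fl (formfun_tri HT fn fn fn)).
suff [h1 h2] : (forall v, v \in E -> T v v n = 0) /\
               (forall v, v \in E -> T v n n = 0).
  have [w wE w0] : exists2 w, w \in E & w != 0.
    exists (vpick E); first exact: memv_pick.
    by rewrite vpick0 -dimv_eq0 dE.
  have [y] := dl_cone HX w0; case/eqP.
  have h3 v : v \in E -> T w v n = 0.
    move=> vE; have := h1 _ (memvD wE vE); rewrite !TE !h1 // add0r addr0.
    rewrite (tri12 HT v w) -mulr2n -mulr_natl => /eqP.
    by rewrite mulf_eq0 (negPf (natS_neq0 1)) => /eqP.
  rewrite (v0n y); move: (v0 y) (v0E y) (lform l y) => e eE t.
  rewrite !TE (tri23 HT w n) h3 // h2 // (tri_polarize fE) //.
  by rewrite !(mulr0, addr0).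
have lin_l v t : v \in E -> lform l (v + t *: n) = t.
  by move=> vE; rewrite lformD lformZ ln lE // add0r mulr1.
have case1 : (forall v, T v v v = 0 -> lform l v = 0) ->
    (forall v, v \in E -> T v v n = 0) /\ (forall v, v \in E -> T v n n = 0).
  move=> hl; have nnn : T n n n != 0.
    by apply/eqP => /hl; rewrite ln => /eqP; rewrite oner_eq0.
  have root0 v t : v \in E ->
      3%:R * T v v n + 3%:R * t * T v n n + t ^+ 2 * T n n n = 0 -> t = 0.
    by move=> vE ht; rewrite -(lin_l v t vE); apply: hl; rewrite lin // ht mulr0.
  have h1 v : v \in E -> T v v n = 0.
    move=> vE; pose p := (3%:R * T v v n)%:P + (3%:R * T v n n) *: 'X + T n n n *: 'X^2.
    have sp : size p = 3%N.
      rewrite /p addrC size_polyDl size_scale ?size_polyXn //.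
      apply: leq_ltn_trans (size_polyD _ _) _; rewrite gtn_max.
      rewrite (leq_ltn_trans (size_polyC_leq1 _)) //.
      by rewrite (leq_ltn_trans (size_scale_leq _ _)) // size_polyX.
    have [|t] := closed_rootP p _; first by rewrite sp.
    rewrite /root /p !(hornerD, hornerZ, hornerC, hornerX, hornerXn) => /eqP rt.
    have t0 : t = 0.
      by apply: (root0 v) => //; rewrite -rt; ring.
    move: rt; rewrite t0 !(expr0n, mulr0, addr0) => /eqP.
    by rewrite mulf_eq0 (negPf (natS_neq0 2)) => /eqP.
  split=> // v vE; have := root0 v (- 3%:R * T v n n / T n n n) vE.
  rewrite h1 // => H; have /eqP : - 3%:R * T v n n / T n n n = 0.
    by apply: H; field.
  by rewrite !mulf_eq0 invr_eq0 (negPf nnn) oppr_eq0 (negPf (natS_neq0 2)) orbF => /eqP.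
case: (dl_irr HX fl fgf) => [v|//|hg]; first by rewrite fg.
have h1 v : v \in E -> T v v n = 0.
  move=> vE; have := hg v (fE v vE); rewrite /g lE // !mul0r mulr0 !addr0.
  rewrite /v0 lE // scale0r subr0 => /eqP.
  by rewrite mulf_eq0 (negPf (natS_neq0 2)) => /eqP.
pose l2 v := 3%:R * T (v0 v) n n + lform l v * T n n n.
have fl2 : formfun 1 l2.
  apply: formfunD; first exact: formfunZ (formfun_tri HT fv0 fn fn).
  exact: formfunM fl (formfun_tri HT fn fn fn).
case: (dl_irr HX fl fl2) => [v|//|hl2].
  rewrite {1}fg /g h1 // => /eqP; rewrite mulf_eq0 => /orP[/eqP->|].
    by rewrite mul0r.
  rewrite mulr0 add0r => /eqP H; rewrite -[RHS]H /l2; ring.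
split=> // v vE; have := hl2 v (fE v vE); rewrite /l2 lE // mul0r addr0.
rewrite /v0 lE // scale0r subr0 => /eqP.
by rewrite mulf_eq0 (negPf (natS_neq0 2)) => /eqP.
Qed.

End DoubleLine.

Section PlaneBasis.
Variables (k : fieldType) (m : nat).
Implicit Types (W : {vspace 'cV[k]_m}) (a b w x : 'cV[k]_m).

Record plane_basis W a b : Prop := PlaneBasis {
  pb_span : forall w, w \in W -> exists c d, w = c *: a + d *: b;
  pb_mem : forall c d, c *: a + d *: b \in W;
  pb_free : forall c d, c *: a + d *: b = 0 -> c = 0 /\ d = 0 }.

Lemma plane_basis_pair W a b : \dim W = 2%N -> a \in W -> b \in W ->
  b != 0 -> a \notin <[b]>%VS -> plane_basis W a b.
Proof.
move=> dW aW bW b0 ab; have eW : W = (<[b]> + <[a]>)%VS.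
  apply/esym/eqP; rewrite eqEdim subv_add -!memvE aW bW /=.
  by rewrite dim_add_vector // dim_vline b0 dW.
split=> [w|c d|c d cd].
- rewrite eW => /mem_add_vector[e /vlineP[d ->] [c ->]].
  by exists c, d; rewrite addrC.
- by rewrite memvD ?memvZ.
have c0 : c = 0.
  apply/eqP; apply: contraR ab => c0; apply/vlineP; exists (- d / c).
  apply: (scalerI c0); rewrite scalerA mulrCA divff // mulr1 scaleNr.
  by apply/eqP; rewrite -addr_eq0 cd.
split=> //; move: cd; rewrite c0 scale0r add0r => /eqP.
by rewrite scaler_eq0 (negPf b0) orbF => /eqP.
Qed.

Lemma plane_basis_complete W b : \dim W = 2%N -> b \in W -> b != 0 ->
  exists a, plane_basis W a b.
Proof.
move=> dW bW b0; have : ~~ (W <= <[b]>)%VS.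
  by apply/negP => /dimvS; rewrite dW dim_vline b0.
by case/subvPn => a aW ab; exists a; apply: plane_basis_pair.
Qed.

Lemma pb_mem1 W a b : plane_basis W a b -> a \in W.
Proof. by case=> _ /(_ 1 0); rewrite scale1r scale0r addr0. Qed.
Lemma pb_mem2 W a b : plane_basis W a b -> b \in W.
Proof. by case=> _ /(_ 0 1); rewrite scale1r scale0r add0r. Qed.

Lemma plane_basis_swap W a b : plane_basis W a b -> plane_basis W b a.
Proof.
case=> h1 h2 h3; split=> [w /h1[c [d ->]]|c d|c d].
- by exists d, c; rewrite addrC.
- by rewrite addrC.
by rewrite addrC => /h3[-> ->].
Qed.

End PlaneBasis.

Lemma quartic_eq0 (k : closedFieldType) (c0 c1 c2 c3 c4 : k) :
  (forall s, c0 + c1 * s + c2 * s ^+ 2 + c3 * s ^+ 3 + c4 * s ^+ 4 = 0) ->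
  [/\ c0 = 0, c1 = 0, c2 = 0, c3 = 0 & c4 = 0].
Proof.
move=> h; have : Poly [:: c0; c1; c2; c3; c4] = 0.
  by apply: poly_fun_eq0 => s; rewrite horner_Poly /= -[RHS](h s); ring.
move=> h0; have hc i : [:: c0; c1; c2; c3; c4]`_i = 0 by rewrite -coef_Poly h0 coef0.
by split; [have := hc 0%N | have := hc 1%N | have := hc 2%N
  | have := hc 3%N | have := hc 4%N].
Qed.

Section Geometry.
Variables (k : closedFieldType) (char0 : [pchar k] =i pred0).
Notation V := 'cV[k]_5.
Implicit Types (E : {vspace V}) (a b p v w x y z : V) (c d r s t : k).
Variables (T : V -> V -> V -> k) (W : {vspace V}).
Hypothesis HX : double_line_cubic T W.
Let HT := dl_tri HX.
Let TE := triE HT.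
Let two0 : 2%:R != 0 :> k := natS_neq0 char0 1.
Let three0 : 3%:R != 0 :> k := natS_neq0 char0 2.

(** Along W the cubic form has degree one only, because all products of two elements
  of W vanish. So X is swept out by the lines residual to the double line in the
  planes through it. *)
Lemma sing_cube x y : x \in W ->
  T (x + y) (x + y) (x + y) = 3%:R * T x y y + T y y y.
Proof. by move=> xW; rewrite (tri_cubeD HT) !(dl_sing HX _ xW xW) mulr0 !add0r. Qed.

(** A pencil of quadratic forms without zero member cannot consist of squares
  only. *)
Lemma exists_rank2 : exists x v w, x \in W /\ disc (T x) v w != 0.
Proof.
have [a [b [a0 ba eW]]] := dim_plane_basis (dl_dim HX).
have aW : a \in W by rewrite eW (subvP (addvSl _ _)) ?memv_line.
have bW : b \in W by rewrite eW (subvP (addvSr _ _)) ?memv_line.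
apply: NNPP => no.
have D0 x v w : x \in W -> disc (T x) v w = 0.
  move=> xW; apply/eqP/negPn/negP => d0; apply: no; by exists x, v, w.
have [v av] := dl_cone HX a0.
pose b' := b - (T b v v / T a v v) *: a.
have b'W : b' \in W by rewrite memvB ?memvZ.
have b'0 : b' != 0.
  by apply: contraNneq ba => /eqP; rewrite subr_eq0 => /eqP->; rewrite memvZ ?memv_line.
have b'v : T b' v v = 0 by rewrite /b' -scaleN1r !TE; field.
clearbody b'; have b'vw w : T b' v w = 0.
  have /eqP := D0 b' v w b'W.
  by rewrite /disc b'v mul0r subr0 expf_eq0 => /andP[_ /eqP].
have [w b'w] := dl_cone HX b'0.
have := D0 (a + b') v w (memvD aW b'W); rewrite /disc !TE b'v b'vw !addr0.
have := D0 a v w aW; rewrite /disc => h1 h2.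
have /eqP : T a v v * T b' w w = 0.
  by apply: (lin_comb2 h1 h2 (x := 1) (y := -1)); ring.
by rewrite mulf_eq0 (negPf av) (negPf b'w).
Qed.

Definition cubic_path (P : k -> V) : Prop :=
  polypath P /\ forall t, T (P t) (P t) (P t) = 0.

(** These vectors need not form a linear space. They replace the tangent space,
  which is everything at a singular point and says nothing about X. *)
Definition tangent p w : Prop := exists2 P, cubic_path P & pathjet P p w.

Lemma tangentZ c p w : tangent p w -> tangent (c *: p) (c *: w).
Proof.
move=> [P [hP fP] jP]; exists (fun t => c *: P t).
  split=> [|t]; first by apply: polypathZ (polyfunC _) hP.
  by rewrite !TE fP !mulr0.
move=> i; apply: jet_eq (_ : jet (fun t => c * P t i 0) _ _) => [t|].
  by rewrite mxE.
have := jetM (jetC c) (jP i); rewrite mul0r addr0.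
by rewrite !mxE.
Qed.

Lemma tangent_sing p w : p \in W -> w \in W -> tangent p w.
Proof.
move=> pW wW; exists (fun t => p + t *: w); last exact: pathjet_line.
split=> [|t]; first exact: polypath_line.
by rewrite !(dl_sing HX) ?memvD ?memvZ.
Qed.

(** At a point p of the double line the tangent cone of X is the quadric
  T p y y = 0. A smooth point y0 of this quadric is the direction of a path in
  X: solve the equation of X, which is linear in the coordinate along p, over
  the line y0 + t y1. *)
Lemma tangent_conic p p' y0 y1 c : p \in W -> p' \in W -> T p y0 y0 = 0 ->
  exists m, tangent (- (3%:R * c * T p' y0 y0 + T y0 y0 y0) *: p)
    (m *: p + (6%:R * T p y0 y1) *: (c *: p' + y0)).
Proof.
move=> pW p'W q0; pose y t := y0 + t *: y1.
pose X t := - (3%:R * c * T p' (y t) (y t) + T (y t) (y t) (y t)).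
pose A t := 3%:R * (2%:R * T p y0 y1 + t * T p y1 y1).
have py : polypath y by apply: polypath_line.
have pX : polyfun X.
  apply/polyfunN/polyfunD; last exact: polyfun_tri.
  by apply: polyfunM (polyfunC _) (polyfun_tri HT (polypathC _) py py).
have [m jX] := polyfun_jet pX.
exists m; exists (fun t => X t *: p + (t * A t) *: (c *: p' + y t)).
  split=> [|t].
    apply: polypathD; first exact: polypathZ pX (polypathC _).
    apply: polypathZ; last exact: polypathD (polypathC _) py.
    apply: polyfunM (polyfunX _) (polyfunM (polyfunC _) _).
    by apply: polyfunD (polyfunC _) (polyfunM (polyfunX _) (polyfunC _)).
  have hq : T p (y t) (y t) * 3%:R = t * A t.
    by rewrite /y /A !TE q0 (tri23 HT p y1); ring.
  rewrite scalerDr addrA scalerA sing_cube ?memvD ?memvZ //.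
  rewrite (triD1 HT) !(triZ1 HT) !(triZ2 HT) !(triZ3 HT).
  have -> : T p (y t) (y t) = t * A t / 3%:R by rewrite -hq mulfK.
  rewrite /X; field; exact: three0.
have X0 : X 0 = - (3%:R * c * T p' y0 y0 + T y0 y0 y0).
  by rewrite /X /y scale0r addr0.
move=> i; rewrite X0 in jX.
have jA : jet (fun t => t * A t) 0 (6%:R * T p y0 y1).
  exists (3%:R * T p y1 y1)%:P => t; rewrite hornerC /A; ring.
have jy : jet (fun t => c * p' i 0 + (y0 i 0 + t * y1 i 0)) (c * p' i 0 + y0 i 0) (0 + y1 i 0).
  by apply: jetD (jetC _) (jet_affine _ _).
have := jetD (jetM jX (jetC (p i 0))) (jetM jA jy).
rewrite !mul0r !mulr0 !add0r addr0 !mxE; apply: jet_eq => t.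
by rewrite !mxE.
Qed.

(** The tangent vectors at a point p of the double line span the whole space
  when the tangent cone at p has rank at least two. Otherwise all smooth points
  of the conic T p y y = 0 off a line would satisfy the two other equations
  T p' y y = T y y y = 0; if the conic is irreducible this makes the pencil
  degenerate, and if it is a pair of lines then X contains a hyperplane. *)
Lemma tangent_span p p' v w : plane_basis W p' p -> disc (T p) v w != 0 ->
  forall xi, (forall u, tangent p u -> lform xi u = 0) ->
  forall u, lform xi u = 0.
Proof.
move=> bW D0 xi xi0.
have pW := pb_mem2 bW; have p'W := pb_mem1 bW.
have xiW u : u \in W -> lform xi u = 0.
  by move=> uW; apply/xi0/tangent_sing.
have HB := tri_bilinear HT p.
(* The number c is free: its choice makes the factor by which the tangent vector
   has to be rescaled nonzero. *)
have valid y0 y1 : T p y0 y0 = 0 -> T p y0 y1 != 0 ->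
    lform xi y0 * T p' y0 y0 = 0 /\ lform xi y0 * T y0 y0 y0 = 0.
  move=> q0 s0.
  have key c : 3%:R * c * T p' y0 y0 + T y0 y0 y0 != 0 -> lform xi y0 = 0.
    have [m] := tangent_conic y1 c pW p'W q0.
    move: (_ + T y0 y0 y0) => X0 tg X00.
    have := tangentZ (- X0^-1) tg; rewrite scalerA mulrNN mulVf // scale1r.
    move/xi0; rewrite lformZ !(lformD, lformZ) !(xiW p, xiW p') // !mulr0 !add0r.
    move/(mulf_cancel0 _); rewrite oppr_eq0 invr_eq0 => /(_ X00).
    by apply: mulf_cancel0; rewrite mulf_neq0 // natS_neq0.
  have [f0|f0] := eqVneq (T y0 y0 y0) 0.
    rewrite f0 mulr0; split=> //.
    have [->|q'0] := eqVneq (T p' y0 y0) 0; first by rewrite mulr0.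
    by rewrite (key 1) ?mul0r // f0 addr0 mulr1 mulf_neq0.
  by rewrite (key 0) ?mul0r // mulr0 mul0r add0r.
have [a [b [aa bb ab]]] := hyperbolic_pair two0 HB D0.
have aW : a \notin W.
  by apply: contra ab => aW; rewrite (dl_sing HX) // pW.
have bW' : b \notin (W + <[a]>)%VS.
  apply: contra ab => /mem_add_vector[e eW [r ->]].
  by rewrite !TE aa mulr0 addr0 (tri23 HT) (dl_sing HX) ?pW.
have [z zW] : exists z, z \notin (W + <[a]> + <[b]>)%VS.
  apply: NNPP => no; have : \dim (W + <[a]> + <[b]>) = 5%N.
    suff -> : (W + <[a]> + <[b]>)%VS = fullv by rewrite dimvf.
    apply/eqP; rewrite eqEsubv subvf; apply/subvP => u _.
    by apply: contraT => uE; case: no; exists u.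
  by rewrite !dim_add_vector ?(dl_dim HX).
have [c [ac bc [x0 [y0 ez]]]] := orthogonal_part HB z aa bb ab.
have cW : c \notin (W + <[a]> + <[b]>)%VS.
  apply: contra zW => cW; rewrite ez memvD //.
  have aE : a \in (W + <[a]>)%VS by rewrite (subvP (addvSr _ _)) ?memv_line.
  have bE : b \in (W + <[a]> + <[b]>)%VS by rewrite (subvP (addvSr _ _)) ?memv_line.
  by rewrite memvD ?memvZ // (subvP (addvSl _ _)).
have full u : exists2 e, e \in W & exists r s t,
    u = e + (r *: a + s *: b + t *: c).
  have : u \in (W + <[a]> + <[b]> + <[c]>)%VS.
    by apply: vspace_fullP; rewrite !dim_add_vector ?(dl_dim HX).
  case/mem_add_vector=> e1 /mem_add_vector[e2 /mem_add_vector[e eW [r ->]] [s ->]] [t ->].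
  by exists e => //; exists r, s, t; rewrite !addrA.
suff [xa xb xc] : [/\ lform xi a = 0, lform xi b = 0 & lform xi c = 0].
  move=> u; have [e eW [r [s [t ->]]]] := full u.
  by rewrite !(lformD, lformZ) xiW // xa xb xc !mulr0 !addr0.
(* If T p c c = 0, the conic is the pair of lines through a, c and through b, c. *)
have [cc|cc] := eqVneq (T p c c) 0.
  have pair a1 b1 : T p a1 a1 = 0 -> T p a1 c = 0 -> T p a1 b1 != 0 ->
      T p c b1 = 0 -> a1 \notin W -> c \notin (W + <[a1]>)%VS ->
      lform xi a1 = 0 /\ lform xi c = 0.
    move=> aa1 ac1 ab1 cb1 a1W ca1.
    have q t : T p (a1 + t *: c) (a1 + t *: c) = 0.
      by rewrite !TE aa1 ac1 (tri23 HT p c a1) ac1 cc !(mulr0, addr0).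
    have v1 t := valid (a1 + t *: c) b1 (q t).
    have v2 t : T p (a1 + t *: c) b1 != 0 by rewrite !TE cb1 mulr0 addr0.
    have pc : polypath (fun t => a1 + t *: c) by apply: polypath_line.
    have px := polyfun_formfun (formfun_lform xi) pc.
    have pq := polyfun_tri HT (polypathC p') pc pc.
    have pf := polyfun_tri HT pc pc pc.
    have [x|hq] := polyfun_prod_eq0 px pq (fun t => (v1 t (v2 t)).1).
      have x1 := x 0; have := x 1.
      by move: x1; rewrite scale0r addr0 scale1r lformD => ->; rewrite add0r.
    have [x|hf] := polyfun_prod_eq0 px pf (fun t => (v1 t (v2 t)).2).
      have x1 := x 0; have := x 1.
      by move: x1; rewrite scale0r addr0 scale1r lformD => ->; rewrite add0r.
    exfalso; apply: (no_hyperplane char0 HX (E := (W + <[a1]> + <[c]>)%VS)).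
      by rewrite !dim_add_vector ?(dl_dim HX).
    have [q1 q2 q3 _ _] : [/\ T p' a1 a1 = 0, 2%:R * T p' a1 c = 0,
        T p' c c = 0, 0 = 0 :> k & 0 = 0 :> k].
      apply: quartic_eq0 => s; rewrite -[RHS](hq s) !TE (tri23 HT p' c a1).
      by ring.
    have [f1 f2 f3 f4 _] : [/\ T a1 a1 a1 = 0, 3%:R * T a1 a1 c = 0,
        3%:R * T a1 c c = 0, T c c c = 0 & 0 = 0 :> k].
      apply: quartic_eq0 => s; rewrite -[RHS](hf s) (tri_cubeD HT) !TE.
      by ring.
    move=> u /mem_add_vector[e1 /mem_add_vector[e eW [r ->]] [s ->]].
    rewrite -addrA sing_cube // (tri_cubeD HT).
    have [m1 [m2 ->]] := pb_span bW eW.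
    rewrite !TE aa1 ac1 (tri23 HT p c a1) ac1 cc q1 (mulf_cancel0 two0 q2) q3.
    rewrite (tri23 HT p' c a1) (mulf_cancel0 two0 q2).
    rewrite f1 (mulf_cancel0 three0 f2) (mulf_cancel0 three0 f3) f4.
    by rewrite !(mulr0, addr0).
  have [xa xc] : lform xi a = 0 /\ lform xi c = 0.
    apply: (pair a b) => //; first by rewrite (tri23 HT).
    by apply: contra cW; apply/subvP/addvSl.
  have [xb _] : lform xi b = 0 /\ lform xi c = 0.
    apply: (pair b a) => //; first by rewrite (tri23 HT).
    - by rewrite (tri23 HT).
    - by apply: contra bW'; apply/subvP/addvSl.
    by apply: contra cW; apply/subvP; rewrite addvS ?addvSl.
  by split.
(* Otherwise the conic is smooth, and y parametrizes it. *)
pose be := - T p c c / (2%:R * T p a b).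
have be0 : be != 0.
  by rewrite mulf_neq0 ?invr_eq0 ?mulf_neq0 ?oppr_eq0.
pose y s := be *: b + s *: c + s ^+ 2 *: a.
have q s : T p (y s) (y s) = 0.
  rewrite /y !TE aa bb ac bc (tri23 HT p c) bc (tri23 HT p c) ac (tri23 HT p b a).
  rewrite /be; field; exact/andP.
have py : polypath y.
  apply: polypathD; first exact: polypath_line.
  by apply: polypathZ (polyfun_exp _ (polyfunX _)) (polypathC _).
have v2 s : s != 0 -> T p (y s) b != 0.
  move=> s0; rewrite /y !TE bb (tri23 HT p c) bc !mulr0 !add0r.
  by rewrite mulf_neq0 ?expf_neq0.
have px := polyfun_formfun (formfun_lform xi) py.
have pq := polyfun_tri HT (polypathC p') py py.
have v1 s : lform xi (y s) * T p' (y s) (y s) = 0.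
  move: s; apply: polyfun_eq0; first exact: polyfunM.
  apply: generically_imp (generically_neq 0) => s s0.
  by have [] := valid (y s) b (q s) (v2 s s0).
have [x|hq] := polyfun_prod_eq0 px pq v1.
  have [x1 x2 x3 _ _] : [/\ be * lform xi b = 0, lform xi c = 0, lform xi a = 0,
      0 = 0 :> k & 0 = 0 :> k].
    by apply: quartic_eq0 => s; rewrite -[RHS](x s) !(lformD, lformZ); ring.
  by split=> //; apply: mulf_cancel0 x1.
have [x1 x2 x3 x4 x5] : [/\ be ^+ 2 * T p' b b = 0, 2%:R * be * T p' b c = 0,
    2%:R * be * T p' a b + T p' c c = 0, 2%:R * T p' a c = 0 & T p' a a = 0].
  apply: quartic_eq0 => s; rewrite -[RHS](hq s) /y !TE.
  by rewrite (tri23 HT p' c b) (tri23 HT p' c a) (tri23 HT p' b a); ring.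
have mu0 : p' - (T p' a b / T p a b) *: p != 0.
  apply/eqP; rewrite -scaleNr -[p' in p' + _]scale1r => /(pb_free bW)[/eqP].
  by rewrite oner_eq0.
have [u] := dl_cone HX mu0; case/eqP.
have [e eW [r [s [t ->]]]] := full u.
have e0 q1 z1 : q1 \in W -> T q1 e z1 = 0 by move=> q1W; rewrite (dl_sing HX).
have e1 q1 z1 : q1 \in W -> T q1 z1 e = 0 by move=> q1W; rewrite (tri23 HT) e0.
rewrite -scaleNr !TE !e0 ?e1 // aa bb ac bc.
rewrite (tri23 HT p c b) bc (tri23 HT p c a) ac.
rewrite (tri23 HT p b a) (tri23 HT p' b a) (tri23 HT p' c a) (tri23 HT p' c b).
rewrite x5 (mulf_cancel0 two0 x4) (mulf_cancel0 (mulf_neq0 two0 be0) x2).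
rewrite (mulf_cancel0 (expf_neq0 2 be0) x1).
have -> : T p' c c = T p c c / T p a b * T p' a b.
  move: x3 => /eqP; rewrite addrC addr_eq0 => /eqP->; rewrite /be; field.
  exact/andP.
field; exact: ab.
Qed.

End Geometry.

(** * Curves in the singular locus *)
Section SingularCurves.
Variables (k : closedFieldType) (char0 : [pchar k] =i pred0).
Notation V := 'cV[k]_5.
Implicit Types (E : {vspace V}) (a b p v w x y z : V) (c d r s t : k).
Variables (T : V -> V -> V -> k) (W : {vspace V}).
Hypothesis HX : double_line_cubic T W.
Let HT := dl_tri HX.
Let TE := triE HT.
Let two0 : 2%:R != 0 :> k := natS_neq0 char0 1.

(** If the space of such x were W, the plane through the double line and z would be
  singular; so it is at most a line. *)
Lemma component_kernel z : z \notin W -> (forall v, T z z v = 0) ->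
  exists n0, [/\ n0 \in W, forall v, T n0 z v = 0 &
    forall x, x \in W -> (forall v, T x z v = 0) -> x \in <[n0]>%VS].
Proof.
move=> zW zz.
have [[n0 [n0W n00 hn0]]|no] := classic (exists x,
    [/\ x \in W, x != 0 & forall v, T x z v = 0]); last first.
  exists 0; split=> [|v|x xW hx]; rewrite ?mem0v ?(tri01 HT) //.
  apply: contraT => x0; case: no; exists x; split=> //.
  by apply: contraNneq x0 => ->; rewrite mem0v.
exists n0; split=> // x xW hx; apply: contraT => xn.
have [x1 [v [x1W]]] := dl_component HX zW zz; case/eqP.
have pb := plane_basis_pair (dl_dim HX) xW n0W n00 xn.
by have [c [d ->]] := pb_span pb x1W; rewrite !TE hx hn0 !mulr0 addr0.
Qed.

(** Let z1 be a point of the curve off W. If the curve left the plane spanned by W and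
  z1, the identity T w (L s) (L s) = 0 would split, for suitable w in W, into two
  polynomial factors. The vanishing of either one contradicts the independence of
  the points, or makes X a cone or a variety that contains a hyperplane. In the
  plane, the component along W is a multiple of the vector n0. *)
Lemma singular_path (L : k -> V) : polypath L -> (forall s v, T (L s) (L s) v = 0) ->
  (forall s, L s \in W) \/
  exists s1 n0, [/\ L s1 \notin W, n0 \in W, forall v, T n0 (L s1) v = 0 &
    (forall x, x \in W -> (forall v, T x (L s1) v = 0) -> x \in <[n0]>%VS)
    /\ forall s, L s \in (<[n0]> + <[L s1]>)%VS].
Proof.
move=> pL hL; have [|/not_all_ex_not[s1 /negP z1W]] := classic (forall s, L s \in W).
  by left.
right; pose z1 := L s1; rewrite -/z1 in z1W.
have [n0 [n0W hn0 n0P]] := component_kernel z1W (hL s1).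
exists s1, n0; split=> //; split=> //.
have TWW w x y : w \in W -> x \in W -> T w x y = 0.
  by move=> wW xW; apply: (dl_sing HX).
have inE s : L s \in (W + <[z1]>)%VS.
  apply: contraT => z2E; exfalso; move: s z2E => s2; set z2 := L s2 => z2E.
  have [l2 l2E l2z] := separating_form z2E.
  have pol w z : polyfun (fun s => T w (L s) z).
    by apply: polyfun_tri => //; apply: polypathC.
  have pl l : polyfun (fun s => lform l (L s)).
    exact: polyfun_formfun (formfun_lform l) pL.
  have h1 v : T z1 z1 v = 0 by apply: hL.
  have h2 v : T z2 z2 v = 0 by apply: hL.
  have [w' w'W w'12] : exists2 w', w' \in W & T w' z1 z2 != 0.
    apply: NNPP => no; have no' w : w \in W -> T w z1 z2 = 0.
      by move=> wW; apply/eqP/negPn/negP => h; apply: no; exists w.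
    apply: (no_hyperplane char0 HX (E := (W + <[z1]> + <[z2]>)%VS)).
      by rewrite !dim_add_vector ?(dl_dim HX).
    move=> u /mem_add_vector[e1 /mem_add_vector[e eW [r ->]] [s ->]].
    rewrite -addrA (sing_cube HX) // (tri_cubeD HT) !TE.
    rewrite !h1 !h2 (tri23 HT e z2) no' // (tri13 HT e z1 z1) h1.
    by rewrite (tri13 HT e z2 z2) (tri13 HT z1 z2 z2) !h2 !(mulr0, addr0).
  have [w [wW w0 w12]] : exists w, [/\ w \in W, w != 0 & T w z1 z2 = 0].
    have [a [b [a0 ba eW]]] := dim_plane_basis (dl_dim HX).
    have aW : a \in W by rewrite eW (subvP (addvSl _ _)) ?memv_line.
    have bW : b \in W by rewrite eW (subvP (addvSr _ _)) ?memv_line.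
    have [Ta|Ta] := eqVneq (T a z1 z2) 0; first by exists a.
    exists (b - (T b z1 z2 / T a z1 z2) *: a); split.
    - by rewrite memvB ?memvZ.
    - apply: contraNneq ba => /eqP; rewrite subr_eq0 => /eqP->.
      by rewrite memvZ ?memv_line.
    by rewrite -scaleNr !TE; field.
  have Tww x s : x \in W -> T x (L s) (L s) = 0.
    by move=> xW; rewrite (tri13 HT) hL.
  have [[s3]|no3] := classic (exists s, L s \notin (W + <[z1]> + <[z2]>)%VS).
    set z3 := L s3 => z3E; have [l3 l3E l3z] := separating_form z3E.
    have dec s : T w (L s) (L s) = 2%:R * lform l3 (L s) * T w (L s) z3.
      have : L s \in (W + <[z1]> + <[z2]> + <[z3]>)%VS.
        by apply: vspace_fullP; rewrite !dim_add_vector ?(dl_dim HX).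
      case/mem_add_vector=> u uE [r ->]; rewrite lformD lformZ l3E // l3z.
      case/mem_add_vector: uE => u1 /mem_add_vector[e eW [r1 ->]] [r2 ->].
      rewrite !TE !(TWW w e) // !(tri23 HT w _ e) !(TWW w e) //.
      rewrite (tri23 HT w z2 z1) w12 (tri23 HT w z3 z1) (tri23 HT w z3 z2).
      by rewrite !(Tww w) //; ring.
    have prod0 s : 2%:R * lform l3 (L s) * T w (L s) z3 = 0 by rewrite -dec Tww.
    have [h|h] := polyfun_prod_eq0 (polyfunM (polyfunC _) (pl l3)) (pol w z3) prod0.
      by have := h s3; rewrite l3z mulr1 => /eqP; rewrite (negPf two0).
    have [y] := dl_cone HX w0; case/eqP.
    have : y \in (W + <[z1]> + <[z2]> + <[z3]>)%VS.
      by apply: vspace_fullP; rewrite !dim_add_vector ?(dl_dim HX).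
    case/mem_add_vector=> u uE [r ->].
    case/mem_add_vector: uE => u1 /mem_add_vector[e eW [r1 ->]] [r2 ->].
    rewrite !TE !(TWW w e) // !(tri23 HT w _ e) !(TWW w e) //.
    rewrite (tri23 HT w z2 z1) w12 (tri23 HT w z3 z1) (tri23 HT w z3 z2).
    by rewrite !(h s1) !(h s2) !(Tww w) // !(mulr0, addr0).
  case/eqP: w'12; have inE s : L s \in (W + <[z1]> + <[z2]>)%VS.
    by apply: contraT => h; case: no3; exists s.
  have dec s : T w' (L s) (L s) = 2%:R * lform l2 (L s) * T w' (L s) z2.
    have := inE s; case/mem_add_vector=> u uE [r ->].
    rewrite lformD lformZ l2E // l2z.
    case/mem_add_vector: uE => e eW [r1 ->].
    rewrite !TE !(TWW w' e) // !(tri23 HT w' _ e) !(TWW w' e) //.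
    by rewrite (tri23 HT w' z2 z1) !(Tww w') //; ring.
  have prod0 s : 2%:R * lform l2 (L s) * T w' (L s) z2 = 0 by rewrite -dec Tww.
  have [h|h] := polyfun_prod_eq0 (polyfunM (polyfunC _) (pl l2)) (pol w' z2) prod0.
    by have := h s2; rewrite l2z mulr1 => /eqP; rewrite (negPf two0).
  exact: h.
have [l lE lz] := separating_form z1W.
pose x s := L s - lform l (L s) *: z1.
have pl : polyfun (fun s => lform l (L s)).
  exact: polyfun_formfun (formfun_lform l) pL.
have xW s : x s \in W.
  rewrite /x; case/mem_add_vector: (inE s) => e eW [r ->].
  by rewrite lformD lformZ lE // lz add0r mulr1 addrK.
have px : polypath x.
  move=> i; apply: polyfun_eq (polyfunB (pL i) (polyfunM pl (polyfunC (z1 i 0)))) => s.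
  by rewrite !mxE.
have hx v s : T (x s) z1 v = 0.
  have prod0 t : (2%:R * lform l (L t)) * T (x t) z1 v = 0.
    rewrite -[RHS](hL t v) -[in RHS](subrK (lform l (L t) *: z1) (L t)) -/(x t).
    move: (x t) (xW t) => e eW; rewrite !TE (TWW e e) // (hL s1) (tri12 HT z1 e).
    by ring.
  have [h|//] := polyfun_prod_eq0 (polyfunM (polyfunC _) pl)
    (polyfun_tri HT px (polypathC z1) (polypathC v)) prod0.
  by have := h s1; rewrite lz mulr1 => /eqP; rewrite (negPf two0).
move=> s; rewrite -(subrK (lform l (L s) *: z1) (L s)) -/(x s) memv_add ?memvZ ?memv_line //.
by apply: n0P => // v; apply: hx.
Qed.

End SingularCurves.

(** * Reduced lifts of rational curves in families *)
Lemma exists_minimal (A : Type) (P : A -> Prop) (mu : A -> nat) :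
  (exists x, P x) -> exists2 x, P x & forall y, P y -> (mu x <= mu y)%N.
Proof.
case=> x; move: {2}(mu x).+1 (ltnSn (mu x)) => n; elim: n x => // n IH x lt Px.
have [[y [Py lty]]|no] := classic (exists y, P y /\ (mu y < mu x)%N).
  by apply: IH Py; apply: leq_trans lty _; rewrite -ltnS.
exists x => // y Py; rewrite leqNgt; apply/negP => lty; apply: no; by exists y.
Qed.


Section PrimitiveDirection.
Variables (k : closedFieldType) (m : nat).
Notation R := {poly k}.
Implicit Types (u v w : 'I_m -> {poly R}).

Let prop u v : Prop := forall i j, u i * v j = u j * v i.
Let nonzero u : Prop := exists i, u i != 0.
Let vsize u : nat := (\max_i size (u i))%N.
Let leading_size u : nat := (\sum_i size ((u i)`_(vsize u).-1)%R)%N.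
Let at_t (c : k) (p : {poly R}) : {poly k} := map_poly (horner_eval c) p.

Let prop_sym u v : prop u v -> prop v u.
Proof. by move=> h i j; rewrite mulrC -h mulrC. Qed.

Let prop_trans u v w : nonzero v -> prop u v -> prop v w -> prop u w.
Proof.
case=> l vl uv vw i j; apply: (mulfI vl).
by rewrite mulrCA (vw l j) mulrA uv -mulrA (vw i l) mulrCA.
Qed.

Let at_t_eq0 c p : at_t c p = 0 -> exists q, p = ('X - c%:P)%:P * q.
Proof.
move=> p0; have hc i : ('X - c%:P) %| p`_i.
  rewrite dvdp_XsubCl /root; have := congr1 (fun r : {poly k} => r`_i) p0.
  by rewrite /at_t coef_map coef0 /= /horner_eval => ->.
exists (\poly_(i < size p) (p`_i %/ ('X - c%:P))); apply/polyP => i.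
rewrite coefCM coef_poly; case: ltnP => hi; last by rewrite nth_default ?mulr0.
by rewrite mulrC divpK.
Qed.

Let vsize_ge u i : (size (u i) <= vsize u)%N.
Proof. exact: leq_bigmax. Qed.

Let vsize_attained u : nonzero u ->
  (0 < vsize u)%N /\ exists i, (u i)`_(vsize u).-1 != 0.
Proof.
case=> i ui; have pos : (0 < vsize u)%N.
  by apply: leq_trans (vsize_ge u i); rewrite size_poly_gt0.
split=> //; have [|j eqj] := eq_bigmax (fun i => size (u i)).
  by rewrite card_ord; case: m i {ui} => [[]|].
by exists j; rewrite {1}/vsize eqj lead_coef_eq0 -size_poly_gt0 -eqj.
Qed.

(** Every vector of polynomials over k[t] is a multiple of a vector that
  generates all vectors proportional to it: take one of minimal degree, so that
  division with remainder produces the multiplier up to an element of k[t], and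
  then use that it is primitive (the lemma of Gauss). *)
Lemma primitive_direction (g : 'I_m -> {poly R}) : (exists i, g i != 0) ->
  exists phi : 'I_m -> {poly R},
    [/\ exists i, phi i != 0, forall i j, phi i * g j = phi j * g i &
     forall u, (forall i j, u i * g j = u j * g i) ->
       exists h, forall i, u i = h * phi i].
Proof.
move=> g0; pose good u := nonzero u /\ prop u g.
have [u0 gu0 min1] : exists2 u, good u & forall v, good v -> (vsize u <= vsize v)%N.
  by apply: exists_minimal; exists g; split=> // i j; rewrite mulrC.
have [phi [[phi0 phig] vphi] min2] : exists2 u, good u /\ vsize u = vsize u0 &
    forall v, good v /\ vsize v = vsize u0 -> (leading_size u <= leading_size v)%N.
  by apply: exists_minimal; exists u0.
exists phi; split=> // u ug.
have [vpos [i0 lead0]] := vsize_attained phi0.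
(* Otherwise phi could be divided by the linear polynomial with zero c, which would
   lower the degree in t of the leading coefficients. *)
have prim c : exists i, at_t c (phi i) != 0.
  apply: NNPP => no; have h i : exists q, phi i = ('X - c%:P)%:P * q.
    by apply: at_t_eq0; apply/eqP/negPn/negP => hi; apply: no; exists i.
  have [psi hpsi] := fin_all_exists h.
  have c0 : 'X - c%:P != 0 :> R by rewrite polyXsubC_eq0.
  have sz i : size (psi i) = size (phi i) by rewrite hpsi size_Cmul.
  have vpsi : vsize psi = vsize phi.
    by rewrite /vsize; apply: eq_bigr => i _; rewrite sz.
  have psig : good psi.
    split; first by exists i0; apply: contraNneq lead0 => p0; rewrite hpsi p0 mulr0 coef0.
    move=> i j; apply: (@mulfI _ ('X - c%:P)%:P); first by rewrite polyC_eq0.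
    by rewrite !mulrA -!hpsi phig.
  have := min2 psi (conj psig (etrans vpsi vphi)); rewrite leqNgt; case/negP.
  rewrite /leading_size vpsi (bigD1 i0) //= [X in (_ < X)%N](bigD1 i0) //=.
  have hs i : (phi i)`_(vsize phi).-1 = ('X - c%:P) * (psi i)`_(vsize phi).-1.
    by rewrite hpsi coefCM.
  have le i : (size ((psi i)`_(vsize phi).-1)%R <= size ((phi i)`_(vsize phi).-1)%R)%N.
    rewrite hs; have [->|nz] := eqVneq (psi i)`_(vsize phi).-1 0.
      by rewrite mulr0 size_poly0.
    by rewrite size_mul // size_XsubC /= ltnW.
  rewrite -addSn; apply: leq_add; last by apply: leq_sum => i _; apply: le.
  have nz : (psi i0)`_(vsize phi).-1 != 0.
    by apply: contraNneq lead0 => p0; rewrite hs p0 mulr0.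
  by rewrite hs size_mul // size_XsubC.
(* Division with remainder over the fractions of k[t], with cleared denominators. *)
have euclid N v : (vsize v <= N)%N -> prop v phi ->
    exists a, a != 0 /\ exists h, forall i, a *: v i = h * phi i.
  elim: N v => [|N IH] v sv vphi'.
    exists 1; split; first exact: oner_neq0.
    exists 0 => i; rewrite mul0r; suff -> : v i = 0 by rewrite scaler0.
    by apply/eqP; rewrite -size_poly_eq0 -leqn0 (leq_trans (vsize_ge v i)).
  have [v0|vn0] := classic (nonzero v); last first.
    exists 1; split; first exact: oner_neq0.
    exists 0 => i; rewrite mul0r; suff -> : v i = 0 by rewrite scaler0.
    by apply/eqP/negPn/negP => hi; apply: vn0; exists i.
  have le : (vsize phi <= vsize v)%N.
    by rewrite vphi; apply: min1; split=> //; apply: prop_trans phig.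
  pose d := (vsize v).-1; pose n := (vsize phi).-1.
  have sn i : (size (phi i) <= n.+1)%N by rewrite /n prednK.
  have vvpos := leq_trans vpos le.
  have sd i : (size (v i) <= d.+1)%N by rewrite /d prednK.
  have dn : (n <= d)%N by rewrite /n /d; case: (vsize phi) (vsize v) le => [|?] [|?].
  pose a := (phi i0)`_n; pose b := (v i0)`_d.
  pose w i := a *: v i - (b *: 'X^(d - n)) * phi i.
  have sw i : (size (w i) <= d)%N.
    apply/leq_sizeP => j; rewrite leq_eqVlt => /orP[/eqP<-|dj].
      rewrite /w coefB coefZ -scalerAl coefZ coefXnM ltnNge leq_subr /= subKn //.
      have := congr1 (fun r : {poly R} => r`_(d + n)) (vphi' i i0).
      by rewrite !coef_mul_top // -/a -/b mulrC => ->; rewrite subrr.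
    rewrite /w coefB coefZ -scalerAl coefZ coefXnM.
    have vj : (v i)`_j = 0 by apply/(leq_sizeP _ _ (sd i)).
    have pj : (phi i)`_(j - (d - n)) = 0 by apply/(leq_sizeP _ _ (sn i)); lia.
    by rewrite vj pj; case: ifP => _; rewrite !mulr0 subrr.
  have [||a2 [a20 [h hh]]] := IH w.
  - apply/bigmax_leqP => i _; apply: leq_trans (sw i) _.
    by rewrite -ltnS (leq_trans _ sv) // /d prednK.
  - move=> i j; rewrite /w !mulrBl -!scalerAl (vphi' i j); congr (_ - _).
    by rewrite -!mulrA [phi i * _]mulrC.
  exists (a2 * a); split; first by rewrite mulf_neq0.
  exists (h + a2 *: (b *: 'X^(d - n))) => i.
  by rewrite mulrDl -hh /w scalerBr -!scalerAl subrK scalerA.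
have [|a [a0 [h hh]]] := euclid (vsize u) u (leqnn _).
  by apply: prop_trans (prop_sym phig).
(* A zero of the denominator a is a zero of h too, because phi does not vanish
   there; so it can be cancelled. *)
move: {2}(size a) (leqnn (size a)) h hh a0 => N.
elim: N a => [|N IH] a; first by rewrite leqn0 size_poly_eq0 => /eqP-> ? _; rewrite eqxx.
move=> sa h hh a0; have [s1|s1] := eqVneq (size a) 1%N.
  have /eqP/size_poly1P[c c0 def_a] := s1.
  exists (c^-1%:P *: h) => i; rewrite -scalerAl -hh def_a scalerA -polyCM.
  by rewrite mulVf // scale1r.
have [c /factor_theorem[a' def_a]] := closed_rootP a s1.
have a'0 : a' != 0 by apply: contraNneq a0 => e; rewrite def_a e mul0r.
have [i1 hi1] := prim c.
have h0 : at_t c h = 0.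
  have := congr1 (at_t c) (hh i1); rewrite /at_t map_polyZ rmorphM /= => /eqP.
  rewrite def_a /horner_eval hornerM hornerXsubC subrr mulr0 scale0r eq_sym.
  by rewrite mulf_eq0 (negPf hi1) orbF => /eqP.
have [h' def_h] := at_t_eq0 h0.
apply: (IH a' _ h') => // [|i].
  by rewrite -ltnS (leq_trans _ sa) // def_a size_mul ?polyXsubC_eq0 // size_XsubC addn2.
apply: (@mulfI _ ('X - c%:P)%:P); first by rewrite polyC_eq0 polyXsubC_eq0.
by rewrite mulrA -def_h -hh def_a mul_polyC scalerA mulrC.
Qed.

End PrimitiveDirection.

(** * Regular maps from a cubic hypersurface *)

Section RegularMaps.
Variables (k : closedFieldType).
Notation V := 'cV[k]_5.
Implicit Types (a b v w : V) (c r t : k) (H : 'I_5 -> {mpoly k[5]}).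

(** A regular map from X to itself, on vectors: s v is any nonzero vector over the
  image of the point v, so that s carries no structure beyond its local lifts H. *)
Record regular_map (T : V -> V -> V -> k) (s : V -> V) : Prop := RegularMap {
  reg_neq0 : forall v, v != 0 -> T v v v = 0 -> s v != 0;
  reg_cubic : forall v, v != 0 -> T v v v = 0 -> T (s v) (s v) (s v) = 0;
  reg_lift : forall v, v != 0 -> T v v v = 0 -> exists d H,
    [/\ forall i, H i \is d.-homog, forms_eval H v != 0 &
      forall w, w != 0 -> T w w w = 0 -> collinear (forms_eval H w) (s w)] }.

Lemma forms_evalZ d H c v : (forall i, H i \is d.-homog) ->
  forms_eval H (c *: v) = c ^+ d *: forms_eval H v.
Proof.
by move=> hH; apply/matrixP => i j; rewrite !mxE (peval_homogZ _ _ (hH i)).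
Qed.

Lemma polypath_forms H (P : k -> V) : polypath P ->
  polypath (fun t => forms_eval H (P t)).
Proof.
by move=> hP i; apply: polyfun_eq (polyfun_peval (H i) hP) => t; rewrite mxE.
Qed.

Lemma polypath_neq0 (P : k -> V) : polypath P -> (exists t, P t != 0) ->
  generically (fun t => P t != 0).
Proof.
move=> hP [t /cV_neq0[i Pi]].
apply: generically_imp (polyfun_generic (hP i) (ex_intro _ t Pi)) => s.
by apply: contraNneq => ->; rewrite mxE.
Qed.

Lemma collinear_paths (P Q : k -> V) : polypath P -> polypath Q ->
  generically (fun t => collinear (P t) (Q t)) -> forall t, collinear (P t) (Q t).
Proof.
move=> hP hQ hg t i j; move: t; apply: polyfun_ext; try exact: polyfunM.
by apply: generically_imp hg => t; apply.
Qed.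

Variables (T : V -> V -> V -> k) (s : V -> V) (Hs : regular_map T s).

Lemma reg_collinear v w : symmetric_trilinear T -> v != 0 -> w != 0 ->
  T v v v = 0 -> collinear w v -> collinear (s w) (s v).
Proof.
move=> HT v0 w0 fv /(collinearP_neq0 v0 w0)[c c0 def_w].
have fw : T w w w = 0 by rewrite def_w !(triE HT) fv !mulr0.
have [d [H [hH Hv cH]]] := reg_lift Hs v0 fv.
have h1 := cH v v0 fv; have h2 := cH w w0 fw.
have cd : c ^+ d != 0 by rewrite expf_neq0.
apply: collinear_trans (h1) => //; apply: collinear_sym.
by rewrite def_w (forms_evalZ _ _ hH) -def_w in h2; apply: collinearZ_neq0 h2.
Qed.

(** Near t the map is given by forms, and the minors that compare them to N are
  polynomials in t that vanish generically. *)
Lemma lift_closure (P N : k -> V) :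
  polypath P -> (forall t, T (P t) (P t) (P t) = 0) -> polypath N ->
  generically (fun t => P t != 0 -> collinear (N t) (s (P t))) ->
  forall t, P t != 0 -> collinear (N t) (s (P t)).
Proof.
move=> hP fP hN hg t0 Pt0.
have [d [H [hH Ht0 cH]]] := reg_lift Hs Pt0 (fP t0).
have pH := polypath_forms H hP.
suff hc t : collinear (N t) (forms_eval H (P t)).
  exact: collinear_trans Ht0 (hc t0) (cH _ Pt0 (fP t0)).
move: t; apply: collinear_paths => //.
have hP0 := polypath_neq0 hP (ex_intro _ t0 Pt0).
apply: generically_imp (generically_and hg hP0) => t [hNt Pt].
have sP := reg_neq0 Hs Pt (fP t).
by apply: collinear_trans (hNt Pt) _ => //; apply/collinear_sym/cH.
Qed.

(** A one-parameter family of lines in X. The images of the lines are rational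
  curves whose parametrization of minimal degree n varies polynomially, without
  base points and without loss of degree: hence the degree of the image is the
  same for all members of the family. *)
Lemma family_lift (A B : k -> V) :
  polypath A -> polypath B ->
  (forall t c r, T (c *: A t + r *: B t) (c *: A t + r *: B t) (c *: A t + r *: B t) = 0) ->
  (exists t, A t != 0) ->
  exists n (Phi : nat -> k -> V), [/\ forall j, polypath (Phi j),
    forall t r, A t + r *: B t != 0 ->
      let w := \sum_(j < n.+1) r ^+ j *: Phi j t in
      w != 0 /\ collinear w (s (A t + r *: B t)) &
    forall t, B t != 0 -> Phi n t != 0 /\ collinear (Phi n t) (s (B t))].
Proof.
move=> hA hB fAB [t0 At0].
have fA t r : T (A t + r *: B t) (A t + r *: B t) (A t + r *: B t) = 0.
  by have := fAB t 1 r; rewrite scale1r.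
have fB t : T (B t) (B t) (B t) = 0.
  by have := fAB t 0 1; rewrite scale0r scale1r add0r.
have [a ha] := fin_all_exists hA; have [b hb] := fin_all_exists hB.
pose lift H i : {poly {poly k}} := line_poly (@polyC k) a b (H i).
have liftE H i t r : (lift H i).[r%:P].[t] = peval (H i) (A t + r *: B t).
  rewrite /lift /line_poly -[_.[t]]/((horner_eval t \o horner_eval r%:P) _).
  rewrite rmorph_mmap /peval /meval /mmap; apply: eq_bigr => m _.
  rewrite /= /horner_eval !hornerC; congr (_ * _); rewrite /mmap1.
  apply: eq_bigr => l _; congr (_ ^+ _).
  by rewrite !mxE hornerD hornerC hornerZ hornerX hornerD hornerM hornerC -ha -hb mulrC.
have liftT H d i t : H i \is d.-homog ->
    (size (lift H i) <= d.+1)%N /\ ((lift H i)`_d).[t] = peval (H i) (B t).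
  move=> hH; have [sz ->] := line_poly_homog (@polyC k) a b hH; split=> //.
  rewrite -[_.[t]]/(horner_eval t _) rmorph_mmap /peval /meval /mmap.
  apply: eq_bigr => m _; rewrite /= /horner_eval hornerC; congr (_ * _).
  by rewrite /mmap1; apply: eq_bigr => l _; rewrite -hb.
have At0' : A t0 + 0 *: B t0 != 0 by rewrite scale0r addr0.
have [d0 [H0 [hH0 H0t cH0]]] := reg_lift Hs At0' (fA t0 0).
have g0 : exists i, lift H0 i != 0.
  have [i hi] := cV_neq0 H0t; exists i; apply: contraNneq hi => z.
  by rewrite mxE -liftE z !horner0.
have [phi [phi0 phig phiP]] := primitive_direction g0.
pose N := (\max_i size (phi i))%N; pose n := N.-1.
have sphi i : (size (phi i) <= N)%N by apply: leq_bigmax.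
have Npos : (0 < N)%N.
  by have [i hi] := phi0; apply: leq_trans (sphi i); rewrite size_poly_gt0.
pose Phi j t : V := \col_i ((phi i)`_j).[t].
have PhiE t r : \sum_(j < n.+1) r ^+ j *: Phi j t = \col_i (phi i).[r%:P].[t].
  apply/matrixP => i j; rewrite summxE mxE.
  have sn : (size (phi i) <= n.+1)%N by rewrite /n prednK.
  rewrite (horner_coef_wide r%:P sn) horner_sum; apply: eq_bigr => l _.
  by rewrite !mxE hornerM horner_exp hornerC mulrC.
(* Any two lifts are proportional along the family, and phi generates all vectors
   proportional to the first one. *)
have liftP d H : (forall i, H i \is d.-homog) ->
    (forall w, w != 0 -> T w w w = 0 -> collinear (forms_eval H w) (s w)) ->
    exists h, forall i, lift H i = h * phi i.
  move=> hH cH; apply: phiP => i j.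
  have vanish (p : {poly {poly k}}) : (forall t r, p.[r%:P].[t] = 0) -> p = 0.
    move=> hp; apply/polyP => l; rewrite coef0; apply: poly_fun_eq0 => t.
    have p0 : map_poly (horner_eval t) p = 0.
      apply: poly_fun_eq0 => r; rewrite -[RHS](hp t r).
      rewrite -[in LHS](hornerC r t) -[_.[t] in RHS]/(horner_eval t _).
      by rewrite -[r%:P.[t]]/(horner_eval t _) horner_map.
    by have := congr1 (fun q : {poly k} => q`_l) p0; rewrite coef_map coef0.
  (* Nothing is known where A t + r B t = 0; so the identity is multiplied by a
     coordinate of this vector that is not identically zero. *)
  have [l hl] := cV_neq0 At0.
  have al : (a l)%:P + b l *: 'X != 0 :> {poly {poly k}}.
    apply: contraNneq hl => z; rewrite ha.
    have := congr1 (fun q : {poly {poly k}} => q`_0) z.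
    by rewrite coefD coefC coefZ coefX mulr0 addr0 coef0 => ->; rewrite horner0.
  have XE t r : ((a l)%:P + b l *: 'X).[r%:P].[t] = (A t + r *: B t) l 0.
    rewrite !mxE ha hb hornerD hornerC hornerZ hornerX hornerD hornerM hornerC.
    by rewrite [r * _]mulrC.
  move: (_ + _) al XE => X X0 XE.
  apply/eqP; rewrite -subr_eq0; apply/eqP/(mulfI X0); rewrite mulr0.
  apply: vanish => t r.
  rewrite !(hornerM, hornerD, hornerN) !liftE XE.
  have [->|nz] := eqVneq (A t + r *: B t) 0; first by rewrite mxE mul0r.
  have h1 := cH0 _ nz (fA t r); have h2 := cH _ nz (fA t r).
  have := collinear_trans (reg_neq0 Hs nz (fA t r)) h2 (collinear_sym h1).
  by move=> /(_ i j); rewrite !mxE => ->; rewrite subrr mulr0.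
exists n, Phi; split=> [j i|t r nz w|t Bt].
- by exists (phi i)`_j => t; rewrite mxE.
- have [d [H [hH Hnz cH]]] := reg_lift Hs nz (fA t r).
  have [h hh] := liftP d H hH cH.
  have eH : forms_eval H (A t + r *: B t) = h.[r%:P].[t] *: w.
    apply/matrixP => i j; rewrite /w PhiE !mxE -liftE hh.
    by rewrite !hornerM.
  have hnz : h.[r%:P].[t] != 0.
    by apply: contraNneq Hnz => z; rewrite eH z scale0r.
  split; first by apply: contraNneq Hnz => z; rewrite eH z scaler0.
  by apply: collinearZ_neq0 hnz _; rewrite -eH; apply: cH.
have [d [H [hH Hnz cH]]] := reg_lift Hs Bt (fB t).
have [h hh] := liftP d H hH cH.
have h0 : h != 0.
  have [i hi] := cV_neq0 Hnz; apply: contraNneq hi => z.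
  by rewrite mxE -(liftT H d i t (hH i)).2 hh z mul0r coef0 horner0.
pose e := (size h).-1.
have se : (size h <= e.+1)%N by rewrite /e prednK ?size_poly_gt0.
have sn i : (size (phi i) <= n.+1)%N by rewrite /n prednK.
have de : d = (e + n)%N.
  apply/eqP; rewrite eqn_leq; apply/andP; split.
    have [i hi] := cV_neq0 Hnz; rewrite leqNgt; apply: contra hi => lt.
    rewrite mxE -(liftT H d i t (hH i)).2 hh.
    rewrite (leq_sizeP _ _ (_ : (size (h * phi i)%R <= d)%N)) ?horner0 //.
    apply: leq_trans (size_polyMleq _ _) (leq_trans _ lt).
    have := leq_add se (sn i); rewrite addSn addnS.
    by case: (size h + size (phi i))%N => //= l; rewrite ltnS.
  have [i] : exists i, size (phi i) = N.
    have [|i0 hi0] := eq_bigmax (fun i => size (phi i)); first by rewrite card_ord.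
    by exists i0; rewrite -hi0.
  move=> si; have [sz _] := liftT H d i t (hH i).
  move: sz; rewrite hh size_mul //; last by rewrite -size_poly_gt0 si.
  have hpos : (0 < size h)%N by rewrite size_poly_gt0.
  by rewrite si -(prednK hpos) -(prednK Npos) -/e -/n addSn addnS /= ltnS.
have eH : forms_eval H (B t) = (h`_e).[t] *: Phi n t.
  apply/matrixP => i j; rewrite !mxE -(liftT H d i t (hH i)).2 hh de.
  by rewrite coef_mul_top // hornerM.
have hnz : (h`_e).[t] != 0 by apply: contraNneq Hnz => z; rewrite eH z scale0r.
split; first by apply: contraNneq Hnz => z; rewrite eH z scaler0.
by apply: collinearZ_neq0 hnz _; rewrite -eH; apply: cH.
Qed.

End RegularMaps.

(** * Bases of planes and invertible matrices *)
Section LinearAlgebra.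
Variables (k : fieldType) (m : nat).
Implicit Types (a b v w : 'cV[k]_m).

Lemma dual_pair W a b : plane_basis W a b -> exists xi0 xi1 : 'rV[k]_m,
  [/\ lform xi0 a = 1, lform xi0 b = 0, lform xi1 a = 0 & lform xi1 b = 1].
Proof.
move=> bW; have ab : a \notin <[b]>%VS.
  apply/negP => /vlineP[c ac]; have [] := pb_free bW (c := 1) (d := - c).
    by rewrite scale1r scaleNr ac subrr.
  by move/eqP; rewrite oner_eq0.
have ba : b \notin <[a]>%VS.
  apply/negP => /vlineP[c bc]; have [] := pb_free bW (c := - c) (d := 1).
    by rewrite scale1r scaleNr bc addNr.
  by move=> _ /eqP; rewrite oner_eq0.
have [xi0 h0 h0a] := separating_form ab; have [xi1 h1 h1b] := separating_form ba.
by exists xi0, xi1; split=> //; [apply: h0 | apply: h1]; apply: memv_line.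
Qed.

Lemma plane_basis_span a b : (forall c d, c *: a + d *: b = 0 -> c = 0 /\ d = 0) ->
  plane_basis (<[a]> + <[b]>)%VS a b.
Proof.
move=> free; split=> // [w|c d]; last by rewrite memv_add ?memvZ ?memv_line.
by case/mem_add_vector=> e /vlineP[c ->] [d ->]; exists c, d.
Qed.

Lemma unitmx_inj (M : 'M[k]_m) : (forall v, M *m v = 0 -> v = 0) -> M \in unitmx.
Proof.
move=> inj; rewrite -unitmx_tr -row_free_unit; apply: inj_row_free => v hv.
apply: (can_inj (@trmxK _ _ _)); rewrite trmx0; apply: inj.
by rewrite -[M]trmxK -trmx_mul hv trmx0.
Qed.

Lemma unitmx_eq0 (M : 'M[k]_m) v : M \in unitmx -> M *m v = 0 -> v = 0.
Proof. by move=> uM Mv; rewrite -(mulKmx uM v) Mv mulmx0. Qed.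

Lemma collinear_mulmx (M : 'M[k]_m) v w :
  collinear v w -> collinear (M *m v) (M *m w).
Proof.
have [->|w0] := eqVneq w 0; first by rewrite mulmx0 => _ i j; rewrite !mxE !mulr0.
by case/(collinearP w0)=> x ->; rewrite -scalemxAr; apply/collinearZ/collinear_refl.
Qed.

Lemma collinear_mulmx_inj (M : 'M[k]_m) v w : M \in unitmx ->
  collinear (M *m v) (M *m w) -> collinear v w.
Proof. by move=> uM /(collinear_mulmx (invmx M)); rewrite !mulKmx. Qed.

End LinearAlgebra.

(** A nowhere vanishing polynomial vector of degree n that is proportional to
  a + r b for all r has degree one: the factor has no zero, so it is constant. *)
Lemma nonvanishing_line_degree (k : closedFieldType) m n (Phi : nat -> 'cV[k]_m) W a b :
  plane_basis W a b ->
  (forall r, let w := \sum_(j < n.+1) r ^+ j *: Phi j in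
     w != 0 /\ collinear w (a + r *: b)) -> Phi n != 0 -> n = 1%N.
Proof.
move=> bW hw Phin; have [xi0 [xi1 [h0a h0b h1a h1b]]] := dual_pair bW.
pose w r := \sum_(j < n.+1) r ^+ j *: Phi j.
pose Pi i := \poly_(j < n.+1) Phi j i 0.
have wE r i : w r i 0 = (Pi i).[r].
  by rewrite /w summxE horner_poly; apply: eq_bigr => j _; rewrite mxE mulrC.
have [h hh] : polyfun (fun r => lform xi0 (w r)).
  apply: (@polyfun_eq _ (fun r => \sum_i xi0 0 i * w r i 0)) => [r|].
    by rewrite /lform mxE.
  apply: polyfun_sum => i; apply: polyfunM (polyfunC _) _.
  by apply: polyfun_eq (polyfun_horner (Pi i)) => r; rewrite wE.
have hline r : lform xi0 (a + r *: b) = 1 by rewrite lformD lformZ h0a h0b mulr0 addr0.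
have l0 r : a + r *: b != 0.
  by apply/eqP => z; have := hline r; rewrite z lform0 => /eqP; rewrite eq_sym oner_eq0.
have eq_w r : w r = h.[r] *: (a + r *: b).
  have [_ /(collinearP (l0 r))[x]] := hw r; rewrite -/(w r) => ex.
  by rewrite -hh ex lformZ hline mulr1.
have h_neq0 r : h.[r] != 0.
  by have [wr _] := hw r; apply: contraNneq wr => z; rewrite -/(w r) eq_w z scale0r.
have /size_poly1P[c c0 hc] : size h == 1%N.
  apply: contraT => /closed_rootP[r /rootP z].
  by have := h_neq0 r; rewrite z eqxx.
have PiE i : Pi i = c *: ((a i 0)%:P + b i 0 *: 'X).
  apply: poly_fun_inj => r; rewrite -wE eq_w hc hornerC !mxE.
  by rewrite hornerZ hornerD hornerC hornerZ hornerX [r * _]mulrC.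
have coefPi i j : (Pi i)`_j = c * ((if j == 0%N then a i 0 else 0) + b i 0 * (j == 1%N)%:R).
  by rewrite PiE coefZ coefD coefC coefZ coefX.
have [i Phi_i] := cV_neq0 Phin.
case: (ltngtP n 1) => [lt|gt|//].
  have b0 : b != 0.
    apply/eqP => z; have := pb_free bW (c := 0) (d := 1).
    rewrite z scale0r scaler0 addr0 => /(_ erefl)[_ /eqP].
    by rewrite oner_eq0.
  have [l bl] := cV_neq0 b0; have := coefPi l 1%N.
  rewrite coef_poly ltnS leqNgt lt /= add0r mulr1 => /esym/eqP.
  by rewrite mulf_eq0 (negPf c0) (negPf bl).
have := coefPi i n; rewrite coef_poly ltnSn (gtn_eqF gt) (gtn_eqF (ltnW gt)).
by rewrite mulr0 addr0 mulr0 => /eqP; rewrite (negPf Phi_i).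
Qed.

(** * Differentials of regular maps *)
Section Jacobian.
Variables (k : closedFieldType) (n : nat).
Implicit Types (H : 'I_n.+1 -> {mpoly k[n.+1]}) (p w : 'cV[k]_n.+1).

Definition jacobian H p : 'M[k]_n.+1 := \matrix_(i, j) peval (H i)^`M(j) p.

Lemma jacobianE H p w i : (jacobian H p *m w) i 0 = diff (H i) p w.
Proof. by rewrite mxE; apply: eq_bigr => j _; rewrite mxE mulrC. Qed.

Lemma pathjet_forms H P p w : pathjet P p w ->
  pathjet (fun t => forms_eval H (P t)) (forms_eval H p) (jacobian H p *m w).
Proof.
move=> hP i; rewrite jacobianE mxE.
by apply: jet_eq (jet_peval (H i) hP) => t; rewrite mxE.
Qed.

Lemma pathjet0 m (P : k -> 'cV[k]_m) (p w : 'cV[k]_m) : pathjet P p w -> P 0 = p.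
Proof. by move=> hP; apply/matrixP => i j; rewrite (ord1 j) (jet0 (hP i)). Qed.

Lemma pathjet_polypath m (P : k -> 'cV[k]_m) (p w : 'cV[k]_m) : pathjet P p w -> polypath P.
Proof. by move=> hP i; apply: jet_polyfun (hP i). Qed.

Lemma pathjet_collinear m (P Q : k -> 'cV[k]_m) (p q u v : 'cV[k]_m) :
  pathjet P p u -> pathjet Q q v -> (forall t, collinear (P t) (Q t)) ->
  forall i j, p i 0 * v j 0 + u i 0 * q j 0 = p j 0 * v i 0 + u j 0 * q i 0.
Proof.
move=> hP hQ hc i j; have h1 := jetM (hP i) (hQ j); have h2 := jetM (hP j) (hQ i).
by have [_] := jet_uniq h1 (jet_eq (fun t => esym (hc t i j)) h2).
Qed.

(** Proportional paths have proportional derivatives modulo their common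
  direction. *)
Lemma pathjet_collinear_scaled m (P Q : k -> 'cV[k]_m) (c d : k) (a u v : 'cV[k]_m) :
  pathjet P (c *: a) u -> pathjet Q (d *: a) v ->
  (forall t, collinear (P t) (Q t)) -> collinear (c *: v - d *: u) a.
Proof.
move=> hP hQ hc i j; have := pathjet_collinear hP hQ hc i j; rewrite !mxE => h.
apply/eqP; rewrite -subr_eq0; apply/eqP.
move/eqP: h; rewrite -subr_eq0 => /eqP h; rewrite -[RHS]oppr0 -h; ring.
Qed.

(** Euler's relation, read off from the expansion of F (p + t p). *)
Lemma diff_euler (F : {mpoly k[n.+1]}) d p : F \is d.-homog ->
  diff F p p = d%:R * peval F p.
Proof.
move=> hF; have j1 := jet_peval F (pathjet_line p p).
have j2 : jet (fun t => (1 + t) ^+ d * peval F p) (peval F p) (d%:R * peval F p).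
  have hj : jet (fun t : k => (1 + t) ^+ d) 1 d%:R.
    elim: d {hF} => [|d IH]; first by apply: jet_eq (jetC 1) => t; rewrite expr0.
    have := jetM (jet_affine 1 1) IH; rewrite !mul1r natr1.
    by apply: jet_eq => t; rewrite mulr1 exprS.
  by have := jetM hj (jetC (peval F p)); rewrite mul1r mulr0 add0r.
have line t : (1 + t) ^+ d * peval F p = peval F (p + t *: p).
  by rewrite -(peval_homogZ _ _ hF) scalerDl scale1r.
by have [_ ->] := jet_uniq j1 (jet_eq line j2).
Qed.

End Jacobian.

(** * The image of the double line *)

Section Automorphism.
Variables (k : closedFieldType) (char0 : [pchar k] =i pred0).
Notation V := 'cV[k]_5.
Implicit Types (E : {vspace V}) (a b p u v w x y z : V) (c r t : k) (d : nat) (H : 'I_5 -> {mpoly k[5]}).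
Variables (T : V -> V -> V -> k) (W : {vspace V}).
Hypothesis HX : double_line_cubic T W.
Let HT := dl_tri HX.
Let TE := triE HT.
Let three0 : 3%:R != 0 :> k := natS_neq0 char0 2.

Lemma tangent_linear p v w : p \in W -> disc (T p) v w != 0 ->
  forall l : V -> k, (forall x y, l (x + y) = l x + l y) ->
  (forall c x, l (c *: x) = c * l x) ->
  (forall u, tangent T p u -> l u = 0) -> forall u, l u = 0.
Proof.
move=> pW D0 l lD lZ l0 u.
have p0 : p != 0.
  by apply: contraNneq D0 => ->; rewrite /disc !(tri01 HT) mul0r expr0n subrr.
have [p' bW] := plane_basis_complete (dl_dim HX) pW p0.
have [xi hxi] := lform_of lD lZ.
rewrite -hxi; apply: (tangent_span char0 HX bW D0) => x hx; rewrite hxi; exact: l0.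
Qed.

Lemma tri_collinear0 v w : v != 0 -> collinear w v -> T v v v = 0 -> T w w w = 0.
Proof. by move=> v0 /(collinearP v0)[c ->] fv; rewrite !TE fv !mulr0. Qed.

Variables (s s' : V -> V).
Hypotheses (Hs : regular_map T s) (Hs' : regular_map T s').
Hypothesis ss' : forall v, v != 0 -> T v v v = 0 -> collinear (s' (s v)) v.

(** The forms H define s wherever they do not vanish simultaneously. *)
Record local_lift d H : Prop := LocalLift {
  lift_homog : forall i, H i \is d.-homog;
  lift_collinear : forall w, w != 0 -> T w w w = 0 -> collinear (forms_eval H w) (s w) }.

Lemma lift_exists v : v != 0 -> T v v v = 0 ->
  exists d H, local_lift d H /\ forms_eval H v != 0.
Proof.
by move=> v0 fv; have [d [H [h1 h2 h3]]] := reg_lift Hs v0 fv; exists d, H.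
Qed.

Lemma lift_cubic d H v : local_lift d H -> v != 0 -> T v v v = 0 ->
  T (forms_eval H v) (forms_eval H v) (forms_eval H v) = 0.
Proof.
move=> hH v0 fv.
exact: tri_collinear0 (reg_neq0 Hs v0 fv) (lift_collinear hH v0 fv) (reg_cubic Hs v0 fv).
Qed.

(** At a point p of the double line where the tangent vectors span, the
  differential of a lift of an automorphism is invertible, and the image of p is
  singular: both statements are proved along paths in X and extended by
  linearity. *)
Lemma jacobian_unit d H p v w : local_lift d H -> p \in W -> disc (T p) v w != 0 ->
  forms_eval H p != 0 ->
  jacobian H p \in unitmx /\ forall u, T (forms_eval H p) (forms_eval H p) u = 0.
Proof.
move=> hH pW D0 Hp0.
have p0 : p != 0.
  by apply: contraNneq D0 => ->; rewrite /disc !(tri01 HT) mul0r expr0n subrr.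
have fp : T p p p = 0 by apply: (dl_sing HX).
pose q := forms_eval H p; have fq : T q q q = 0 by apply: (lift_cubic hH).
have [e [K [hK Kq0 cK]]] := reg_lift Hs' Hp0 fq; rewrite -/q in Kq0.
have along u : tangent T p u -> exists2 P, cubic_path T P /\ pathjet P p u &
    generically (fun t => P t != 0 /\ forms_eval H (P t) != 0).
  case=> P cP jP; exists P => //; have [hP fP] := cP.
  apply: generically_and; apply: polypath_neq0.
  - exact: hP.
  - by exists 0; rewrite (pathjet0 jP).
  - exact: polypath_forms.
  by exists 0; rewrite (pathjet0 jP).
have KH P : cubic_path T P -> generically (fun t => P t != 0 /\ forms_eval H (P t) != 0) ->
    forall t, collinear (forms_eval K (forms_eval H (P t))) (P t).
  move=> [hP fP] hg; apply: collinear_paths => //.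
    by do 2!apply: polypath_forms.
  apply: generically_imp hg => t [Pt Ht].
  have fH := lift_cubic hH Pt (fP t).
  have sP := reg_neq0 Hs Pt (fP t).
  have fsP := reg_cubic Hs Pt (fP t).
  have h1 := cK _ Ht fH.
  have h2 := reg_collinear Hs' HT sP Ht fsP (lift_collinear hH Pt (fP t)).
  apply: collinear_trans (reg_neq0 Hs' Ht fH) h1 _.
  exact: collinear_trans (reg_neq0 Hs' sP fsP) h2 (ss' Pt (fP t)).
have Kqp : collinear (forms_eval K q) p.
  have [P [cP jP] hg] := along p (tangent_sing HX pW pW).
  by have := KH P cP hg 0; rewrite (pathjet0 jP).
have [om om0 Kq] := collinearP_neq0 p0 Kq0 Kqp.
(* The chain rule for the composition of K and H, which is the identity along X up to
   a factor. *)
have diffKH u : collinear (om *: u - jacobian K q *m (jacobian H p *m u)) p.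
  move=> i j; apply/eqP; rewrite -subr_eq0; apply/eqP; move: u.
  apply: (tangent_linear pW D0) => [x y|c x|u tu].
  - by rewrite !mulmxDr !mxE; ring.
  - by rewrite -!scalemxAr !mxE; ring.
  have [P [cP jP] hg] := along u tu.
  have jK : pathjet (fun t => forms_eval K (forms_eval H (P t)))
      (om *: p) (jacobian K q *m (jacobian H p *m u)).
    by rewrite -Kq; do 2!apply: pathjet_forms.
  have jP' : pathjet P (1 *: p) u by rewrite scale1r.
  have := pathjet_collinear_scaled jK jP' (KH P cP hg); rewrite scale1r.
  by move/(_ i j) ->; rewrite subrr.
have d_neq0 : d != 0%N.
  apply/eqP => d0.
  have [p' bW] := plane_basis_complete (dl_dim HX) pW p0.
  have J0 u : jacobian H p *m u = 0.
    apply/matrixP => i j; rewrite (ord1 j) jacobianE mxE.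
    have hH0 := lift_homog hH i; rewrite d0 in hH0.
    have cst v1 : peval (H i) v1 = peval (H i) 0.
      by have := peval_homogZ 0 v1 hH0; rewrite scale0r expr0 mul1r => ->.
    have j1 := jet_peval (H i) (pathjet_line p u).
    by have [_ ->] := jet_uniq j1 (jet_eq (fun t => esym (cst _)) (jetC _)).
  have := diffKH p'; rewrite J0 mulmx0 subr0 => /(collinearZ_neq0 om0).
  case/(collinearP p0)=> x ex; have [] := pb_free bW (c := 1) (d := - x).
    by rewrite scale1r ex scaleNr subrr.
  by move/eqP; rewrite oner_eq0.
have Jp : jacobian H p *m p = d%:R *: q.
  apply/matrixP => i j; rewrite (ord1 j) jacobianE !mxE.
  by rewrite (diff_euler _ (lift_homog hH i)).
have uJ : jacobian H p \in unitmx.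
  apply: unitmx_inj => u Ju; have := diffKH u; rewrite Ju mulmx0 subr0.
  move/(collinearZ_neq0 om0)/(collinearP p0) => [x ex].
  move: Ju; rewrite ex -scalemxAr Jp scalerA => /eqP.
  rewrite scaler_eq0 (negPf Hp0) orbF mulf_eq0 => /orP[/eqP->|].
    by rewrite scale0r.
  by case: d d_neq0 {hH Jp} => // d' _; rewrite (negPf (natS_neq0 char0 d')).
split=> // u.
have hJ x : T q q (jacobian H p *m x) = 0.
  move: x; apply: (tangent_linear pW D0) => [x y|c x|x tx].
  - by rewrite mulmxDr !TE.
  - by rewrite -scalemxAr !TE.
  have [P [cP jP] hg] := along x tx; have [hP fP] := cP.
  have jT := jet_tri_cube HT (pathjet_forms H jP).
  have fH t : T (forms_eval H (P t)) (forms_eval H (P t)) (forms_eval H (P t)) = 0.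
    move: t; apply: polyfun_eq0.
      by apply: polyfun_tri => //; apply: polypath_forms.
    by apply: generically_imp hg => t [Pt _]; apply: (lift_cubic hH).
  have [_] := jet_uniq jT (jet_eq (fun t => esym (fH t)) (jetC 0)).
  exact: mulf_cancel0.
by rewrite -[u](mulKVmx uJ).
Qed.

End Automorphism.

Lemma coef_exp_top (R : nzRingType) (p : {poly R}) d m :
  (size p <= d.+1)%N ->
  (size (p ^+ m)%R <= (d * m).+1)%N /\ (p ^+ m)`_(d * m) = p`_d ^+ m.
Proof.
move=> sp; elim: m => [|m [IHs IHc]].
  by rewrite !expr0 muln0 size_poly1 coefC.
rewrite !exprS mulnS; split; last by rewrite coef_mul_top // IHc.
apply: leq_trans (size_polyMleq _ _) _; have := leq_add sp IHs.
by rewrite addSn addnS; case: (_ + _)%N => //= l; rewrite ltnS.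
Qed.

Section LineImage.
Variables (k : closedFieldType) (char0 : [pchar k] =i pred0).
Notation V := 'cV[k]_5.
Implicit Types (E : {vspace V}) (a b p u v w x y z : V) (c r t : k) (n d : nat)
  (H : 'I_5 -> {mpoly k[5]}).

(** The parametrization of degree n of a rational curve, in homogeneous form. *)
Definition binary_form n (Phi : nat -> V) (c r : k) : V :=
  \sum_(j < n.+1) (c ^+ (n - j) * r ^+ j) *: Phi j.

Section Homogenize.
Variables (T : V -> V -> V -> k) (s : V -> V).
Hypotheses (HT : symmetric_trilinear T) (Hs : regular_map T s).

(** The affine parametrization has no base points, and its leading coefficient is
  the image of the point at infinity. *)
Lemma homogenize_lift a b n (Phi : nat -> V) :
  (forall c r, c *: a + r *: b = 0 -> c = 0 /\ r = 0) ->
  (forall c r, T (c *: a + r *: b) (c *: a + r *: b) (c *: a + r *: b) = 0) ->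
  (forall r, let w := \sum_(j < n.+1) r ^+ j *: Phi j in
     w != 0 /\ collinear w (s (a + r *: b))) ->
  Phi n != 0 /\ collinear (Phi n) (s b) ->
  forall c r, (c != 0) || (r != 0) -> binary_form n Phi c r != 0 /\
    collinear (binary_form n Phi c r) (s (c *: a + r *: b)).
Proof.
move=> free fab h1 [Phin hb] c r cr.
have nz c' r' : (c' != 0) || (r' != 0) -> c' *: a + r' *: b != 0.
  by apply: contraTneq => /free[-> ->]; rewrite eqxx.
have b0 : b != 0.
  by have := nz 0 1; rewrite scale1r scale0r add0r oner_neq0 orbT => ->.
have [c0|c0] := eqVneq c 0.
  have r0 : r != 0 by move: cr; rewrite c0 eqxx.
  have -> : binary_form n Phi c r = r ^+ n *: Phi n.
    rewrite /binary_form big_ord_recr /= subnn expr0 mul1r big1 ?add0r // => j _.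
    by rewrite c0 expr0n subn_eq0 leqNgt ltn_ord /= mul0r scale0r.
  have rn : r ^+ n != 0 by rewrite expf_neq0.
  split; first by rewrite scaler_eq0 negb_or rn.
  rewrite c0 scale0r add0r; apply: collinearZ.
  have fb : T b b b = 0 by have := fab 0 1; rewrite scale0r scale1r add0r.
  apply: collinear_trans (reg_neq0 Hs b0 fb) hb _; apply/collinear_sym.
  have rb0 : r *: b != 0 by rewrite scaler_eq0 negb_or r0.
  exact: reg_collinear HT b0 rb0 fb (collinearZ r (collinear_refl b)).
have eA : c *: a + r *: b = c *: (a + (r / c) *: b).
  by rewrite scalerDr scalerA mulrCA divff // mulr1.
have nz1 : a + (r / c) *: b != 0 by have := nz 1 (r / c); rewrite scale1r oner_neq0 => ->.
have [] := h1 (r / c); set w := \sum_(j < _) _ => w0 hw.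
have -> : binary_form n Phi c r = c ^+ n *: w.
  rewrite scaler_sumr; apply: eq_bigr => j _; rewrite scalerA; congr (_ *: _).
  have jn : (j <= n)%N by rewrite -ltnS.
  have -> : c ^+ n = c ^+ (n - j) * c ^+ j by rewrite -exprD subnK.
  rewrite exprMn exprVn -mulrA; congr (_ * _).
  by rewrite mulrCA divff ?mulr1 // expf_neq0.
have cn : c ^+ n != 0 by rewrite expf_neq0.
split; first by rewrite scaler_eq0 negb_or cn.
apply: collinearZ; rewrite eA.
have f1 : T (a + (r / c) *: b) (a + (r / c) *: b) (a + (r / c) *: b) = 0.
  by have := fab 1 (r / c); rewrite scale1r.
apply: collinear_trans (reg_neq0 Hs nz1 f1) hw _; apply/collinear_sym.
have cn1 : c *: (a + (r / c) *: b) != 0 by rewrite scaler_eq0 negb_or c0.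
exact: reg_collinear HT nz1 cn1 f1 (collinearZ c (collinear_refl _)).
Qed.

Lemma line_lift a b : (forall c r, c *: a + r *: b = 0 -> c = 0 /\ r = 0) ->
  (forall c r, T (c *: a + r *: b) (c *: a + r *: b) (c *: a + r *: b) = 0) ->
  exists n Phi, Phi n != 0 /\ forall c r, (c != 0) || (r != 0) ->
    binary_form n Phi c r != 0 /\
    collinear (binary_form n Phi c r) (s (c *: a + r *: b)).
Proof.
move=> free fab.
have nz c r : (c != 0) || (r != 0) -> c *: a + r *: b != 0.
  by apply: contraTneq => /free[-> ->]; rewrite eqxx.
have a0 : a != 0 by have := nz 1 0; rewrite scale1r scale0r addr0 oner_neq0 => ->.
have b0 : b != 0.
  by have := nz 0 1; rewrite scale1r scale0r add0r oner_neq0 orbT => ->.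
have [n [Phi [_ h1 h2]]] := family_lift Hs (polypathC a) (polypathC b)
  (fun _ => fab) (ex_intro _ 0 a0).
exists n, (Phi^~ 0); have [Phin hb] := h2 0 b0; split=> //.
apply: homogenize_lift => // r; apply: h1.
by have := nz 1 r; rewrite scale1r oner_neq0 => ->.
Qed.

End Homogenize.

Variables (T : V -> V -> V -> k) (W : {vspace V}).
Hypothesis HX : double_line_cubic T W.
Let HT := dl_tri HX.
Let TE := triE HT.
Variables (s s' : V -> V).
Hypotheses (Hs : regular_map T s) (Hs' : regular_map T s').
Hypothesis ss' : forall v, v != 0 -> T v v v = 0 -> collinear (s' (s v)) v.
Variables (e0 e1 v0 w0 : V).
Hypotheses (bW : plane_basis W e0 e1) (D0 : disc (T e1) v0 w0 != 0).

Lemma generic_rank2 : generically (fun r => disc (T (e0 + r *: e1)) v0 w0 != 0).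
Proof.
have pD : polyfun (fun r => disc (T (e0 + r *: e1)) v0 w0).
  have pT a b : polyfun (fun r => T (e0 + r *: e1) a b).
    by apply: polyfun_tri => //; [apply: polypath_line | apply: polypathC | apply: polypathC].
  by apply: polyfunB; [apply: polyfun_exp | apply: polyfunM].
apply: (polyfun_generic pD); apply: NNPP => no.
have z r : disc (T (e0 + r *: e1)) v0 w0 = 0.
  by apply/eqP/negPn/negP => h; apply: no; exists r.
case/eqP: D0; have [_ _ -> _ _ //] : [/\ disc (T e0) v0 w0 = 0,
  2%:R * T e0 v0 w0 * T e1 v0 w0 - T e0 v0 v0 * T e1 w0 w0 - T e1 v0 v0 * T e0 w0 w0 = 0,
  disc (T e1) v0 w0 = 0, 0 = 0 :> k & 0 = 0 :> k].
apply: quartic_eq0 => r; rewrite -[RHS](z r) /disc !TE; ring.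
Qed.

Lemma reg_inj v w : v != 0 -> w != 0 -> T v v v = 0 -> T w w w = 0 ->
  collinear (s v) (s w) -> collinear v w.
Proof.
move=> v1 w1 fv fw cs; have sv := reg_neq0 Hs v1 fv; have sw := reg_neq0 Hs w1 fw.
have fsv := reg_cubic Hs v1 fv; have fsw := reg_cubic Hs w1 fw.
have h := reg_collinear Hs' HT sw sv fsw cs.
apply: collinear_trans (reg_neq0 Hs' sv fsv) (collinear_sym (ss' v1 fv)) _.
exact: collinear_trans (reg_neq0 Hs' sw fsw) h (ss' w1 fw).
Qed.

(** The automorphism maps the double line isomorphically onto a line of singular
  points. The image is a curve in the singular locus, hence lies on a line; the
  degree is one because the inverse is regular along the image line. *)
Lemma double_line_image : exists l0 l1,
  [/\ forall c r, c *: l0 + r *: l1 = 0 -> c = 0 /\ r = 0,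
      forall c r, collinear (c *: l0 + r *: l1) (s (c *: e0 + r *: e1)) &
      forall w w' v, w \in (<[l0]> + <[l1]>)%VS -> w' \in (<[l0]> + <[l1]>)%VS ->
        T w w' v = 0].
Proof.
have fW c r : T (c *: e0 + r *: e1) (c *: e0 + r *: e1) (c *: e0 + r *: e1) = 0.
  by apply: (dl_sing HX); apply: (pb_mem bW).
have nzW c r : (c != 0) || (r != 0) -> c *: e0 + r *: e1 != 0.
  by apply: contraTneq => /(pb_free bW)[-> ->]; rewrite eqxx.
have [n [Ph [Phn hPh]]] := line_lift HT Hs (pb_free bW) fW.
pose L r := binary_form n Ph 1 r.
have LE r : L r = \sum_(j < n.+1) r ^+ j *: Ph j.
  by apply: eq_bigr => j _; rewrite expr1n mul1r.
have nz1 r : e0 + r *: e1 != 0 by have := nzW 1 r; rewrite scale1r oner_neq0 => ->.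
have f1 r : T (e0 + r *: e1) (e0 + r *: e1) (e0 + r *: e1) = 0.
  by have := fW 1 r; rewrite scale1r.
have hL r : L r != 0 /\ collinear (L r) (s (e0 + r *: e1)).
  by have := hPh 1 r; rewrite scale1r oner_neq0 => /(_ isT).
have pL : polypath L.
  move=> i; apply: (@polyfun_eq _ (fun r => \sum_(j < n.+1) r ^+ j * Ph j i 0)).
    by move=> r; rewrite LE summxE; apply: eq_bigr => j _; rewrite mxE.
  apply: polyfun_sum => j; apply: polyfunM (polyfunC _).
  exact: polyfun_exp (polyfunX _).
(* The image of a general point is singular, and this is a closed condition. *)
have sL r v : T (L r) (L r) v = 0.
  move: r; apply: polyfun_eq0; first by apply: polyfun_tri => //; apply: polypathC.
  apply: generically_imp generic_rank2 => r Dr.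
  have [d [H [hH Hnz]]] := lift_exists Hs (nz1 r) (f1 r).
  have pW : e0 + r *: e1 \in W by have := pb_mem bW 1 r; rewrite scale1r.
  have [_ sing] := jacobian_unit char0 HX Hs Hs' ss' hH pW Dr Hnz.
  have hc : collinear (L r) (forms_eval H (e0 + r *: e1)).
    apply: collinear_trans (reg_neq0 Hs (nz1 r) (f1 r)) (hL r).2 _.
    exact/collinear_sym/(lift_collinear hH).
  by have [x ->] := collinearP Hnz hc; rewrite !TE sing !mulr0.
have [W' [dW' LW' sW']] : exists W', [/\ \dim W' = 2%N, forall r, L r \in W' &
    forall w w' v, w \in W' -> w' \in W' -> T w w' v = 0].
  have [LW|[s1 [n0 [z1W n0W n0z [_ Lin]]]]] := singular_path char0 HX pL sL.
    by exists W; split; [apply: (dl_dim HX) | | apply: (dl_sing HX)].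
  exists (<[n0]> + <[L s1]>)%VS; split=> //.
    rewrite dim_add_vector ?dim_vline; last first.
      by apply: contra z1W => /vlineP[x ->]; rewrite memvZ.
    suff -> : n0 != 0 by [].
    apply/eqP => n00; have := Lin (s1 + 1); rewrite n00 => /mem_add_vector[e].
    case/vlineP=> y ->; rewrite scaler0 => -[x]; rewrite add0r => ex.
    have hc : collinear (L (s1 + 1)) (L s1) by rewrite ex; apply/collinearZ/collinear_refl.
    have : collinear (e0 + (s1 + 1) *: e1) (e0 + s1 *: e1).
      apply: reg_inj => //.
      apply: collinear_trans (hL _).1 (collinear_sym (hL _).2) _.
      exact: collinear_trans (hL _).1 hc (hL _).2.
    case/(collinearP (nz1 s1)) => q eq1.
    have [] := pb_free bW (c := 1 - q) (d := s1 + 1 - q * s1).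
      rewrite !scalerBl scale1r addrACA [X in X + _ = 0]addrC -opprD -[q * s1]mulrC.
      rewrite -scalerA scalerA [s1 * q]mulrC -scalerA -scalerDr addrC.
      by rewrite [X in X + _ = 0]eq1 subrr.
    move/eqP; rewrite subr_eq0 => /eqP <-; rewrite mul1r addrAC subrr add0r.
    by move/eqP; rewrite oner_eq0.
  move=> w w' v /mem_add_vector[_ /vlineP[c1 ->] [c2 ->]].
  case/mem_add_vector=> _ /vlineP[c3 ->] [c4 ->].
  by rewrite !TE (dl_sing HX) // n0z (tri12 HT (L s1)) n0z sL !(mulr0, addr0).
have [w1 [w2 [w10 w21 eW']]] := dim_plane_basis dW'.
have w1W' : w1 \in W' by rewrite eW' (subvP (addvSl _ _)) ?memv_line.
have w2W' : w2 \in W' by rewrite eW' (subvP (addvSr _ _)) ?memv_line.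
have bW' := plane_basis_swap (plane_basis_pair dW' w2W' w1W' w10 w21).
have fW' c r : T (c *: w1 + r *: w2) (c *: w1 + r *: w2) (c *: w1 + r *: w2) = 0.
  by apply: sW'; apply: (pb_mem bW').
have [n' [Ps [_ hPs]]] := line_lift HT Hs' (pb_free bW') fW'.
have PhW' j : (j < n.+1)%N -> Ph j \in W'.
  move=> jn; apply: contraT => /separating_form[xi xiW' xij].
  have p0 : \poly_(j < n.+1) lform xi (Ph j) = 0.
    apply: poly_fun_eq0 => r; rewrite horner_poly -[RHS](xiW' _ (LW' r)) LE.
    rewrite (big_morph (lform xi) (lformD xi) (lform0 xi)).
    by apply: eq_bigr => l _; rewrite lformZ mulrC.
  have := congr1 (fun q : {poly k} => q`_j) p0.
  by rewrite coef_poly jn xij coef0 => /eqP; rewrite oner_eq0.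
have [xi1 [xi2 [x11 x12 x21 x22]]] := dual_pair bW'.
have dec w : w \in W' -> w = lform xi1 w *: w1 + lform xi2 w *: w2.
  by move=> /(pb_span bW')[c [r ->]]; rewrite !(lformD, lformZ) x11 x12 x21 x22
    !mulr0 !mulr1 addr0 add0r.
pose pa := \poly_(j < n.+1) lform xi1 (Ph j).
pose pb := \poly_(j < n.+1) lform xi2 (Ph j).
have paE r : pa.[r] = lform xi1 (L r).
  rewrite horner_poly LE (big_morph (lform xi1) (lformD xi1) (lform0 xi1)).
  by apply: eq_bigr => l _; rewrite lformZ mulrC.
have pbE r : pb.[r] = lform xi2 (L r).
  rewrite horner_poly LE (big_morph (lform xi2) (lformD xi2) (lform0 xi2)).
  by apply: eq_bigr => l _; rewrite lformZ mulrC.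
(* The composition of the parametrizations of the two maps: its degree n * n' is one
   since it represents the identity of the double line. *)
pose N i : {poly k} := \sum_(j < n'.+1) (pa ^+ (n' - j) * pb ^+ j) * (Ps j i 0)%:P.
pose Nc l : V := \col_i (N i)`_l.
have spa : (size pa <= n.+1)%N by apply: size_poly.
have spb : (size pb <= n.+1)%N by apply: size_poly.
have term (j : 'I_n'.+1) :
    (size (pa ^+ (n' - j) * pb ^+ j)%R <= (n * n').+1)%N /\
    (pa ^+ (n' - j) * pb ^+ j)`_(n * n') = pa`_n ^+ (n' - j) * pb`_n ^+ j.
  have jn : (j <= n')%N by rewrite -ltnS.
  have [s1 c1] := coef_exp_top (n' - j) spa; have [s2 c2] := coef_exp_top j spb.
  have -> : (n * n' = n * (n' - j) + n * j)%N by rewrite -mulnDr subnK.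
  split; last by rewrite coef_mul_top // c1 c2.
  apply: leq_trans (size_polyMleq _ _) _; have := leq_add s1 s2.
  by rewrite addSn addnS; case: (_ + _)%N => //= l; rewrite ltnS.
have NE r : \sum_(l < (n * n').+1) r ^+ l *: Nc l = binary_form n' Ps pa.[r] pb.[r].
  apply/matrixP => i j; rewrite !summxE (ord1 j).
  transitivity (N i).[r].
    have sN : (size (N i) <= (n * n').+1)%N.
      apply: leq_trans (size_sum _ _ _) _; apply/bigmax_leqP => l _.
      apply: leq_trans (size_polyMleq _ _) _; have [sz _] := term l.
      have := leq_add sz (size_polyC_leq1 (Ps l i 0)); rewrite addn1.
      by case: (_ + _)%N => //= q; rewrite ltnS.
    rewrite (horner_coef_wide r sN); apply: eq_bigr => l _.
    by rewrite !mxE mulrC.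
  rewrite horner_sum; apply: eq_bigr => l _.
  by rewrite !mxE !hornerM !horner_exp hornerC.
have nn' : (n * n')%N = 1%N.
  apply: (nonvanishing_line_degree (Phi := Nc) bW) => [r w|].
    have Ldec := dec _ (LW' r).
    have ab0 : (pa.[r] != 0) || (pb.[r] != 0).
      apply: contraTT (hL r).1; rewrite negb_or !negbK paE pbE => /andP[/eqP za /eqP zb].
      by rewrite Ldec za zb !scale0r addr0 eqxx.
    have [B0 hB] := hPs _ _ ab0; rewrite /w NE; split=> //.
    rewrite paE pbE -Ldec in hB *; have Lr := (hL r).1.
    have fL : T (L r) (L r) (L r) = 0 by apply: sL.
    have s1 := reg_neq0 Hs (nz1 r) (f1 r); have fs1 := reg_cubic Hs (nz1 r) (f1 r).
    have h2 := reg_collinear Hs' HT s1 Lr fs1 (hL r).2.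
    apply: collinear_trans (reg_neq0 Hs' Lr fL) hB _.
    exact: collinear_trans (reg_neq0 Hs' s1 fs1) h2 (ss' (nz1 r) (f1 r)).
  have Ndec := dec _ (PhW' n (ltnSn n)).
  have pan : pa`_n = lform xi1 (Ph n) by rewrite coef_poly ltnSn.
  have pbn : pb`_n = lform xi2 (Ph n) by rewrite coef_poly ltnSn.
  have ab0 : (pa`_n != 0) || (pb`_n != 0).
    apply: contraTT Phn; rewrite negb_or !negbK pan pbn => /andP[/eqP za /eqP zb].
    by rewrite Ndec za zb !scale0r addr0 eqxx.
  have [B0 _] := hPs _ _ ab0; suff -> : Nc (n * n')%N = binary_form n' Ps pa`_n pb`_n by [].
  apply/matrixP => i j; rewrite !mxE summxE coef_sum (ord1 j); apply: eq_bigr => l _.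
  by rewrite coefMC !mxE; have [_ ->] := term l.
have n1 : n = 1%N by move/eqP: nn'; rewrite muln_eq1 => /andP[/eqP].
have BE c r : binary_form n Ph c r = c *: Ph 0 + r *: Ph 1.
  by rewrite n1 /binary_form !big_ord_recl big_ord0 /= addr0 !expr1 !expr0 mulr1 mul1r.
exists (Ph 0%N), (Ph 1%N); split=> [c r z|c r|w w' v].
- have [cr|] := boolP ((c != 0) || (r != 0)); last first.
    by rewrite negb_or !negbK => /andP[/eqP-> /eqP->].
  by have [] := hPh c r cr; rewrite BE z eqxx.
- have [cr|] := boolP ((c != 0) || (r != 0)); first by rewrite -BE; have [] := hPh c r cr.
  rewrite negb_or !negbK => /andP[/eqP-> /eqP->].
  by rewrite !scale0r addr0; apply: collinear0.
have P0 : Ph 0%N \in W' by apply: PhW'.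
have P1 : Ph 1%N \in W' by apply: PhW'; rewrite n1.
have sub : (<[Ph 0%N]> + <[Ph 1%N]> <= W')%VS by rewrite subv_add -!memvE P0 P1.
by move=> /(subvP sub) h1 /(subvP sub); apply: sW'.
Qed.

End LineImage.

(** * Lines on which a regular map is linear *)
Section LinearOn.
Variables (k : closedFieldType).
Notation V := 'cV[k]_5.
Implicit Types (E F : {vspace V}) (a b p u v w x y z : V) (c r t : k) (n d : nat).
Variables (T : V -> V -> V -> k) (s : V -> V).
Hypotheses (HT : symmetric_trilinear T) (Hs : regular_map T s).

(** The nonvanishing of M v is part of the definition because the zero vector is
  collinear to everything. *)
Definition linear_on E : Prop :=
  exists M : 'M[k]_5, forall v, v \in E -> v != 0 ->
    M *m v != 0 /\ collinear (M *m v) (s v).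

Lemma linear_on_sub E F : (F <= E)%VS -> linear_on E -> linear_on F.
Proof. by move=> /subvP FE [M hM]; exists M => v /FE; apply: hM. Qed.

Lemma linear_on_pair a b a' b' :
  (forall c r, c *: a + r *: b = 0 -> c = 0 /\ r = 0) ->
  (forall c r, (c != 0) || (r != 0) -> c *: a' + r *: b' != 0 /\
    collinear (c *: a' + r *: b') (s (c *: a + r *: b))) ->
  linear_on (<[a]> + <[b]>)%VS.
Proof.
move=> free h; have [xi0 [xi1 [x0a x0b x1a x1b]]] := dual_pair (plane_basis_span free).
have Mv v : (a' *m xi0 + b' *m xi1) *m v = lform xi0 v *: a' + lform xi1 v *: b'.
  rewrite mulmxDl -!mulmxA; congr (_ + _); apply/matrixP => i j;
    by rewrite (ord1 j) !mxE big_ord1 mulrC.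
exists (a' *m xi0 + b' *m xi1) => v /mem_add_vector[_ /vlineP[c ->] [r ->]] v0.
rewrite Mv !(lformD, lformZ) x0a x0b x1a x1b !mulr0 !mulr1 addr0 add0r.
apply: h; apply: contraNT v0; rewrite negb_or !negbK => /andP[/eqP-> /eqP->].
by rewrite !scale0r addr0.
Qed.

(** If an automorphism is linear on one line of a family, it is linear on all of
  them: the degree of the image curve is constant. *)
Lemma linear_on_family (A B : k -> V) : polypath A -> polypath B ->
  (forall t c r, T (c *: A t + r *: B t) (c *: A t + r *: B t) (c *: A t + r *: B t) = 0) ->
  (forall c r, c *: A 0 + r *: B 0 = 0 -> c = 0 /\ r = 0) ->
  (forall c r, c *: A 1 + r *: B 1 = 0 -> c = 0 /\ r = 0) ->
  linear_on (<[A 0%R]> + <[B 0%R]>)%VS -> linear_on (<[A 1%R]> + <[B 1%R]>)%VS.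
Proof.
move=> pA pB fAB free0 free1 [M hM].
have nz t : (forall c r, c *: A t + r *: B t = 0 -> c = 0 /\ r = 0) ->
    forall c r, (c != 0) || (r != 0) -> c *: A t + r *: B t != 0.
  by move=> free c r; apply: contraTneq => /free[-> ->]; rewrite eqxx.
have nzA t : (forall c r, c *: A t + r *: B t = 0 -> c = 0 /\ r = 0) ->
    forall r, A t + r *: B t != 0.
  by move=> free r; have := nz t free 1 r; rewrite scale1r oner_neq0 => ->.
have nzB t : (forall c r, c *: A t + r *: B t = 0 -> c = 0 /\ r = 0) -> B t != 0.
  by move=> free; have := nz t free 0 1; rewrite scale1r scale0r add0r oner_neq0 orbT => ->.
have A00 : A 0 != 0 by have := nzA 0 free0 0; rewrite scale0r addr0.
have [n [Phi [_ h1 h2]]] := family_lift Hs pA pB fAB (ex_intro _ 0 A00).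
have Mfree c r : c *: (M *m A 0) + r *: (M *m B 0) = 0 -> c = 0 /\ r = 0.
  rewrite !scalemxAr -mulmxDr => z; apply: free0; apply/eqP.
  have inE : c *: A 0 + r *: B 0 \in (<[A 0%R]> + <[B 0%R]>)%VS.
    by rewrite memv_add ?memvZ ?memv_line.
  by apply: contraT => /(hM _ inE)[]; rewrite z eqxx.
have n1 : n = 1%N.
  apply: (nonvanishing_line_degree (Phi := Phi^~ 0) (plane_basis_span Mfree)).
    move=> r w; have nz0 := nzA 0 free0 r; have [w0 hw] := h1 0 r nz0; split=> //.
    have inE : A 0 + r *: B 0 \in (<[A 0%R]> + <[B 0%R]>)%VS.
      by rewrite memv_add ?memvZ ?memv_line.
    have [_] := hM _ inE nz0; rewrite mulmxDr -scalemxAr => hc.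
    have f0 := fAB 0 1 r; rewrite scale1r in f0.
    exact: collinear_trans (reg_neq0 Hs nz0 f0) hw (collinear_sym hc).
  by have [] := h2 0 (nzB 0 free0).
have hom := homogenize_lift (Phi := Phi^~ 1) HT Hs free1 (fAB 1) (fun r => h1 1 r (nzA 1 free1 r))
  (h2 1 (nzB 1 free1)).
apply: (linear_on_pair (a' := Phi 0%N 1) (b' := Phi 1%N 1) free1) => c r cr.
have := hom c r cr; rewrite n1 /binary_form !big_ord_recl big_ord0 /= addr0.
by rewrite !expr1 !expr0 mulr1 mul1r.
Qed.

End LinearOn.

(** A family of points given by polynomials extends over t = 0. *)
Lemma polypath_strip (k : closedFieldType) m (P : k -> 'cV[k]_m) :
  polypath P -> (exists t, P t != 0) ->
  exists i Q, [/\ polypath Q, Q 0 != 0 & forall t, P t = t ^+ i *: Q t].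
Proof.
move=> pP [t1 /cV_neq0[l Pl]]; have [p hp] := pP l.
have p0 : p != 0 by apply: contraNneq Pl => z; rewrite hp z horner0.
move: {Pl} P pP p hp p0 {2}(size p) (leqnn (size p)) => P pP p hp p0 N.
elim: N P pP p hp p0 => [|N IH] P pP p hp p0.
  by rewrite leqn0 size_poly_eq0 (negPf p0).
move=> sp; have [P0|P0] := eqVneq (P 0) 0; last first.
  by exists 0%N, P; split=> // t; rewrite expr0 scale1r.
have hq i : exists q : {poly k}, forall t, P t i 0 = t * q.[t].
  have [|h [q hq] ph] := polyfun_root (pP i) (t0 := 0); first by rewrite P0 mxE.
  by exists q => t; rewrite ph subr0 hq.
have [q qE] := fin_all_exists hq.
pose P' t : 'cV[k]_m := \col_i (q i).[t].
have pP' : polypath P' by move=> i; exists (q i) => t; rewrite mxE.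
have def_p : p = 'X * q l.
  by apply: poly_fun_inj => t; rewrite -hp qE hornerM hornerX.
have ql0 : q l != 0 by apply: contraNneq p0 => z; rewrite def_p z mulr0.
have [||i [Q [pQ Q0 hQ]]] := IH P' pP' (q l) _ ql0.
- by move=> t; rewrite mxE.
- by rewrite -ltnS (leq_trans _ sp) // def_p mulrC size_mulX.
exists i.+1, Q; split=> // t; rewrite exprS -scalerA -hQ.
by apply/matrixP => j j'; rewrite (ord1 j') !mxE qE.
Qed.

(** * Residual lines *)
Section ResidualLines.
Variables (k : closedFieldType) (char0 : [pchar k] =i pred0).
Notation V := 'cV[k]_5.
Implicit Types (E : {vspace V}) (a b p u v w x y z : V) (c r t : k) (n d : nat)
  (H : 'I_5 -> {mpoly k[5]}).
Variables (T : V -> V -> V -> k) (W : {vspace V}).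
Hypothesis HX : double_line_cubic T W.
Let HT := dl_tri HX.
Let TE := triE HT.
Let two0 : 2%:R != 0 :> k := natS_neq0 char0 1.
Let three0 : 3%:R != 0 :> k := natS_neq0 char0 2.
Variables (e0 e1 v0 w0 : V).
Hypotheses (bW : plane_basis W e0 e1) (D0 : disc (T e1) v0 w0 != 0).

Let e0W : e0 \in W := pb_mem1 bW.
Let e1W : e1 \in W := pb_mem2 bW.

Lemma plane_span : W = (<[e0]> + <[e1]>)%VS.
Proof.
apply/eqP; rewrite eqEsubv subv_add -!memvE e0W e1W !andbT.
by apply/subvP => w /(pb_span bW)[c [r ->]]; rewrite memv_add ?memvZ ?memv_line.
Qed.

(** Modulo W the quadratic form T e1 is the sum of a hyperbolic plane and a line. *)
Lemma full_decomposition : exists a b (c : V),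
  [/\ T e1 a a = 0, T e1 b b = 0, T e1 a b != 0, T e1 a c = 0 & T e1 b c = 0] /\
  [/\ a \notin W, b \notin (W + <[a]>)%VS & c \notin (W + <[a]> + <[b]>)%VS].
Proof.
have HB := tri_bilinear HT e1.
have [a [b [aa bb ab]]] := hyperbolic_pair two0 HB D0.
have aW : a \notin W by apply: contra ab => aW; rewrite (dl_sing HX).
have bW' : b \notin (W + <[a]>)%VS.
  apply: contra ab => /mem_add_vector[e eW [r ->]].
  by rewrite !TE aa mulr0 addr0 (tri23 HT) (dl_sing HX).
have [z zW] : exists z, z \notin (W + <[a]> + <[b]>)%VS.
  apply: NNPP => no; have : \dim (W + <[a]> + <[b]>) = 5%N.
    suff -> : (W + <[a]> + <[b]>)%VS = fullv by rewrite dimvf.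
    apply/eqP; rewrite eqEsubv subvf; apply/subvP => u _.
    by apply: contraT => uE; case: no; exists u.
  by rewrite !dim_add_vector ?(dl_dim HX).
have [c [ac bc [x0 [y0 ez]]]] := orthogonal_part HB z aa bb ab.
exists a, b, c; split; split=> //; apply: contra zW => cW; rewrite ez memvD //.
have aE : a \in (W + <[a]>)%VS by rewrite (subvP (addvSr _ _)) ?memv_line.
have bE : b \in (W + <[a]> + <[b]>)%VS by rewrite (subvP (addvSr _ _)) ?memv_line.
by rewrite memvD ?memvZ // (subvP (addvSl _ _)).
Qed.

(** Two conics meet: restrict the second one to a parametrization of the first. *)
Lemma base_point : exists y, [/\ y \notin W, T e0 y y = 0 & T e1 y y = 0].
Proof.
have [a [b [c [[aa bb ab ac bc] [aW bW' cW]]]]] := full_decomposition.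
have [q0a|q0a] := eqVneq (T e0 a a) 0; first by exists a.
pose be := - T e1 c c / (2%:R * T e1 a b).
pose y r := be *: b + r *: c + r ^+ 2 *: a.
have q r : T e1 (y r) (y r) = 0.
  rewrite /y !TE aa bb ac bc (tri23 HT e1 c b) bc (tri23 HT e1 c a) ac (tri23 HT e1 b a).
  rewrite /be; field; exact/andP.
have yW r : (be != 0) || (r != 0) -> y r \notin W.
  move=> br; have [r0|r0] := eqVneq r 0.
    rewrite /y r0 expr0n !scale0r !addr0; move: br; rewrite r0 eqxx orbF => b0.
    apply: contra bW' => h; rewrite -[b]scale1r -(mulVf b0) -scalerA.
    by rewrite memvZ // (subvP (addvSl _ _)).
  apply: contra ab => h; have : T e1 (y r) b = 0.
    by apply: (dl_sing HX).
  rewrite /y !TE bb (tri23 HT e1 c) bc !mulr0 !add0r.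
  by move/(mulf_cancel0 (expf_neq0 2 r0)) ->.
have [cc|cc] := eqVneq be 0.
  (* The first conic contains the line through a and c. *)
  pose p := (T e0 c c)%:P + (2%:R * T e0 a c) *: 'X + (T e0 a a) *: 'X^2.
  have pE r : p.[r] = T e0 (c + r *: a) (c + r *: a).
    rewrite /p !TE !(hornerD, hornerZ, hornerC, hornerX, hornerXn).
    by rewrite (tri23 HT e0 c a); ring.
  have sp : size p != 1%N.
    rewrite /p addrC size_polyDl size_scale ?size_polyXn //.
    apply: leq_ltn_trans (size_polyD _ _) _; rewrite gtn_max.
    rewrite (leq_ltn_trans (size_polyC_leq1 _)) //.
    by rewrite (leq_ltn_trans (size_scale_leq _ _)) // size_polyX.
  have [r /rootP] := closed_rootP p sp; rewrite pE => hr.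
  exists (c + r *: a); split=> //.
    apply: contra cW => h; rewrite -[c](addrK (r *: a)).
    apply: (subvP (addvSl _ _)); apply: memvB; first exact: (subvP (addvSl _ _)).
    by rewrite memvZ // (subvP (addvSr _ _)) ?memv_line.
  have cc1 : T e1 c c = 0.
    move/eqP: cc; rewrite /be mulf_eq0 invr_eq0 mulf_eq0 (negPf two0) (negPf ab).
    by rewrite !orbF oppr_eq0 => /eqP.
  by rewrite !TE aa cc1 ac (tri23 HT e1 c) ac !(mulr0, addr0).
pose p := (be ^+ 2 * T e0 b b)%:P + (2%:R * be * T e0 b c) *: 'X +
  (T e0 c c + 2%:R * be * T e0 a b) *: 'X^2 + (2%:R * T e0 a c) *: 'X^3 +
  (T e0 a a) *: 'X^4.
have pE r : p.[r] = T e0 (y r) (y r).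
  rewrite /p /y !TE !(hornerD, hornerZ, hornerC, hornerX, hornerXn).
  rewrite (tri23 HT e0 c a) (tri23 HT e0 c b) (tri23 HT e0 b a); ring.
have sp : size p != 1%N.
  rewrite /p addrC size_polyDl size_scale ?size_polyXn //.
  apply: leq_ltn_trans (_ : 4 < 5)%N => //; apply/leq_sizeP => j hj.
  rewrite !(coefD, coefZ, coefC, coefX, coefXn).
  by case: j hj => [|[|[|[|j]]]] // _; rewrite /= !mulr0 !addr0.
have [r /rootP] := closed_rootP p sp; rewrite pE => hr.
by exists (y r); split=> //; apply: yW; rewrite cc.
Qed.

Variable (s : V -> V).
Hypotheses (Hs : regular_map T s) (LW : linear_on s W).

(** The plane spanned by the double line and z is contained in X, and any line of it
  is connected to the double line by a pencil of lines. *)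
Lemma linear_on_plane z a b : z \notin W -> (forall w, w \in W -> T w z z = 0) ->
  T z z z = 0 -> a \in (W + <[z]>)%VS -> b \in (W + <[z]>)%VS ->
  (forall c r, c *: a + r *: b = 0 -> c = 0 /\ r = 0) ->
  linear_on s (<[a]> + <[b]>)%VS.
Proof.
move=> zW qz fz aE bE free.
have fE v : v \in (W + <[z]>)%VS -> T v v v = 0.
  move=> /mem_add_vector[e eW [r ->]]; rewrite (sing_cube HX) // !TE qz // fz.
  by rewrite !mulr0 addr0.
have WE := subvP (addvSl W <[z]>).
pose A t := e0 + t *: (a - e0); pose B t := e1 + t *: (b - e1).
have A0 : A 0 = e0 by rewrite /A scale0r addr0.
have B0 : B 0 = e1 by rewrite /B scale0r addr0.
have A1 : A 1 = a by rewrite /A scale1r addrC subrK.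
have B1 : B 1 = b by rewrite /B scale1r addrC subrK.
rewrite -A1 -B1; apply: (linear_on_family HT Hs (A := A) (B := B)).
- exact: polypath_line.
- exact: polypath_line.
- move=> t c r; apply: fE; have e0E := WE _ e0W; have e1E := WE _ e1W.
  by rewrite memvD ?memvZ // memvD ?memvZ ?memvB.
- by rewrite A0 B0; apply: (pb_free bW).
- by rewrite A1 B1.
by rewrite A0 B0 -plane_span.
Qed.

(** The residual line of X in the plane spanned by the double line and u. *)
Definition residual_point u : V := T e1 u u *: e0 - T e0 u u *: e1.
Definition residual_direction u : V := u - (T u u u / (3%:R * T e1 u u)) *: e1.

(** An automorphism is linear on the residual lines: deform the plane of such a
  line to the plane over a common zero of the two conics. There the residual
  line is the double line itself or a line in a plane contained in X. *)
Lemma linear_on_residual u : T e1 u u != 0 ->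
  linear_on s (<[residual_point u]> + <[residual_direction u]>)%VS.
Proof.
move=> q1; have [ys [ysW q0ys q1ys]] := base_point.
pose y t := ys + t *: (u - ys).
have py : polypath y by apply: polypath_line.
have y0 : y 0 = ys by rewrite /y scale0r addr0.
have y1 : y 1 = u by rewrite /y scale1r addrC subrK.
clearbody y.
(* The coefficients of the equation of the residual line in the plane of y t. They
   may vanish at t = 0, but after division by a power of t they have a limit Q 0. *)
pose al t : 'cV[k]_3 := \col_i nth 0 [:: 3%:R * T e0 (y t) (y t);
  3%:R * T e1 (y t) (y t); T (y t) (y t) (y t)] i.
have pal : polypath al.
  have pT a : polyfun (fun t => 3%:R * T a (y t) (y t)).
    by apply: polyfunM (polyfunC _) (polyfun_tri HT (polypathC _) py py).
  move=> [[|[|[|j]]] hj] //.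
  - by apply: polyfun_eq (pT e0) => t; rewrite mxE.
  - by apply: polyfun_eq (pT e1) => t; rewrite mxE.
  by apply: polyfun_eq (polyfun_tri HT py py py) => t; rewrite mxE.
have [|i [Q [pQ Q0 alE]]] := polypath_strip pal.
  exists 1; apply/eqP => /(congr1 (fun M : 'cV_3 => M 1 0)); rewrite !mxE /= y1.
  by move/eqP; rewrite mulf_eq0 (negPf three0) (negPf q1).
pose a0 t := Q t 0 0; pose a1 t := Q t 1 0; pose a2 t := Q t 2%:R 0.
have E0 t : 3%:R * T e0 (y t) (y t) = t ^+ i * a0 t.
  by have := congr1 (fun M : 'cV_3 => M 0 0) (alE t); rewrite !mxE.
have E1 t : 3%:R * T e1 (y t) (y t) = t ^+ i * a1 t.
  by have := congr1 (fun M : 'cV_3 => M 1 0) (alE t); rewrite !mxE.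
have E2 t : T (y t) (y t) (y t) = t ^+ i * a2 t.
  by have := congr1 (fun M : 'cV_3 => M 2%:R 0) (alE t); rewrite !mxE.
have Q1 : Q 1 != 0.
  apply: contraNneq q1 => z; have := E1 1; rewrite /a1 z mxE mulr0 y1.
  by move/(mulf_cancel0 three0) => ->.
have gen t : Q t != 0 -> generically (fun ta => a0 t + ta * a1 t + ta ^+ 2 * a2 t != 0).
  move=> Qt; apply: polyfun_generic.
    apply: polyfunD; last exact: polyfunM (polyfun_exp _ (polyfunX _)) (polyfunC _).
    exact: polyfunD (polyfunC _) (polyfunM (polyfunX _) (polyfunC _)).
  apply: NNPP => no; case/eqP: Qt.
  have [z0 z1 z2 _ _] : [/\ a0 t = 0, a1 t = 0, a2 t = 0, 0 = 0 :> k & 0 = 0 :> k].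
    apply: quartic_eq0 => r; apply/eqP/negPn/negP => h; apply: no; exists r.
    by apply: contraNneq h => z; apply/eqP; rewrite -[RHS]z; ring.
  apply/matrixP => j j'; rewrite (ord1 j') mxE.
  case: j => [[|[|[|j]]] hj] //.
  - by rewrite -[RHS]z0 /a0; congr (Q t _ _); apply/val_inj.
  - by rewrite -[RHS]z1 /a1; congr (Q t _ _); apply/val_inj.
  by rewrite -[RHS]z2 /a2; congr (Q t _ _); apply/val_inj.
(* The vectors A t and B t are the cross products of Q t with (- ta, 1, 0) and
   (- ta^2, 0, 1). They span the residual line as long as Q t is not orthogonal to
   (1, ta, ta^2), which is required at t = 0 and t = 1 only. *)
have [ta [D00 D10]] := generically_ex (generically_and (gen 0 Q0) (gen 1 Q1)).
pose A t := (- a2 t) *: e0 + (- (ta * a2 t)) *: e1 + (a0 t + ta * a1 t) *: y t.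
pose B t := a1 t *: e0 + (- (ta ^+ 2 * a2 t + a0 t)) *: e1 + (ta ^+ 2 * a1 t) *: y t.
have combo t c r : c *: A t + r *: B t = (- c * a2 t + r * a1 t) *: e0 +
    (- c * ta * a2 t - r * (ta ^+ 2 * a2 t + a0 t)) *: e1 +
    (c * (a0 t + ta * a1 t) + r * ta ^+ 2 * a1 t) *: y t.
  by apply/matrixP => j j'; rewrite !mxE; ring.
have fX0 (x0 x1 r t : k) : a0 t * x0 + a1 t * x1 + a2 t * r = 0 ->
    T (x0 *: e0 + x1 *: e1 + r *: y t) (x0 *: e0 + x1 *: e1 + r *: y t)
      (x0 *: e0 + x1 *: e1 + r *: y t) = 0.
  move=> h; rewrite (sing_cube HX) ?memvD ?memvZ // !TE E2.
  rewrite -[RHS](mulr0 (r ^+ 2 * t ^+ i)) -h !mulrDr mulrACA.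
  have e0t : r * (r * T e0 (y t) (y t)) * 3%:R = r ^+ 2 * (t ^+ i * a0 t).
    by rewrite -E0; ring.
  have e1t : r * (r * T e1 (y t) (y t)) * 3%:R = r ^+ 2 * (t ^+ i * a1 t).
    by rewrite -E1; ring.
  transitivity (x0 * (r * (r * T e0 (y t) (y t)) * 3%:R) +
     x1 * (r * (r * T e1 (y t) (y t)) * 3%:R) + r * (r * (r * (t ^+ i * a2 t)))).
    by ring.
  by rewrite e0t e1t; ring.
have free t : y t \notin W -> a0 t + ta * a1 t + ta ^+ 2 * a2 t != 0 ->
    forall c r, c *: A t + r *: B t = 0 -> c = 0 /\ r = 0.
  move=> yW Dt c r; rewrite combo => z.
  have R0 : c * (a0 t + ta * a1 t) + r * ta ^+ 2 * a1 t = 0.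
    apply/eqP; apply: contraR yW => Rn.
    rewrite -[y t]scale1r -(mulVf Rn) -scalerA memvZ //.
    move/eqP: z; rewrite addrC addr_eq0 => /eqP ->.
    by rewrite memvN memvD ?memvZ.
  move: z; rewrite R0 scale0r addr0 => /(pb_free bW)[X0 X1].
  split; apply: (mulf_cancel0 Dt).
    by apply: (lin_comb2 R0 X0 (x := 1) (y := - ta ^+ 2)); ring.
  by apply: (lin_comb2 X0 X1 (x := ta) (y := - 1)); ring.
have pa0 : polyfun a0 by apply: pQ.
have pa1 : polyfun a1 by apply: pQ.
have pa2 : polyfun a2 by apply: pQ.
have pA : polypath A.
  apply: polypathD; first apply: polypathD.
  - by apply: polypathZ (polypathC _); apply: polyfunN.
  - by apply: polypathZ (polypathC _); apply/polyfunN/polyfunM => //; apply: polyfunC.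
  by apply: polypathZ py; apply: polyfunD => //; apply: polyfunM => //; apply: polyfunC.
have pB : polypath B.
  apply: polypathD; first apply: polypathD.
  - exact: polypathZ (polypathC _).
  - apply: polypathZ (polypathC _); apply: polyfunN; apply: polyfunD => //.
    by apply: polyfunM => //; apply: polyfunC.
  by apply: polypathZ py; apply: polyfunM => //; apply: polyfunC.
have uW : y 1 \notin W.
  by rewrite y1; apply: contra q1 => uW; rewrite (dl_sing HX).
have y0W : y 0 \notin W by rewrite y0.
have L0 : linear_on s (<[A 0%R]> + <[B 0%R]>)%VS.
  have free0 := free 0 y0W D00.
  have [fys|fys] := eqVneq (T ys ys ys) 0.
    have inE (x0 x1 r : k) : x0 *: e0 + x1 *: e1 + r *: y 0 \in (W + <[ys]>)%VS.
      by rewrite y0 memv_add ?memvZ ?memv_line // memvD ?memvZ.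
    apply: (linear_on_plane ysW) => //; try exact: inE.
    by move=> w /(pb_span bW)[c [r ->]]; rewrite !TE q0ys q1ys !mulr0 addr0.
  have i0 : i = 0%N.
    have := E2 0; rewrite y0; case: (i) => // j; rewrite expr0n mul0r => /eqP.
    by rewrite (negPf fys).
  have a00 : a0 0 = 0 by have := E0 0; rewrite i0 y0 q0ys mulr0 expr0 mul1r.
  have a10 : a1 0 = 0 by have := E1 0; rewrite i0 y0 q1ys mulr0 expr0 mul1r.
  apply: linear_on_sub LW; rewrite subv_add -!memvE /A /B a00 a10.
  by rewrite !mulr0 !addr0 !scale0r !addr0 !memvD ?memvZ ?mem0v.
have fAB t c r : T (c *: A t + r *: B t) (c *: A t + r *: B t) (c *: A t + r *: B t) = 0.
  by rewrite combo; apply: fX0; ring.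
have L1 := linear_on_family HT Hs pA pB fAB (free 0 y0W D00) (free 1 uW D10) L0.
have inAB (x0 x1 r : k) : a0 1 * x0 + a1 1 * x1 + a2 1 * r = 0 ->
    x0 *: e0 + x1 *: e1 + r *: u \in (<[A 1%R]> + <[B 1%R]>)%VS.
  move=> h; set D := a0 1 + _ + _ in D10.
  have -> : x0 *: e0 + x1 *: e1 + r *: u = (D^-1 * (r - x0 * ta ^+ 2)) *: A 1 +
      (D^-1 * (x0 * ta - x1)) *: B 1.
    apply: (scalerI D10); rewrite [RHS]scalerDr !scalerA !mulrA divff // !mul1r.
    rewrite combo y1 2!scalerDr !scalerA; congr (_ *: _ + _ *: _ + _ *: _);
      apply/eqP; rewrite -subr_eq0; apply/eqP; rewrite /D.
    - by rewrite -[RHS](mulr0 1) -h; ring.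
    - by rewrite -[RHS](mulr0 ta) -h; ring.
    by rewrite -[RHS](mulr0 (ta ^+ 2)) -h; ring.
  by rewrite memv_add ?memvZ ?memv_line.
apply: linear_on_sub L1; rewrite subv_add -!memvE.
have Ea0 : a0 1 = 3%:R * T e0 u u by have := E0 1; rewrite expr1n mul1r y1.
have Ea1 : a1 1 = 3%:R * T e1 u u by have := E1 1; rewrite expr1n mul1r y1.
have Ea2 : a2 1 = T u u u by have := E2 1; rewrite expr1n mul1r y1.
apply/andP; split.
  have := inAB (T e1 u u) (- T e0 u u) 0; rewrite scale0r addr0 scaleNr.
  by apply; rewrite Ea0 Ea1; ring.
have -> : residual_direction u =
    0 *: e0 + (- (T u u u / (3%:R * T e1 u u))) *: e1 + 1 *: u.
  by rewrite scale0r add0r scale1r scaleNr addrC.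
by apply: inAB; rewrite Ea1 Ea2; field; apply/andP.
Qed.

End ResidualLines.

(** * Reconstruction of the linear map *)

Lemma form_on_line (k : closedFieldType) n (F : {mpoly k[n.+1]}) d (a b : 'cV[k]_n.+1) :
  F \is d.-homog -> exists p : {poly k},
    [/\ (size p <= d.+1)%N, p`_d = peval F b & forall r, peval F (a + r *: b) = p.[r]].
Proof.
move=> hF; pose p := line_poly (@idfun k) (fun i => a i 0) (fun i => b i 0) F.
have [sz top] := line_poly_homog (@idfun k) (fun i => a i 0) (fun i => b i 0) hF.
have eqm (h1 h2 : 'I_n.+1 -> k) (f1 : k -> k) : f1 =1 idfun -> h1 =1 h2 ->
    mmap f1 h1 F = mmap idfun h2 F.
  move=> hf hh; rewrite /mmap; apply: eq_bigr => m _; rewrite hf; congr (_ * _).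
  by rewrite /mmap1; apply: eq_bigr => l _; rewrite hh.
exists p; split=> // r; rewrite -[p.[r]]/(horner_eval r p) /p /line_poly rmorph_mmap.
apply/esym/eqm => [x|l]; rewrite /= /horner_eval ?hornerC //.
by rewrite hornerD hornerC hornerZ hornerX !mxE mulrC.
Qed.

(** A rational function that is regular everywhere is a polynomial: the reduced
  denominator has no zero. *)
Lemma regular_quotient (k : closedFieldType) (p q : {poly k}) : q != 0 ->
  (forall r, exists p' q', q'.[r] != 0 /\ p * q' = p' * q) -> q %| p.
Proof.
move=> q0 reg; pose g := gcdp p q.
have g0 : g != 0 by rewrite gcdp_eq0 negb_and q0 orbT.
have def_q : q = q %/ g * g by rewrite divpK ?dvdp_gcdr.
have def_p : p = p %/ g * g by rewrite divpK ?dvdp_gcdl.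
have cop : coprimep (p %/ g) (q %/ g) by apply: coprimep_div_gcd; rewrite q0 orbT.
suff s1 : size (q %/ g) == 1%N.
  have /size_poly1P[c c0 hc] := s1.
  by rewrite def_q hc mul_polyC dvdpZl // def_p dvdp_mull.
apply: contraT => /closed_rootP[r rr]; have [p' [q' [q'r e]]] := reg r.
have : q %/ g %| p %/ g * q'.
  apply/dvdpP; exists p'; apply: (mulIf g0).
  by rewrite mulrAC -def_p -mulrA -def_q.
rewrite Gauss_dvdpr; last by rewrite coprimep_sym.
by rewrite -(dvdp_XsubCl) in rr; move=> /(dvdp_trans rr); rewrite dvdp_XsubCl => /rootP/eqP;
  rewrite (negPf q'r).
Qed.

Lemma pathjet_mulmx (k : closedFieldType) n m (M : 'M[k]_(m, n)) (P : k -> 'cV[k]_n)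
    (p w : 'cV[k]_n) :
  pathjet P p w -> pathjet (fun t => M *m P t) (M *m p) (M *m w).
Proof.
move=> hP i; rewrite !mxE.
apply: (@jet_eq _ (fun t => \sum_j M i j * P t j 0)) => [t|]; first by rewrite mxE.
elim: (index_enum _) => [|j r IH].
  by rewrite !big_nil; apply: jet_eq (jetC 0) => t; rewrite big_nil.
rewrite !big_cons; have := jetD (jetM (jetC (M i j)) (hP j)) IH.
by rewrite mul0r addr0; apply: jet_eq => t; rewrite big_cons.
Qed.

Section Reconstruction.
Variables (k : closedFieldType) (char0 : [pchar k] =i pred0).
Notation V := 'cV[k]_5.
Implicit Types (E : {vspace V}) (a b p u v w x y z : V) (c r t : k) (n d : nat)
  (H : 'I_5 -> {mpoly k[5]}).
Variables (T : V -> V -> V -> k) (W : {vspace V}).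
Hypothesis HX : double_line_cubic T W.
Let HT := dl_tri HX.
Variables (e0 e1 v0 w0 : V).
Hypotheses (bW : plane_basis W e0 e1) (D0 : disc (T e1) v0 w0 != 0).
Variables (s s' : V -> V).
Hypotheses (Hs : regular_map T s) (Hs' : regular_map T s').
Hypothesis ss' : forall v, v != 0 -> T v v v = 0 -> collinear (s' (s v)) v.
Variables (l0 l1 : V).
Hypotheses (lfree : forall c r, c *: l0 + r *: l1 = 0 -> c = 0 /\ r = 0)
  (lcol : forall c r, collinear (c *: l0 + r *: l1) (s (c *: e0 + r *: e1))).

Let e0W : e0 \in W := pb_mem1 bW.
Let e1W : e1 \in W := pb_mem2 bW.

Section Projection.
Variables (eta0 eta1 : 'rV[k]_5).
Hypotheses (eta00 : lform eta0 l0 = 1) (eta01 : lform eta0 l1 = 0)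
  (eta10 : lform eta1 l0 = 0) (eta11 : lform eta1 l1 = 1).

(** The projection of the space that kills the span of l0 and l1. *)
Let Pi : 'M[k]_5 := 1%:M - l0 *m eta0 - l1 *m eta1.

Let PiE v : Pi *m v = v - lform eta0 v *: l0 - lform eta1 v *: l1.
Proof.
rewrite /Pi !mulmxBl mul1mx -!mulmxA; congr (_ - _ - _); apply/matrixP => i j;
  by rewrite (ord1 j) !mxE big_ord1 mulrC.
Qed.

Let Pi_l c r : Pi *m (c *: l0 + r *: l1) = 0.
Proof.
rewrite PiE !(lformD, lformZ) eta00 eta01 eta10 eta11 !mulr0 !mulr1 addr0 add0r.
by rewrite [c *: l0 + _]addrC addrK subrr.
Qed.

Let Pi_eq0 v : Pi *m v = 0 -> v = lform eta0 v *: l0 + lform eta1 v *: l1.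
Proof. by rewrite PiE -addrA -opprD => /eqP; rewrite subr_eq0 => /eqP. Qed.

Let Pi_idem v : Pi *m (Pi *m v) = Pi *m v.
Proof.
rewrite [in LHS](PiE v) -addrA -opprD mulmxBr Pi_l subr0.
by [].
Qed.

Let pt r := e0 + r *: e1.
Let lt r := l0 + r *: l1.

Let pt_neq0 r : pt r != 0.
Proof.
apply/eqP => z; have := pb_free bW (c := 1) (d := r); rewrite scale1r => /(_ z)[/eqP].
by rewrite oner_eq0.
Qed.

Let lt_neq0 r : lt r != 0.
Proof.
by apply/eqP => z; have := lfree (c := 1) (r := r); rewrite scale1r => /(_ z)[/eqP];
  rewrite oner_eq0.
Qed.

Let ptW r : pt r \in W.
Proof. by have := pb_mem bW 1 r; rewrite scale1r. Qed.

Let fpt r : T (pt r) (pt r) (pt r) = 0.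
Proof. exact: (dl_sing HX). Qed.

Let lt_col r : collinear (lt r) (s (pt r)).
Proof. by have := lcol 1 r; rewrite !scale1r. Qed.

(** Along the double line a lift is rho times the parametrization of the image
  line, and its normal derivative is a polynomial vector of no larger degree. *)
Let data d H (rho : {poly k}) (g : V -> 'I_5 -> {poly k}) : Prop :=
  [/\ forall r, forms_eval H (pt r) = rho.[r] *: lt r,
      forall r y i, (Pi *m (jacobian H (pt r) *m y)) i 0 = (g y i).[r],
      (size rho <= d)%N /\ forall y i, rho != 0 -> (size (g y i) <= d)%N
    & forms_eval H e1 != 0 -> size rho = d].

Let data_exists d H : local_lift T s d H -> exists rho g, data d H rho g.
Proof.
move=> hH; have hom := lift_homog hH.
have [p hp] := fin_all_exists (fun i => form_on_line e0 e1 (hom i)).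
have hder i j := mderiv_homog j (hom i).
have [dp hdp] := fin_all_exists (fun ij : 'I_5 * 'I_5 => form_on_line e0 e1 (hder ij.1 ij.2)).
pose rho := \sum_i eta0 0 i *: p i.
pose q := \sum_i eta1 0 i *: p i.
pose jp y i := \sum_j y j 0 *: dp (i, j).
pose g y i := \sum_l Pi i l *: jp y l.
have col r : collinear (forms_eval H (pt r)) (lt r).
  apply: collinear_trans (reg_neq0 Hs (pt_neq0 r) (fpt r)) _ _.
    exact: lift_collinear hH _ (pt_neq0 r) (fpt r).
  exact/collinear_sym/lt_col.
have sumE (xi : 'rV_5) r : (\sum_i xi 0 i *: p i).[r] = lform xi (forms_eval H (pt r)).
  rewrite horner_sum /lform mxE; apply: eq_bigr => i _.
  by rewrite hornerZ !mxE; have [_ _ ->] := hp i.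
have Hrho r : forms_eval H (pt r) = rho.[r] *: lt r.
  have [x ex] := collinearP (lt_neq0 r) (col r).
  rewrite /rho sumE ex lformZ lformD lformZ eta00 eta01 mulr0 addr0 mulr1.
  by [].
have qrho : q = 'X * rho.
  apply: poly_fun_inj => r; rewrite hornerM hornerX /q sumE Hrho.
  by rewrite lformZ lformD lformZ eta10 eta11 add0r mulr1 mulrC.
have sq : (size q <= d.+1)%N.
  apply: leq_trans (size_sum _ _ _) _; apply/bigmax_leqP => i _.
  by apply: leq_trans (size_scale_leq _ _) _; have [] := hp i.
have srho : (size rho <= d)%N.
  have [->|r0] := eqVneq rho 0; first by rewrite size_poly0.
  by move: sq; rewrite qrho mulrC size_mulX.
exists rho, g; split=> //.
- move=> r y i; rewrite mxE horner_sum; apply: eq_bigr => l _.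
  rewrite hornerZ horner_sum; congr (_ * _); rewrite mxE; apply: eq_bigr => j _.
  by rewrite hornerZ mxE mulrC; have [_ _ ->] := hdp (l, j).
- split=> // y i r0; have d0 : (0 < d)%N.
    by apply: leq_trans srho; rewrite size_poly_gt0.
  apply: leq_trans (size_sum _ _ _) _; apply/bigmax_leqP => l _.
  apply: leq_trans (size_scale_leq _ _) _.
  apply: leq_trans (size_sum _ _ _) _; apply/bigmax_leqP => j _.
  apply: leq_trans (size_scale_leq _ _) _.
  by have [sz _ _] := hdp (l, j); rewrite prednK in sz.
move=> He1; apply/eqP; rewrite eqn_leq srho /=.
have qd : q`_d != 0.
  rewrite coef_sum; have -> : \sum_i (eta1 0 i *: p i)`_d = lform eta1 (forms_eval H e1).
    rewrite /lform mxE; apply: eq_bigr => i _.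
    by rewrite coefZ !mxE; have [_ ->] := hp i.
  have e10 : e1 != 0.
    by apply: contraNneq D0 => ->; rewrite /disc !(tri01 HT) mul0r expr0n subrr.
  have fe1 : T e1 e1 e1 = 0 by apply: (dl_sing HX).
  have l10 : l1 != 0.
    by apply/eqP => z; move: eta11; rewrite z lform0 => /eqP; rewrite eq_sym oner_eq0.
  have c1 : collinear (forms_eval H e1) l1.
    apply: collinear_trans (reg_neq0 Hs e10 fe1) (lift_collinear hH e10 fe1) _.
    by have := lcol 0 1; rewrite !scale0r !scale1r !add0r; apply: collinear_sym.
  have [x x0 ->] := collinearP_neq0 l10 He1 c1.
  by rewrite lformZ eta11 mulr1.
move: qd; rewrite qrho coefXM; case: (d) => [|d']; first by rewrite eqxx.
by rewrite /= => h; rewrite ltnNge; apply: contra h => /leq_sizeP->.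
Qed.

(** The normal derivatives of two lifts are in the ratio of the two factors. *)
Let data_ratio d1 H1 rho1 g1 d2 H2 rho2 g2 :
  local_lift T s d1 H1 -> local_lift T s d2 H2 -> data d1 H1 rho1 g1 -> data d2 H2 rho2 g2 ->
  forall y i, rho2 * g1 y i = rho1 * g2 y i.
Proof.
move=> hH1 hH2 [E1 G1 _ _] [E2 G2 _ _] y i; apply: poly_fun_inj => r.
move: r; apply: polyfun_ext; try exact: polyfun_horner.
apply: generically_imp (generic_rank2 HX e0 D0) => r Dr.
apply/eqP; rewrite !hornerM -G1 -G2 -subr_eq0; apply/eqP.
move: y; apply: (tangent_linear char0 HX (ptW r) Dr) => [x y|c x|u tu].
- by rewrite !mulmxDr ![(_ + _ : 'cV_5) i 0]mxE; ring.
- by rewrite -!scalemxAr ![(_ *: _ : 'cV_5) i 0]mxE; ring.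
have [P [pP fP] jP] := tu.
have j1 := pathjet_forms H1 jP; have j2 := pathjet_forms H2 jP.
rewrite E1 in j1; rewrite E2 in j2.
have col t : collinear (forms_eval H1 (P t)) (forms_eval H2 (P t)).
  move: t; apply: collinear_paths; try exact: polypath_forms.
  have P0 : P 0 != 0 by rewrite (pathjet0 jP) pt_neq0.
  apply: generically_imp (polypath_neq0 pP (ex_intro _ 0 P0)) => t Pt.
  apply: collinear_trans (reg_neq0 Hs Pt (fP t)) (lift_collinear hH1 Pt (fP t)) _.
  exact/collinear_sym/(lift_collinear hH2).
have := pathjet_collinear_scaled j1 j2 col => /(collinearP (lt_neq0 r))[x ex].
have /(congr1 (fun M : V => M i 0)) : Pi *m (rho1.[r] *: (jacobian H2 (pt r) *m u) -
    rho2.[r] *: (jacobian H1 (pt r) *m u)) = 0.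
  rewrite ex -scalemxAr; have := Pi_l 1 r; rewrite scale1r => ->.
  by rewrite scaler0.
rewrite mulmxBr -!scalemxAr; move: (Pi *m _) (Pi *m _) => A B; rewrite !mxE => h.
by rewrite -[LHS]opprK opprB h oppr0.
Qed.

Let data_neq0 d H rho g r : data d H rho g -> forms_eval H (pt r) != 0 -> rho.[r] != 0.
Proof. by case=> E _ _ _; rewrite E; apply: contraNneq => ->; rewrite scale0r. Qed.

(** The normal derivative does not depend on the point of the double line: as a
  function on the line it is regular of degree zero. *)
Lemma normal_derivative : exists Theta : 'M[k]_5,
  [/\ forall v, Pi *m (Theta *m v) = Theta *m v,
      forall w, w \in W -> Theta *m w = 0,
      forall u, Theta *m u = 0 -> u \in W &
      forall d H r, local_lift T s d H -> exists2 rho,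
        forms_eval H (pt r) = rho *: lt r &
        forall y, Pi *m (jacobian H (pt r) *m y) = rho *: (Theta *m y)].
Proof.
have e10 : e1 != 0.
  apply: contraNneq D0 => ->; by rewrite /disc !(tri01 HT) mul0r expr0n subrr.
have fe1 : T e1 e1 e1 = 0 by apply: (dl_sing HX).
have [d1 [H1 [hH1 H1e]]] := lift_exists Hs e10 fe1.
have [rho1 [g1 D1]] := data_exists hH1.
have [E1 G1 [s1 sg1] top1] := D1.
have rho10 : rho1 != 0.
  apply: contraNneq H1e => z.
  have Hz r : forms_eval H1 (pt r) = 0 by rewrite E1 z horner0 scale0r.
  have hom := lift_homog hH1.
  apply/eqP/matrixP => i j; rewrite (ord1 j) !mxE.
  have [p [_ top hp]] := form_on_line e0 e1 (hom i).
  rewrite -top; have -> : p = 0; last by rewrite coef0.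
  apply: poly_fun_eq0 => r; rewrite -hp.
  by have := congr1 (fun M : V => M i 0) (Hz r); rewrite !mxE.
have sz1 := top1 H1e.
have [r1 rr1] := poly_nonroot rho10.
pose Theta := rho1.[r1]^-1 *: (Pi *m jacobian H1 (pt r1)).
have ThE v : Theta *m v = rho1.[r1]^-1 *: (Pi *m (jacobian H1 (pt r1) *m v)).
  by rewrite -scalemxAl mulmxA.
(* At each point of the line the ratio of g1 to rho1 is the ratio for a lift defined
   there, so it is regular; by the degrees it is constant. *)
have g1E y i : g1 y i = (Theta *m y) i 0 *: rho1.
  have /dvdpP[q hq] : rho1 %| g1 y i.
    apply: regular_quotient => // r.
    have [d [H [hH Hr]]] := lift_exists Hs (pt_neq0 r) (fpt r).
    have [rho [g D]] := data_exists hH.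
    exists (g y i), rho; split; first exact: data_neq0 D Hr.
    by rewrite mulrC (data_ratio hH1 hH D1 D) mulrC.
  have sq : (size q <= 1)%N.
    have [->|q0] := eqVneq q 0; first by rewrite size_poly0.
    have := sg1 y i rho10; rewrite hq size_mul // sz1.
    have := size_poly_gt0 q; rewrite q0; case: (size q) => // a _.
    by rewrite addSn /= -{2}[d1]add0n leq_add2r leqn0 => /eqP->.
  have hc := size1_polyC sq; rewrite hc in hq.
  suff -> : (Theta *m y) i 0 = q`_0 by rewrite hq mul_polyC.
  rewrite ThE mxE G1 hq hornerM hornerC mulrCA mulVf ?mulr1 //.
have main d H r : local_lift T s d H -> exists2 rho,
    forms_eval H (pt r) = rho *: lt r &
    forall y, Pi *m (jacobian H (pt r) *m y) = rho *: (Theta *m y).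
  move=> hH; have [rho [g D]] := data_exists hH; have [E G _ _] := D.
  exists rho.[r]; first exact: E.
  move=> y; apply/matrixP => i j; rewrite (ord1 j) G mxE.
  have := data_ratio hH1 hH D1 D y i; rewrite g1E => h.
  have /(mulfI rho10) -> : rho1 * g y i = rho1 * ((Theta *m y) i 0 *: rho).
    by rewrite -h -!scalerAr mulrC.
  by rewrite hornerZ mulrC.
have ThW w : w \in W -> Theta *m w = 0.
  move=> wW; rewrite ThE; suff -> : Pi *m (jacobian H1 (pt r1) *m w) = 0 by rewrite scaler0.
  have jP := pathjet_line (pt r1) w; have jH := pathjet_mulmx Pi (pathjet_forms H1 jP).
  apply/matrixP => i j; rewrite (ord1 j) [RHS]mxE.
  have z t : (Pi *m forms_eval H1 (pt r1 + t *: w)) i 0 = 0.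
    move: t; apply: polyfun_eq0; first exact: (pathjet_polypath jH).
    have P0 : pt r1 + 0 *: w != 0 by rewrite scale0r addr0 pt_neq0.
    apply: generically_imp (polypath_neq0 (polypath_line (pt r1) w) (ex_intro _ 0 P0)).
    move=> t Pt; have PW : pt r1 + t *: w \in W by rewrite memvD ?memvZ.
    have [c [r ePt]] := pb_span bW PW.
    have fP : T (pt r1 + t *: w) (pt r1 + t *: w) (pt r1 + t *: w) = 0.
      exact: (dl_sing HX).
    have ln0 : c *: l0 + r *: l1 != 0.
      apply: contraNneq Pt => /lfree[c0 r0].
      by rewrite ePt c0 r0 !scale0r addr0.
    have col : collinear (forms_eval H1 (pt r1 + t *: w)) (c *: l0 + r *: l1).
      apply: collinear_trans (reg_neq0 Hs Pt fP) (lift_collinear hH1 Pt fP) _.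
      by rewrite ePt; apply/collinear_sym/lcol.
    have [x ->] := collinearP ln0 col.
    by rewrite -scalemxAr Pi_l scaler0 mxE.
  by have [_ ->] := jet_uniq (jH i) (jet_eq (fun t => esym (z t)) (jetC 0)).
exists Theta; split=> //.
  by move=> v; rewrite ThE -scalemxAr Pi_idem.
move=> u Tu; have [r Dr] := generically_ex (generic_rank2 HX e0 D0).
have [d [H [hH Hr]]] := lift_exists Hs (pt_neq0 r) (fpt r).
have [uJ _] := jacobian_unit char0 HX Hs Hs' ss' hH (ptW r) Dr Hr.
have [rho _ hrho] := main d H r hH.
pose L' := (<[l0]> + <[l1]>)%VS.
have bL := plane_basis_span lfree; rewrite -/L' in bL.
have inL v : Theta *m v = 0 -> jacobian H (pt r) *m v \in L'.
  move=> Tv; have := hrho v; rewrite Tv scaler0 => /Pi_eq0 ->.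
  exact: (pb_mem bL).
have dL : \dim L' = 2%N.
  rewrite dim_add_vector ?dim_vline.
    suff -> : l0 != 0 by [].
    apply/eqP => z; have [] := lfree (c := 1) (r := 0).
      by rewrite z scaler0 scale0r addr0.
    by move/eqP; rewrite oner_eq0.
  apply/negP => /vlineP[c lc]; have [] := lfree (c := - c) (r := 1).
    by rewrite lc scale1r scaleNr addNr.
  by move=> _ /eqP; rewrite oner_eq0.
have Je1 : jacobian H (pt r) *m e1 != 0.
  by apply: contraNneq e10 => /(unitmx_eq0 uJ) ->.
have Je01 : jacobian H (pt r) *m e0 \notin <[jacobian H (pt r) *m e1]>%VS.
  apply/negP => /vlineP[c]; rewrite scalemxAr => /(congr1 (mulmx (invmx (jacobian H (pt r))))).
  rewrite !mulKmx // => ec; have [] := pb_free bW (c := 1) (d := - c).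
    by rewrite scale1r ec scaleNr subrr.
  by move/eqP; rewrite oner_eq0.
have bJ := plane_basis_pair dL (inL _ (ThW _ e0W)) (inL _ (ThW _ e1W)) Je1 Je01.
have [c [t]] := pb_span bJ (inL _ Tu).
rewrite !scalemxAr -mulmxDr => /(congr1 (mulmx (invmx (jacobian H (pt r))))).
by rewrite !mulKmx // => ->; apply: (pb_mem bW).
Qed.

End Projection.

(** A linear isomorphism with the same restriction to the double line as the
  automorphism, and the same normal derivative along it. *)
Lemma linear_model : exists M : 'M[k]_5,
  [/\ M \in unitmx,
      forall c r, M *m (c *: e0 + r *: e1) = c *: l0 + r *: l1,
      forall w, w \in W -> collinear (M *m w) (s w) &
      forall d H r, local_lift T s d H -> exists2 rho,
        forms_eval H (e0 + r *: e1) = rho *: (M *m (e0 + r *: e1)) &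
        forall y, exists2 w, w \in W &
          jacobian H (e0 + r *: e1) *m y = rho *: (M *m y) + M *m w].
Proof.
have [eta0 [eta1 [eta00 eta01 eta10 eta11]]] := dual_pair (plane_basis_span lfree).
have [xi0 [xi1 [x00 x01 x10 x11]]] := dual_pair bW.
have [Theta [PTh ThW ThI ThH]] := normal_derivative eta00 eta01 eta10 eta11.
pose Pi : 'M[k]_5 := 1%:M - l0 *m eta0 - l1 *m eta1; rewrite -/Pi in PTh ThH.
have PiE v : Pi *m v = v - lform eta0 v *: l0 - lform eta1 v *: l1.
  rewrite /Pi !mulmxBl mul1mx -!mulmxA; congr (_ - _ - _); apply/matrixP => i j;
    by rewrite (ord1 j) !mxE big_ord1 mulrC.
pose M := l0 *m xi0 + l1 *m xi1 + Theta.
have ME v : M *m v = lform xi0 v *: l0 + lform xi1 v *: l1 + Theta *m v.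
  rewrite /M !mulmxDl -!mulmxA; congr (_ + _ + _); apply/matrixP => i j;
    by rewrite (ord1 j) !mxE big_ord1 mulrC.
have MW c r : M *m (c *: e0 + r *: e1) = c *: l0 + r *: l1.
  rewrite ME ThW ?addr0; last exact: (pb_mem bW).
  by rewrite !(lformD, lformZ) x00 x01 x10 x11 !mulr0 !mulr1 addr0 add0r.
have Pi_l c r : Pi *m (c *: l0 + r *: l1) = 0.
  rewrite PiE !(lformD, lformZ) eta00 eta01 eta10 eta11 !mulr0 !mulr1 addr0 add0r.
  by rewrite [c *: l0 + _]addrC addrK subrr.
have PiM v : Pi *m (M *m v) = Theta *m v.
  by rewrite ME mulmxDr Pi_l add0r PTh.
exists M; split=> // [|w /(pb_span bW)[c [r ->]]|d H r hH]; last first.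
- have [rho Hrho hJ] := ThH d H r hH; exists rho.
    by rewrite Hrho; have := MW 1 r; rewrite !scale1r => ->.
  move=> y; set J := jacobian _ _; set z := J *m y - rho *: (M *m y).
  have Pz : Pi *m z = 0 by rewrite /z mulmxBr hJ -scalemxAr PiM subrr.
  exists (lform eta0 z *: e0 + lform eta1 z *: e1); first exact: (pb_mem bW).
  rewrite MW; have <- : z = lform eta0 z *: l0 + lform eta1 z *: l1.
    by move: Pz; rewrite PiE -addrA -opprD => /eqP; rewrite subr_eq0 => /eqP.
  by rewrite /z addrC subrK.
- by rewrite MW; apply: lcol.
apply: unitmx_inj => v Mv; have Tv : Theta *m v = 0 by rewrite -PiM Mv mulmx0.
have [c [r ev]] := pb_span bW (ThI _ Tv).
by move: Mv; rewrite ev MW => /lfree[-> ->]; rewrite !scale0r addr0.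
Qed.

End Reconstruction.

Lemma collinear_lform (k : fieldType) m (xi zeta : 'rV[k]_m) (a b : 'cV[k]_m) :
  collinear a b -> lform xi a * lform zeta b = lform zeta a * lform xi b.
Proof.
have [->|b0] := eqVneq b 0; first by rewrite !lform0 !mulr0.
by case/(collinearP b0)=> x ->; rewrite !lformZ; rewrite mulrAC mulrC mulrA.
Qed.

Lemma polyfun_lform (k : closedFieldType) m (xi : 'rV[k]_m) (P : k -> 'cV[k]_m) :
  polypath P -> polyfun (fun t => lform xi (P t)).
Proof.
move=> hP; apply: (@polyfun_eq _ (fun t => \sum_i xi 0 i * P t i 0)) => [t|].
  by rewrite /lform mxE.
by apply: polyfun_sum => i; apply: polyfunM (polyfunC _) (hP i).
Qed.

Lemma polypath_mulmx (k : closedFieldType) m n (M : 'M[k]_(n, m)) (P : k -> 'cV[k]_m) :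
  polypath P -> polypath (fun t => M *m P t).
Proof.
move=> hP j; apply: (@polyfun_eq _ (fun t => \sum_i M j i * P t i 0)) => [t|].
  by rewrite mxE.
by apply: polyfun_sum => i; apply: polyfunM (polyfunC _) (hP i).
Qed.

(** * The automorphism on residual lines *)
Section Shift.
Variables (k : closedFieldType) (char0 : [pchar k] =i pred0).
Notation V := 'cV[k]_5.
Implicit Types (E : {vspace V}) (a b p u v w x y z B : V) (c r t : k) (n d : nat)
  (H : 'I_5 -> {mpoly k[5]}).
Variables (T : V -> V -> V -> k) (W : {vspace V}).
Hypothesis HX : double_line_cubic T W.
Let HT := dl_tri HX.
Let TE := triE HT.
Let three0 : 3%:R != 0 :> k := natS_neq0 char0 2.
Variables (e0 e1 : V) (bW : plane_basis W e0 e1).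
Variable s : V -> V.
Hypothesis Hs : regular_map T s.
Variable M : 'M[k]_5.
Hypotheses (uM : M \in unitmx) (MW : forall w, w \in W -> collinear (M *m w) (s w)).
Hypothesis Mlift : forall d H r, local_lift T s d H -> exists2 rho,
  forms_eval H (e0 + r *: e1) = rho *: (M *m (e0 + r *: e1)) &
  forall y, exists2 w, w \in W &
    jacobian H (e0 + r *: e1) *m y = rho *: (M *m y) + M *m w.
Hypothesis lin_res : forall u, T e1 u u != 0 ->
  linear_on s (<[residual_point T e0 e1 u]> + <[residual_direction T e1 u]>)%VS.

Let e0W : e0 \in W := pb_mem1 bW.
Let e1W : e1 \in W := pb_mem2 bW.

Let notinW u : T e1 u u != 0 -> u \notin W.
Proof. by apply: contra => uW; rewrite (dl_sing HX). Qed.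

Let M_neq0 v : v != 0 -> M *m v != 0.
Proof. by apply: contraNneq => /(unitmx_eq0 uM) ->. Qed.

(** The automorphism sends x + u to M (x + B + u) for all x in W such that x + u
  lies in the cone over X. *)
Definition shift u B : Prop := B \in W /\
  forall x, x \in W -> T (x + u) (x + u) (x + u) = 0 ->
    collinear (M *m (x + B + u)) (s (x + u)).

(** On the residual line of u the automorphism is given by a matrix N. At the point
  p where this line meets the double line, N and M agree up to a factor, and the
  derivatives of a lift along the line compare N w to M w for a second point w of
  the line: they agree up to that factor and an element of M W. *)
Lemma shift_exists u : T e1 u u != 0 -> exists B, shift u B.
Proof.
move=> q0; have uW := notinW q0.
pose r := - T e0 u u / T e1 u u; pose p := e0 + r *: e1.
pose w := residual_direction T e1 u.
have pW : p \in W by rewrite memvD ?memvZ.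
have p0 : p != 0.
  apply/eqP => z; have := pb_free bW (c := 1) (d := r); rewrite scale1r => /(_ z)[/eqP].
  by rewrite oner_eq0.
have fp : T p p p = 0 by apply: (dl_sing HX).
have [N hN] := lin_res q0; set E := (_ + _)%VS in hN.
have resE : residual_point T e0 e1 u = T e1 u u *: p.
  rewrite /p /residual_point scalerDr scalerA /r mulrCA divff // mulr1.
  by rewrite scaleNr.
have pE : p \in E.
  have -> : p = (T e1 u u)^-1 *: residual_point T e0 e1 u.
    by rewrite resE scalerA mulVf // scale1r.
  by rewrite (subvP (addvSl _ _)) // memvZ ?memv_line.
have wE : w \in E by rewrite (subvP (addvSr _ _)) ?memv_line.
have wu : w = - (T u u u / (3%:R * T e1 u u)) *: e1 + u.
  by rewrite /w /residual_direction scaleNr addrC.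
have qpu : T p u u = 0 by rewrite /p /r !TE; field.
have pdef : p = e0 + r *: e1 by [].
clearbody p w.
have fw : T w w w = 0.
  rewrite wu (sing_cube HX) ?memvZ // !TE; field; exact/andP.
have qpw : T p w w = 0.
  by rewrite wu !(triD2 HT, triD3 HT, triZ2 HT, triZ3 HT) (tri23 HT p u e1) !(dl_sing HX _ pW e1W) qpu !(mulr0, addr0).
have wW : w \notin W.
  apply: contra uW => h; rewrite -[u](addKr (- (T u u u / (3%:R * T e1 u u)) *: e1)) -wu.
  by rewrite memvD // memvN memvZ.
have [Np0 Npc] := hN p pE p0.
have Mp0 := M_neq0 p0; have sp0 := reg_neq0 Hs p0 fp.
have [mu mu0 eNp] := collinearP_neq0 Mp0 Np0
  (collinear_trans sp0 Npc (collinear_sym (MW pW))).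
have [d [H [hH Hp]]] := lift_exists Hs p0 fp.
have [rho Hrho HJ] := Mlift r hH; rewrite -pdef in Hrho HJ.
have rho0 : rho != 0 by apply: contraNneq Hp => z; rewrite Hrho z scale0r.
have nzl t : p + t *: w != 0.
  apply/eqP => z; have [t0|t0] := eqVneq t 0.
    by move: z; rewrite t0 scale0r addr0 => z; rewrite z eqxx in p0.
  case/negP: wW; rewrite -[w]scale1r -(mulVf t0) -scalerA memvZ //.
  by move/eqP: z; rewrite addrC addr_eq0 => /eqP->; rewrite memvN.
have fl t : T (p + t *: w) (p + t *: w) (p + t *: w) = 0.
  by rewrite (sing_cube HX) // !(triZ1 HT, triZ2 HT, triZ3 HT) qpw fw !mulr0 addr0.
have jH := pathjet_forms H (pathjet_line p w); rewrite Hrho in jH.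
have jN : pathjet (fun t => N *m (p + t *: w)) (mu *: (M *m p)) (N *m w).
  by rewrite -eNp; apply: pathjet_mulmx (pathjet_line p w).
have col t : collinear (forms_eval H (p + t *: w)) (N *m (p + t *: w)).
  apply: collinear_trans (reg_neq0 Hs (nzl t) (fl t)) (lift_collinear hH (nzl t) (fl t)) _.
  apply: collinear_sym; have [] := hN (p + t *: w) _ (nzl t) => //.
  by rewrite memvD ?memvZ.
have [x ex] := collinearP Mp0 (pathjet_collinear_scaled jH jN col).
have [w1 w1W eJ] := HJ w.
pose B := rho^-1 *: w1 + (x / (mu * rho)) *: p.
have BW : B \in W by rewrite memvD ?memvZ.
have eNw : N *m w = mu *: (M *m (w + B)).
  apply: (scalerI rho0); move/eqP: ex; rewrite subr_eq => /eqP ->.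
  rewrite eJ /B !mulmxDr -!scalemxAr !scalerDr !scalerA.
  have -> : rho * mu * rho^-1 = mu by field.
  have -> : rho * mu * (x / (mu * rho)) = x by field; apply/andP.
  by move: (M *m p) (M *m w) (M *m w1) => a b c; apply/matrixP => i j; rewrite !mxE; ring.
clearbody B; exists B; split=> // x1 x1W fx.
have [a0 [a1 ex1]] := pb_span bW x1W.
have ea : a1 + T u u u / (3%:R * T e1 u u) = a0 * r.
  move: fx; rewrite (sing_cube HX) // ex1 !TE => h.
  have -> : T u u u = - (3%:R * (a0 * T e0 u u + a1 * T e1 u u)).
    by apply/eqP; rewrite -addr_eq0 addrC h.
  by rewrite /r; field; apply/andP.
have ex1u : x1 + u = w + a0 *: p.
  rewrite wu pdef ex1 scalerDr scalerA -ea scalerDl scaleNr.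
  by apply/matrixP => i j; rewrite !mxE; ring.
have nz : x1 + u != 0.
  apply: contra uW => /eqP z; rewrite -[u](addKr x1) z addr0 memvN //.
have inE : x1 + u \in E by rewrite ex1u memvD ?memvZ.
have [N0 Nc] := hN _ inE nz.
have eN : N *m (x1 + u) = mu *: (M *m (x1 + B + u)).
  rewrite addrAC ex1u !mulmxDr -!scalemxAr eNp eNw mulmxDr.
  by move: (M *m p) (M *m w) (M *m B) => a b c; apply/matrixP => i j; rewrite !mxE; ring.
by rewrite eN in Nc; apply: collinearZ_neq0 mu0 Nc.
Qed.

Let canonical_x u := - (T u u u / (3%:R * T e1 u u)) *: e1.

Let canonical_xW u : canonical_x u \in W.
Proof. by rewrite memvZ. Qed.

Let canonical_cubic u : T e1 u u != 0 ->
  T (canonical_x u + u) (canonical_x u + u) (canonical_x u + u) = 0.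
Proof.
move=> q0; rewrite (sing_cube HX) ?memvZ // /canonical_x (triZ1 HT).
by field; apply/andP.
Qed.

Let addW_neq0 x u : u \notin W -> x \in W -> x + u != 0.
Proof.
move=> uW xW; apply: contra uW => /eqP z.
by rewrite -[u](addKr x) z addr0 memvN.
Qed.

Let collinear_addW x x' u : u \notin W -> x \in W -> x' \in W ->
  collinear (x + u) (x' + u) -> x = x'.
Proof.
move=> uW xW x'W /(collinearP (addW_neq0 uW x'W))[c ec].
have c1 : c = 1.
  apply/eqP; apply: contraR uW; rewrite eq_sym -subr_eq0 => c1.
  rewrite -[u]scale1r -(mulVf c1) -scalerA memvZ //.
  have -> : (1 - c) *: u = c *: x' - x.
    apply/eqP; rewrite scalerBl scale1r subr_eq addrAC -scalerDr -ec.
    by rewrite [x + u]addrC addrK.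
  by rewrite memvB ?memvZ.
by move: ec; rewrite c1 scale1r => /addIr.
Qed.

(** The shift can be read off from the image of one point, and x + u is determined
  by its projective class because u is not in W. *)
Lemma shift_uniq u B B' : T e1 u u != 0 -> shift u B -> shift u B' -> B = B'.
Proof.
move=> q0 [BW hB] [B'W hB']; have uW := notinW q0.
have x0W := canonical_xW u; have fx := canonical_cubic q0.
have nz := addW_neq0 uW x0W.
have h := collinear_trans (reg_neq0 Hs nz fx) (hB _ x0W fx) (collinear_sym (hB' _ x0W fx)).
have := collinear_addW uW _ _ (collinear_mulmx_inj uM h) => /(_ _ _)/addrI; apply.
- by rewrite memvD.
by rewrite memvD.
Qed.

Lemma shiftZ c u B : c != 0 -> T e1 u u != 0 -> shift u B -> shift (c *: u) (c *: B).
Proof.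
move=> c0 q0 [BW hB]; split=> [|x xW fx]; first by rewrite memvZ.
have ex : x = c *: (c^-1 *: x) by rewrite scalerA divff // scale1r.
rewrite ex -!scalerDr in fx *; move: fx; rewrite !TE => fx.
have x'W : c^-1 *: x \in W by rewrite memvZ.
have f' : T (c^-1 *: x + u) (c^-1 *: x + u) (c^-1 *: x + u) = 0.
  by do 3!move/(mulf_cancel0 c0): fx => fx; rewrite -[LHS]mul1r; move: fx; rewrite !TE mul1r.
have nz := addW_neq0 (notinW q0) x'W.
rewrite -scalemxAr; apply/collinearZ.
apply: collinear_trans (reg_neq0 Hs nz f') (hB _ x'W f') _.
apply/collinear_sym; apply: (reg_collinear Hs HT nz _ f').
  by rewrite scaler_eq0 negb_or c0.
exact/collinearZ/collinear_refl.
Qed.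

Lemma shiftW u w B : w \in W -> shift u B -> shift (w + u) B.
Proof.
move=> wW [BW hB]; split=> // x xW; rewrite addrA => fx.
have := hB _ (memvD xW wW) fx; congr (collinear (M *m _) _).
by rewrite !addrA [x + B + w]addrAC.
Qed.

End Shift.

Section ShiftLine.
Variables (k : closedFieldType) (char0 : [pchar k] =i pred0).
Notation V := 'cV[k]_5.
Implicit Types (E : {vspace V}) (a b p u v w x y z B : V) (c r t : k) (n d : nat)
  (H : 'I_5 -> {mpoly k[5]}).
Variables (T : V -> V -> V -> k) (W : {vspace V}).
Hypothesis HX : double_line_cubic T W.
Let HT := dl_tri HX.
Let TE := triE HT.
Let two0 : 2%:R != 0 :> k := natS_neq0 char0 1.
Let three0 : 3%:R != 0 :> k := natS_neq0 char0 2.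
Variables (e0 e1 : V) (bW : plane_basis W e0 e1).
Variables (s s' : V -> V).
Hypotheses (Hs : regular_map T s) (Hs' : regular_map T s').
Hypothesis ss' : forall v, v != 0 -> T v v v = 0 -> collinear (s' (s v)) v.
Variable M : 'M[k]_5.
Hypotheses (uM : M \in unitmx) (MW : forall w, w \in W -> collinear (M *m w) (s w)).
Notation shift := (shift T W s M).
Hypothesis shift_ex : forall u, T e1 u u != 0 -> exists B, shift u B.

Let e0W : e0 \in W := pb_mem1 bW.
Let e1W : e1 \in W := pb_mem2 bW.


Let M_neq0 v : v != 0 -> M *m v != 0.
Proof. by apply: contraNneq => /(unitmx_eq0 uM) ->. Qed.

(** Homogeneous in x and r, so that it covers the double line, where r = 0. *)
Lemma shift_scaled y B x r : T e1 y y != 0 -> shift y B -> x \in W ->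
  T (x + r *: y) (x + r *: y) (x + r *: y) = 0 -> x + r *: y != 0 ->
  collinear (M *m (x + r *: B + r *: y)) (s (x + r *: y)).
Proof.
move=> q0 hB xW fx nz; have [r0|r0] := eqVneq r 0.
  by rewrite r0 !scale0r !addr0; apply: MW.
have ex : x = r *: (r^-1 *: x) by rewrite scalerA divff // scale1r.
have [BW hB'] := shiftZ HX bW Hs r0 q0 hB.
by apply: hB'.
Qed.

(** The shift is a polynomial along the line v + t v': at a pole, a path in X
  over the line would be mapped to the image of the double line although it does
  not end on the double line, or would end on the double line at a point whose
  image is known. The second case only occurs over common zeros of the two
  conics; they are simple because the first conic has two distinct zeros on the
  line. *)
Lemma shift_line v v' : disc (T e1) v v' != 0 ->
  exists b0 b1 : {poly k}, forall t B, T e1 (v + t *: v') (v + t *: v') != 0 ->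
    shift (v + t *: v') B -> B = b0.[t] *: e0 + b1.[t] *: e1.
Proof.
move=> D1; pose y t := v + t *: v'.
have py : polypath y by apply: polypath_line.
pose q t := T e1 (y t) (y t); pose q' t := T e0 (y t) (y t).
pose C t := T (y t) (y t) (y t).
have pq : polyfun q by apply: polyfun_tri => //; apply: polypathC.
have pq' : polyfun q' by apply: polyfun_tri => //; apply: polypathC.
have pC : polyfun C by apply: polyfun_tri.
have qE t : q t = T e1 v v + 2%:R * T e1 v v' * t + T e1 v' v' * t ^+ 2.
  by rewrite /q /y !TE (tri23 HT e1 v' v); ring.
(* The zeros of q are simple. *)
have simple t0 q1 : (forall t, q t = (t - t0) * q1 t) -> polyfun q1 -> q1 t0 != 0.
  move=> hq1 [p hp]; apply/eqP => z.
  have /factor_theorem[p2 ep] : root p t0 by apply/rootP; rewrite -hp.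
  have hq2 t : q t = (t - t0) ^+ 2 * p2.[t].
    by rewrite hq1 hp ep hornerM hornerXsubC; ring.
  case/eqP: D1; have q0 : q t0 = 0 by rewrite hq1 subrr mul0r.
  have d0 : T e1 v v' + t0 * T e1 v' v' = 0.
    have key t : t * (2%:R * (T e1 v v' + t0 * T e1 v' v') + t * T e1 v' v' - t * p2.[t + t0]) = 0.
      have := hq2 (t + t0); rewrite addrK => h.
      have : q (t + t0) - q t0 = t ^+ 2 * p2.[t + t0] by rewrite h q0 subr0.
      move=> h'; apply/eqP; rewrite -(subr0 (_ * _)) -(subrr (t ^+ 2 * p2.[t + t0])) -{1}h' !qE.
      by apply/eqP; ring.
    apply: (mulf_cancel0 two0).
    pose pp := (2%:R * (T e1 v v' + t0 * T e1 v' v'))%:P + 'X * ((T e1 v' v')%:P - (p2 \Po ('X + t0%:P))).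
    have : 'X * pp = 0.
      apply: poly_fun_eq0 => t; rewrite -[RHS](key t) /pp !(hornerM, hornerD, hornerN, horner_comp, hornerX, hornerC).
      by ring.
    move/(mulf_cancel0 (negbT (polyX_eq0 _))) => h; have := congr1 (horner^~ 0) h.
    by rewrite /pp hornerD hornerC hornerM hornerX mul0r addr0 horner0.
  have e1v : T e1 v v' = - (t0 * T e1 v' v') by apply/eqP; rewrite -addr_eq0 d0.
  have e2 : T e1 v v = t0 ^+ 2 * T e1 v' v'.
    by move: q0; rewrite qE e1v => h; apply/eqP; rewrite -subr_eq0 -h; apply/eqP; ring.
  by rewrite /disc e1v e2; ring.
have yW t : y t \notin W.
  apply/negP => h; have h1 z : T e1 (y t) z = 0 by apply: (dl_sing HX).
  case/eqP: D1; have := h1 v; have := h1 v'; rewrite /y !TE (tri23 HT e1 v' v) => a1 a2.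
  by apply: (lin_comb2 a1 a2 (x := T e1 v v') (y := - T e1 v' v')); rewrite /disc; ring.
have [t1 qt1] : exists t, q t != 0.
  apply: NNPP => no; have z t : q t = 0.
    by apply/eqP/negPn/negP => h; apply: no; exists t.
  have [a1 a2 a3 _ _] : [/\ T e1 v v = 0, 2%:R * T e1 v v' = 0, T e1 v' v' = 0,
      0 = 0 :> k & 0 = 0 :> k].
    by apply: quartic_eq0 => t; rewrite -[RHS](z t) qE; ring.
  by case/eqP: D1; rewrite /disc a1 a3 (mulf_cancel0 two0 a2) mul0r expr0n subrr.
have gq : generically (fun t => q t != 0) by apply: polyfun_generic (ex_intro _ t1 qt1).
suff : exists b0 b1 : {poly k}, forall t B, q t != 0 -> shift (y t) B ->
    B = b0.[t] *: e0 + b1.[t] *: e1 by [].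
clearbody y.
have [xi0 [xi1 [x00 x01 x10 x11]]] := dual_pair bW.
have Wdec B : B \in W -> B = lform xi0 B *: e0 + lform xi1 B *: e1.
  move=> /(pb_span bW)[c [r ->]]; rewrite !(lformD, lformZ) x00 x01 x10 x11.
  by rewrite !mulr0 !mulr1 addr0 add0r.
pose P t := (- C t) *: e1 + (3%:R * q t) *: y t.
have pP : polypath P.
  apply: polypathD; first by apply: polypathZ (polypathC _); apply: polyfunN.
  by apply: polypathZ py; apply: polyfunM => //; apply: polyfunC.
have fP t : T (P t) (P t) (P t) = 0.
  by rewrite /P (sing_cube HX) ?memvZ // !TE -/(q t) -/(C t); ring.
have Pnz t : q t != 0 -> P t != 0.
  move=> qt; apply/eqP => z; case/negP: (yW t).
  have h3 : 3%:R * q t != 0 by rewrite mulf_neq0.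
  rewrite -[y t]scale1r -(mulVf h3) -scalerA memvZ //.
  by move/eqP: z; rewrite /P addrC addr_eq0 => /eqP->; rewrite memvN memvZ.
pose good (g : {poly k} * ({poly k} * {poly k})) := g.1 != 0 /\
  generically (fun t => forall B, q t != 0 -> shift (y t) B ->
    g.1.[t] *: B = g.2.1.[t] *: e0 + g.2.2.[t] *: e1).
(* A lift followed by the inverse of M gives the shift as a quotient. *)
have ex_good : exists g, good g.
  have [d [H [hH Hnz]]] := lift_exists Hs (Pnz t1 qt1) (fP t1).
  pose N t := invmx M *m forms_eval H (P t).
  have pN : polypath N by apply: polypath_mulmx (polypath_forms H pP).
  have [ze zeW zey] := separating_form (yW t1).
  have NB t B : q t != 0 -> shift (y t) B -> collinear (N t) (P t + (3%:R * q t) *: B).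
    move=> qt hB; have nz := Pnz t qt; apply: (collinear_mulmx_inj uM).
    rewrite mulKVmx //; apply: collinear_trans (reg_neq0 Hs nz (fP t)) (lift_collinear hH nz (fP t)) _.
    apply: collinear_sym; rewrite /P addrAC; apply: shift_scaled => //.
      by rewrite memvZ.
    exact: fP.
  have zP : forall t, lform ze (P t) = 3%:R * q t * lform ze (y t).
    by move=> t; rewrite /P lformD !lformZ zeW // mulr0 add0r.
  have pzN := polyfun_lform ze pN; have pzy := polyfun_lform ze py.
  clearbody P.
  have [g hg] : polyfun (fun t => 3%:R * q t * lform ze (N t)).
    by apply: polyfunM pzN; apply: polyfunM => //; apply: polyfunC.
  have uE xi : polyfun (fun t => 3%:R * q t * lform ze (y t) * lform xi (N t) -
      lform ze (N t) * lform xi (P t)).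
    apply: polyfunB; last by apply: polyfunM => //; apply: polyfun_lform.
    apply: polyfunM; last exact: polyfun_lform.
    by apply: polyfunM pzy; apply: polyfunM => //; apply: polyfunC.
  have [u0 hu0] := uE xi0; have [u1 hu1] := uE xi1.
  exists (g, (u0, u1)); split=> /=.
    have [B1 hB1] := shift_ex qt1.
    have N0 : N t1 != 0.
      by apply: contraNneq Hnz => z; rewrite -(mulKVmx uM (forms_eval H _)) -/(N t1) z mulmx0.
    have zB1 : lform ze (P t1 + (3%:R * q t1) *: B1) = 3%:R * q t1.
      by rewrite lformD lformZ zP zey zeW ?mulr0 ?mulr1 ?addr0 //; case: hB1.
    have PB0 : P t1 + (3%:R * q t1) *: B1 != 0.
      apply/eqP => z; have := zB1; rewrite z lform0 => /esym/eqP.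
      by rewrite mulf_eq0 (negPf three0) (negPf qt1).
    have [c c0 eN] := collinearP_neq0 PB0 N0 (NB t1 B1 qt1 hB1).
    have : g.[t1] != 0 by rewrite -hg eN lformZ zB1 !mulf_neq0.
    by apply: contraNneq => ->; rewrite horner0.
  apply: generically_all => t B qt hB; have BW := hB.1.
  have comp xi : 3%:R * q t * lform ze (N t) * lform xi B =
      3%:R * q t * lform ze (y t) * lform xi (N t) - lform ze (N t) * lform xi (P t).
    have := collinear_lform xi ze (NB t B qt hB); rewrite !(lformD, lformZ) zP (zeW B) //.
    rewrite mulr0 addr0 => h; rewrite [_ * lform xi (N t)]mulrC h; ring.
  rewrite [in LHS](Wdec B BW) scalerDr !scalerA.
  by rewrite -hg -hu0 -hu1 !comp.
have [[g [u0 u1]] [g0 ggood] gmin] := exists_minimal (fun g : {poly k} * ({poly k} * {poly k}) => size g.1) ex_good.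
rewrite /= in g0 ggood gmin.
pose uh t := u0.[t] *: e0 + u1.[t] *: e1.
have uhW t : uh t \in W by rewrite memvD ?memvZ.
have puh : polypath uh.
  by apply: polypathD; apply: polypathZ (polypathC _); apply: polyfun_horner.
have along (x : k -> V) (r : k -> k) : polypath x -> polyfun r ->
    (forall t, x t \in W) ->
    (forall t, T (x t + r t *: y t) (x t + r t *: y t) (x t + r t *: y t) = 0) ->
    generically (fun t => x t + r t *: y t != 0 ->
      collinear (M *m (g.[t] *: (x t + r t *: y t) + r t *: uh t)) (s (x t + r t *: y t))).
  move=> px pr xW fx; apply: generically_imp (generically_and gq ggood) => t [qt gt] nz.
  have [B hB] := shift_ex qt; have gB := gt B qt hB.
  have -> : g.[t] *: (x t + r t *: y t) + r t *: uh t =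
      g.[t] *: (x t + r t *: B + r t *: y t).
    rewrite /uh -gB !scalerDr !scalerA [r t * _]mulrC -!addrA; congr (_ + _).
    by rewrite addrC.
  by rewrite -scalemxAr; apply/collinearZ/shift_scaled.
have pXR (x : k -> V) (r : k -> k) : polypath x -> polyfun r ->
    polypath (fun t => x t + r t *: y t).
  by move=> px pr; apply: polypathD => //; apply: polypathZ.
have image (x : k -> V) (r : k -> k) t0 : polypath x -> polyfun r ->
    (forall t, x t \in W) ->
    (forall t, T (x t + r t *: y t) (x t + r t *: y t) (x t + r t *: y t) = 0) ->
    x t0 + r t0 *: y t0 != 0 ->
    collinear (M *m (g.[t0] *: (x t0 + r t0 *: y t0) + r t0 *: uh t0))
      (s (x t0 + r t0 *: y t0)).
  move=> px pr xW fx nz; have pXr := pXR _ _ px pr.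
  have pN : polypath (fun t => M *m (g.[t] *: (x t + r t *: y t) + r t *: uh t)).
    apply: polypath_mulmx; apply: polypathD; last exact: polypathZ.
    by apply: polypathZ => //; apply: polyfun_horner.
  exact: (lift_closure Hs pXr fx pN (along x r px pr xW fx) nz).
have s_W a : a \in W -> a != 0 -> s a != 0.
  by move=> aW a0; apply: (reg_neq0 Hs a0); apply: (dl_sing HX).
have off (x : k -> V) (r : k -> k) t0 : polypath x -> polyfun r ->
    (forall t, x t \in W) ->
    (forall t, T (x t + r t *: y t) (x t + r t *: y t) (x t + r t *: y t) = 0) ->
    r t0 != 0 -> g.[t0] = 0 -> uh t0 = 0.
  move=> px pr xW fx rt gt; apply/eqP; apply: contraT => u_neq0; exfalso.
  have nz : x t0 + r t0 *: y t0 != 0.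
    apply/eqP => z; case/negP: (yW t0).
    rewrite -[y t0]scale1r -(mulVf rt) -scalerA memvZ //.
    by move/eqP: z; rewrite addrC addr_eq0 => /eqP->; rewrite memvN.
  have := image x r t0 px pr xW fx nz; rewrite gt scale0r add0r -scalemxAr.
  move/(collinearZ_neq0 rt) => h1.
  have h2 := collinear_trans (M_neq0 u_neq0) (collinear_sym h1) (MW (uhW t0)).
  have := reg_inj HX Hs Hs' ss' nz u_neq0 (fx t0) (dl_sing HX _ (uhW t0) (uhW t0)) h2.
  case/(collinearP u_neq0) => c ec; case/negP: (yW t0).
  rewrite -[y t0]scale1r -(mulVf rt) -scalerA memvZ //.
  have -> : r t0 *: y t0 = c *: uh t0 - x t0 by rewrite -ec addrC addKr.
  by rewrite memvB ?memvZ.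
have pole t0 : g.[t0] = 0 -> uh t0 = 0.
  move=> gt0; have [qt0|qt0] := eqVneq (q t0) 0; last first.
    apply: (off (fun t => (- C t) *: e1) (fun t => 3%:R * q t)) => //.
    - by apply: polypathZ (polypathC _); apply: polyfunN.
    - by apply: polyfunM => //; apply: polyfunC.
    - by move=> t; rewrite memvZ.
    by rewrite mulf_neq0.
  have [qh pqh hq] := polyfun_root pq qt0.
  have qh0 := simple t0 qh hq pqh.
  have [q't0|q't0] := eqVneq (q' t0) 0; last first.
    apply: (off (fun t => (- C t) *: e0) (fun t => 3%:R * q' t)) => //.
    - by apply: polypathZ (polypathC _); apply: polyfunN.
    - by apply: polyfunM => //; apply: polyfunC.
    - by move=> t; rewrite memvZ.
    - by move=> t; rewrite (sing_cube HX) ?memvZ // !TE -/(q' t) -/(C t); ring.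
    by rewrite mulf_neq0.
  have [q'h pq'h hq'] := polyfun_root pq' q't0.
  have [Ct0|Ct0] := eqVneq (C t0) 0.
    have [Ch pCh hC] := polyfun_root pC Ct0.
    apply: (off (fun t => (- Ch t) *: e1) (fun t => 3%:R * qh t)) => //.
    - by apply: polypathZ (polypathC _); apply: polyfunN.
    - by apply: polyfunM => //; apply: polyfunC.
    - by move=> t; rewrite memvZ.
    - move=> t; rewrite (sing_cube HX) ?memvZ // !TE -/(q t) -/(C t) hq hC; ring.
    by rewrite mulf_neq0.
  (* Here the residual lines degenerate to the double line. *)
  have [gh pgh hg] := polyfun_root (polyfun_horner g) gt0.
  have on c : (c * qh t0) *: e0 - (c * q'h t0 + C t0) *: e1 != 0 ->
      collinear (uh t0) ((c * qh t0) *: e0 - (c * q'h t0 + C t0) *: e1).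
    set x0 := _ - _ => x00'.
    pose x t := (c * qh t) *: e0 + (- (c * q'h t + C t)) *: e1.
    pose r t := (t - t0) * (3%:R * qh t).
    have ex0 : x t0 = x0 by rewrite /x scaleNr.
    have px : polypath x.
      apply: polypathD; apply: polypathZ (polypathC _).
        by apply: polyfunM => //; apply: polyfunC.
      by apply/polyfunN/polyfunD => //; apply: polyfunM => //; apply: polyfunC.
    have pr : polyfun r.
      apply: polyfunM; first by apply: polyfunB; [apply: polyfunX | apply: polyfunC].
      by apply: polyfunM => //; apply: polyfunC.
    have xW t : x t \in W by rewrite memvD ?memvZ.
    have fx t : T (x t + r t *: y t) (x t + r t *: y t) (x t + r t *: y t) = 0.
      rewrite (sing_cube HX) // /x !TE -/(q t) -/(q' t) -/(C t) hq hq' /r; ring.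
    have rt0 : r t0 = 0 by rewrite /r subrr mul0r.
    have nz : x t0 + r t0 *: y t0 != 0 by rewrite rt0 scale0r addr0 ex0.
    pose N t := M *m (gh t *: (x t + r t *: y t) + (3%:R * qh t) *: uh t).
    have pN : polypath N.
      apply: polypath_mulmx; apply: polypathD; apply: polypathZ => //; first exact: pXR.
      by apply: polyfunM => //; apply: polyfunC.
    have gN : generically (fun t => x t + r t *: y t != 0 -> collinear (N t) (s (x t + r t *: y t))).
      apply: generically_imp (generically_and (generically_neq t0) (along x r px pr xW fx)).
      move=> t [tt0 h] /h; have tt1 : t - t0 != 0 by rewrite subr_eq0.
      have -> : g.[t] *: (x t + r t *: y t) + r t *: uh t =
          (t - t0) *: (gh t *: (x t + r t *: y t) + (3%:R * qh t) *: uh t).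
        by rewrite [RHS]scalerDr !scalerA hg.
      by rewrite -scalemxAr; apply: collinearZ_neq0.
    have := lift_closure Hs (pXR _ _ px pr) fx pN gN nz.
    rewrite /N rt0 scale0r addr0 ex0 => h.
    have x0W : x0 \in W by rewrite -ex0.
    have h2 := collinear_trans (s_W _ x0W x00') h (collinear_sym (MW x0W)).
    have := collinear_mulmx_inj uM h2 => /(collinearP x00')[c' ec'].
    have h3 : 3%:R * qh t0 != 0 by rewrite mulf_neq0.
    apply: (collinearZ_neq0 h3); have -> : (3%:R * qh t0) *: uh t0 = (c' - gh t0) *: x0.
      by rewrite scalerBl -ec' addrC addKr.
    exact/collinearZ/collinear_refl.
  have n0 : (0 * qh t0) *: e0 - (0 * q'h t0 + C t0) *: e1 != 0.
    apply/eqP; rewrite -scaleNr => /(pb_free bW)[_ /eqP].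
    by rewrite mul0r add0r oppr_eq0 (negPf Ct0).
  have n1 : (1 * qh t0) *: e0 - (1 * q'h t0 + C t0) *: e1 != 0.
    apply/eqP; rewrite -scaleNr => /(pb_free bW)[/eqP].
    by rewrite mul1r (negPf qh0).
  have [c0 ec0] := collinearP n0 (on 0 n0); have [c1 ec1] := collinearP n1 (on 1 n1).
  rewrite !mul0r scale0r !add0r scalerN scalerA in ec0.
  have := pb_free bW (c := c1 * qh t0) (d := c0 * C t0 - c1 * (q'h t0 + C t0)).
  rewrite !mul1r scalerBr !scalerA in ec1; rewrite scalerBl.
  rewrite [X in X = 0](_ : _ = uh t0 - uh t0); last first.
    by rewrite {1}ec1 ec0 opprK addrAC addrA.
  rewrite subrr => /(_ erefl)[/eqP]; rewrite mulf_eq0 (negPf qh0) orbF => /eqP c10.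
  by move=> _; rewrite ec1 c10 !mul0r !scale0r subrr.
(* A denominator of minimal degree has no zero. *)
have sg : size g = 1%N.
  apply/eqP; apply: contraT => /closed_rootP[t0 /rootP gt0]; exfalso.
  have /(pb_free bW)[u00 u10] := pole t0 gt0.
  have [g' eg] := factor_theorem g t0 (introT rootP gt0).
  have [u0' eu0] := factor_theorem u0 t0 (introT rootP u00).
  have [u1' eu1] := factor_theorem u1 t0 (introT rootP u10).
  have g'0 : g' != 0 by apply: contraNneq g0 => z; rewrite eg z mul0r.
  have : good (g', (u0', u1')).
    split=> //=; apply: generically_imp (generically_and (generically_neq t0) ggood).
    move=> t [tt0 h] B qt hB; have := h B qt hB.
    have tt1 : t - t0 != 0 by rewrite subr_eq0.
    rewrite eg eu0 eu1 !hornerM !hornerXsubC ![_ * (t - t0)]mulrC -!scalerA -scalerDr.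
    exact: (scalerI tt1).
  by move/gmin => /=; rewrite eg size_mul ?polyXsubC_eq0 // size_XsubC addn2 ltnn.
have /size_poly1P[c c0 ec] : size g == 1%N by rewrite sg.
exists (c^-1 *: u0), (c^-1 *: u1) => t0 B qt0 hB.
rewrite !hornerZ -!scalerA -scalerDr -/(uh t0).
have h := image (fun t => (- C t) *: e1) (fun t => 3%:R * q t) t0.
have nz := Pnz t0 qt0.
have h1 : collinear (M *m (c *: P t0 + (3%:R * q t0) *: uh t0)) (s (P t0)).
  have := h _ _ _ fP nz; rewrite ec hornerC; apply.
  - by apply: polypathZ (polypathC _); apply: polyfunN.
  - by apply: polyfunM => //; apply: polyfunC.
  by move=> t; rewrite memvZ.
have qt0' : 3%:R * q t0 != 0 by rewrite mulf_neq0.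
have h2 : collinear (M *m (P t0 + (3%:R * q t0) *: B)) (s (P t0)).
  rewrite /P addrAC; apply: shift_scaled => //; first by rewrite memvZ.
  exact: fP.
have BW := hB.1.
have h3 := collinear_mulmx_inj uM (collinear_trans (reg_neq0 Hs nz (fP t0)) h2 (collinear_sym h1)).
have [xi xiW xiy] := separating_form (yW t0).
have := collinear_lform xi xi0 h3; have := collinear_lform xi xi1 h3.
have xiP : lform xi (P t0) = 3%:R * q t0.
  by rewrite /P lformD !lformZ xiW // xiy mulr0 add0r mulr1.
clearbody P uh; rewrite !(lformD, lformZ) xiP !(xiW B) // !(xiW (uh t0)) // !mulr0 !addr0.
move=> k1 k0.
have comp xj : 3%:R * q t0 * (c * lform xj (P t0) + 3%:R * q t0 * lform xj (uh t0)) =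
    (lform xj (P t0) + 3%:R * q t0 * lform xj B) * (c * (3%:R * q t0)) ->
    lform xj B = c^-1 * lform xj (uh t0).
  move=> e; apply: (mulfI (mulf_neq0 (mulf_neq0 qt0' qt0') c0)).
  have -> : 3%:R * q t0 * (3%:R * q t0) * c * (c^-1 * lform xj (uh t0)) =
    3%:R * q t0 * (3%:R * q t0) * lform xj (uh t0) by field.
  apply/eqP; rewrite -subr_eq0; apply/eqP.
  move/eqP: e; rewrite -subr_eq0 => /eqP e; rewrite -[RHS]oppr0 -e; ring.
by rewrite (Wdec B BW) (Wdec _ (uhW t0)) (comp xi0 k0) (comp xi1 k1) scalerDr !scalerA.
Qed.

End ShiftLine.

(** * Automorphisms are linear *)

(** Multiplying by t^(n+1), where n+1 is the degree of c, gives at t = 0 the leading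
  coefficient of c on the right and 0 on the left. *)
Lemma reciprocal_const (k : closedFieldType) (b c : {poly k}) :
  generically (fun t => b.[t] = c.[t^-1]) -> exists r, forall t, b.[t] = r.
Proof.
move=> h; have [/size1_polyC ec|] := leqP (size c) 1.
  exists c`_0 => t.
  apply: (polyfun_ext (polyfun_horner b) (polyfunC c`_0)).
  by apply: generically_imp h => u ->; rewrite {1}ec hornerC.
case sc: (size c) => [|[|n]] // _.
pose G t := \sum_(i < n.+2) c`_i * t ^+ (n.+1 - i).
have pG : polyfun G.
  by apply: polyfun_sum => i; apply: polyfunM (polyfunC _) (polyfun_exp _ (@polyfunX _)).
have pB : polyfun (fun t => t ^+ n.+1 * b.[t]).
  by apply: polyfunM (polyfun_exp _ (@polyfunX _)) (polyfun_horner b).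
have eG : generically (fun t => t ^+ n.+1 * b.[t] = G t).
  apply: generically_imp (generically_and (generically_neq 0) h) => t [t0 ->].
  rewrite /G horner_coef sc big_distrr; apply: eq_bigr => i _ /=.
  rewrite mulrCA; congr (_ * _); rewrite exprVn.
  have -> : t ^+ n.+1 = t ^+ (n.+1 - i) * t ^+ i by rewrite -exprD subnK // -ltnS.
  by rewrite mulfK // expf_neq0.
have := polyfun_ext pB pG eG 0; rewrite expr0n mul0r /G big_ord_recr /= subnn expr0 mulr1.
rewrite big1 => [|i _]; last by rewrite subSn ?leq_ord // exprS mul0r mulr0.
by move/eqP; rewrite add0r eq_sym -[n.+1]/(n.+2.-1) -sc lead_coef_eq0 -size_poly_eq0 sc.
Qed.

Lemma reciprocal_linear (k : closedFieldType) (b c : {poly k}) :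
  generically (fun t => b.[t] = t * c.[t^-1]) -> forall t, b.[t] = b.[0] + t * c.[0].
Proof.
move=> h; have /factor_theorem[c' ec] : root (c - c.[0]%:P) 0.
  by apply/rootP; rewrite hornerD hornerN hornerC subrr.
have [r hr] : exists r, forall t, (b - c.[0] *: 'X).[t] = r.
  apply: (@reciprocal_const _ _ c').
  apply: generically_imp (generically_and (generically_neq 0) h) => t [t0 bt].
  have e : c.[t^-1] - c.[0] = c'.[t^-1] * t^-1.
    by have := congr1 (horner^~ t^-1) ec; rewrite /= !(hornerM, hornerD, hornerN, hornerX, hornerC) subr0.
  rewrite hornerD hornerN hornerZ hornerX bt -(mulfVK t0 c'.[_]) -e; ring.
move=> t; have := hr t; rewrite -(hr 0) !(hornerD, hornerN, hornerZ, hornerX).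
by rewrite mulr0 subr0 => <-; ring.
Qed.

Section Linear.
Variables (k : closedFieldType) (char0 : [pchar k] =i pred0).
Notation V := 'cV[k]_5.
Implicit Types (E : {vspace V}) (a b p u v w x y z B : V) (c r t : k) (n d : nat)
  (H : 'I_5 -> {mpoly k[5]}).
Variables (T : V -> V -> V -> k) (W : {vspace V}).
Hypothesis HX : double_line_cubic T W.
Let HT := dl_tri HX.
Let TE := triE HT.
Let two0 : 2%:R != 0 :> k := natS_neq0 char0 1.
Let three0 : 3%:R != 0 :> k := natS_neq0 char0 2.
Variables (e0 e1 v0 w0 : V) (bW : plane_basis W e0 e1).
Hypothesis D0 : disc (T e1) v0 w0 != 0.
Variables (s s' : V -> V).
Hypotheses (Hs : regular_map T s) (Hs' : regular_map T s').
Hypothesis ss' : forall v, v != 0 -> T v v v = 0 -> collinear (s' (s v)) v.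
Variable M : 'M[k]_5.
Hypotheses (uM : M \in unitmx) (MW : forall w, w \in W -> collinear (M *m w) (s w)).
Notation shift := (shift T W s M).
Hypothesis shift_ex : forall u, T e1 u u != 0 -> exists B, shift u B.

Let e1W : e1 \in W := pb_mem2 bW.

(** Along v + t v' the shift is a polynomial in t; by homogeneity it is also t times
  a polynomial in 1/t. *)
Lemma shift_add v v' t B B' B'' : disc (T e1) v v' != 0 ->
  T e1 v v != 0 -> T e1 v' v' != 0 -> T e1 (v + t *: v') (v + t *: v') != 0 ->
  shift v B -> shift v' B' -> shift (v + t *: v') B'' -> B'' = B + t *: B'.
Proof.
move=> D1 qv qv' qt hB hB' hB''.
have [b0 [b1 hb]] := shift_line char0 HX bW Hs Hs' ss' uM MW shift_ex D1.
have D1' : disc (T e1) v' v != 0.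
  by move: D1; rewrite /disc (tri23 HT e1 v' v) [_ v v * _]mulrC.
have [c0 [c1 hc]] := shift_line char0 HX bW Hs Hs' ss' uM MW shift_ex D1'.
pose q t := T e1 (v + t *: v') (v + t *: v').
have pl := polypath_line v v'.
have pq : polyfun q by apply: polyfun_tri => //; apply: polypathC.
have gq : generically (fun t => q t != 0).
  by apply: polyfun_generic pq _; exists 0; rewrite /q scale0r addr0.
have rec : generically (fun t => b0.[t] = t * c0.[t^-1] /\ b1.[t] = t * c1.[t^-1]).
  apply: generically_imp (generically_and (generically_neq 0) gq) => r [r0 qr].
  have [Br hBr] := shift_ex qr; have eb := hb r Br qr hBr.
  have hc' := shiftZ HX bW Hs (invr_neq0 r0) qr hBr.
  rewrite scalerDr scalerA mulVf // scale1r addrC in hc'.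
  have qr' : T e1 (v' + r^-1 *: v) (v' + r^-1 *: v) != 0.
    have -> : v' + r^-1 *: v = r^-1 *: (v + r *: v').
      by rewrite scalerDr scalerA mulVf // scale1r addrC.
    by rewrite !(triZ2 HT, triZ3 HT) !mulf_neq0 ?invr_neq0.
  have ec := hc _ _ qr' hc'.
  have : (b0.[r] - r * c0.[r^-1]) *: e0 + (b1.[r] - r * c1.[r^-1]) *: e1 = 0.
    rewrite !scalerBl addrACA -opprD -!scalerA -scalerDr -ec scalerA divff // scale1r.
    by rewrite -eb subrr.
  by case/(pb_free bW) => /eqP + /eqP; rewrite !subr_eq0 => /eqP-> /eqP->.
have r0 := reciprocal_linear (generically_imp (fun t => @proj1 _ _) rec).
have r1 := reciprocal_linear (generically_imp (fun t => @proj2 _ _) rec).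
have eB : B = b0.[0] *: e0 + b1.[0] *: e1 by apply: hb; rewrite scale0r addr0.
have eB' : B' = c0.[0] *: e0 + c1.[0] *: e1 by apply: hc; rewrite scale0r addr0.
rewrite (hb t B'' qt hB'') r0 r1 eB eB' scalerDr !scalerA !scalerDl.
by rewrite addrACA.
Qed.

(** Additivity along lines is used twice: in the plane of d1 and d2, where the
  discriminant does not vanish, and then along d3. The form R collects the
  conditions under which both steps apply. *)
Lemma shift_linear : exists N : 'M[k]_5, exists d R,
  [/\ forall w, w \in W -> N *m w = 0, forall y, N *m y \in W,
      formfun d R /\ (exists v, R v != 0),
      forall w v, w \in W -> R (w + v) = R v &
      forall v, R v != 0 -> T e1 v v != 0 /\ shift v (N *m v)].
Proof.
have [a [b [c [[aa bb ab ac bc] [aW bW' cW]]]]] := full_decomposition char0 HX bW D0.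
set ka := T e1 a b in ab.
have ba : T e1 b a = ka by rewrite (tri23 HT).
have ca : T e1 c a = 0 by rewrite (tri23 HT).
have cb : T e1 c b = 0 by rewrite (tri23 HT).
have [ga gaE gac] := separating_form cW.
have gaW w : w \in W -> lform ga w = 0.
  by move=> wW; apply: gaE; rewrite (subvP (addvSl _ _)) // (subvP (addvSl _ _)).
have gaa : lform ga a = 0.
  by apply: gaE; rewrite (subvP (addvSl _ _)) // (subvP (addvSr _ _)) ?memv_line.
have gab : lform ga b = 0 by apply: gaE; rewrite (subvP (addvSr _ _)) ?memv_line.
have [al hal] : exists xi, forall y, lform xi y = T e1 y b / ka.
  by apply: lform_of => [y z|r y]; rewrite !TE ?mulrDl ?mulrA.
have [be hbe] : exists xi, forall y, lform xi y = T e1 y a / ka.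
  by apply: lform_of => [y z|r y]; rewrite !TE ?mulrDl ?mulrA.
have full : (W + <[a]> + <[b]> + <[c]>)%VS = fullv.
  by apply/eqP; rewrite eqEdim subvf dimvf /dim /= !dim_add_vector // (dl_dim HX).
have dec y : exists2 w, w \in W &
    y = w + lform al y *: a + lform be y *: b + lform ga y *: c.
  have : y \in (W + <[a]> + <[b]> + <[c]>)%VS by rewrite full memvf.
  case/mem_add_vector => _ /mem_add_vector[_ /mem_add_vector[w wW [r ->]] [r' ->]] [r'' ->].
  exists w => //; rewrite !hal !hbe !(lformD, lformZ) gaW // gaa gab gac.
  have T0 z : T e1 w z = 0 by apply: (dl_sing HX).
  rewrite !TE !T0 aa bb ba ca cb -/ka !(mulr0, addr0, add0r, mulr1) !mulfK //.
(* The choice of tau makes T e1 d3 d3 nonzero. *)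
have [tau qd3] : exists tau, T e1 c c + 2%:R * tau ^+ 2 * ka != 0.
  have [cc0|cc0] := eqVneq (T e1 c c) 0; last by exists 0; rewrite expr0n mulr0 mul0r addr0.
  by exists 1; rewrite cc0 expr1n mulr1 add0r mulf_neq0.
pose d1 := a + b; pose d2 := a + 2%:R *: b; pose d3 := c + tau *: (a + b).
have qd1 : T e1 d1 d1 = 2%:R * ka by rewrite /d1 !TE aa bb ba -/ka; ring.
have qd2 : T e1 d2 d2 = 2%:R * (2%:R * ka) by rewrite /d2 !TE aa bb ba -/ka; ring.
have qd12 : T e1 d1 d2 = 3%:R * ka by rewrite /d1 /d2 !TE aa bb ba -/ka; ring.
have {qd3}qd3 : T e1 d3 d3 != 0.
  apply: contra qd3 => /eqP h; apply/eqP; rewrite -h /d3 !TE aa bb ba ca cb ac bc -/ka; ring.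
have nd1 : T e1 d1 d1 != 0 by rewrite qd1 mulf_neq0.
have nd2 : T e1 d2 d2 != 0 by rewrite qd2 !mulf_neq0.
have [B1 hB1] := shift_ex nd1; have [B2 hB2] := shift_ex nd2; have [B3 hB3] := shift_ex qd3.
have D12 : disc (T e1) d1 d2 != 0.
  have -> : disc (T e1) d1 d2 = ka ^+ 2 by rewrite /disc qd1 qd2 qd12; ring.
  by rewrite expf_neq0.
pose x2 := be - al; pose x1 := al - x2 - tau *: ga.
have x2E y : lform x2 y = lform be y - lform al y by rewrite /x2 /lform mulmxBl !mxE.
have x1E y : lform x1 y = lform al y - lform x2 y - tau * lform ga y.
  by rewrite /x1 /lform !mulmxBl -scalemxAl !mxE.
pose z y := lform x1 y *: d1 + lform x2 y *: d2.
have decz y : exists2 w, w \in W & y = w + (z y + lform ga y *: d3).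
  have [w wW ey] := dec y; exists w => //; rewrite {1}ey /z x1E x2E /d1 /d2 /d3.
  by apply/matrixP => i j; rewrite !mxE; ring.
pose N := B1 *m x1 + B2 *m x2 + B3 *m ga.
have NE y : N *m y = lform x1 y *: B1 + lform x2 y *: B2 + lform ga y *: B3.
  rewrite /N !mulmxDl -!mulmxA; congr (_ + _ + _); apply/matrixP => i j;
    by rewrite (ord1 j) !mxE big_ord1 mulrC.
have xW w : w \in W -> [/\ lform x1 w = 0, lform x2 w = 0 & lform ga w = 0].
  move=> wW; rewrite x1E x2E hal hbe gaW // !(dl_sing HX _ e1W wW).
  by rewrite !mul0r !subr0 mulr0 subr0.
pose q y := T e1 y y.
pose R y := (lform x1 y * q (z y)) * (disc (T e1) (z y) d3 * q y).
have fz : formmap 1 z.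
  have h xi B : formmap 1 (fun y => lform xi y *: B).
    exact: (formmapZ (formfun_lform xi) (formmap_cst _ B)).
  exact: formmapD.
have fq : formfun 2 q by exact: (formfun_tri HT (formmap_cst 4 e1) (@formmap_id k _) (@formmap_id k _)).
have fqz : formfun 2 (fun y => q (z y)).
  exact: (formfun_tri HT (formmap_cst 4 e1) fz fz).
have fdisc : formfun 2 (fun y => disc (T e1) (z y) d3).
  apply: formfunB.
    have h : formfun 1 (fun y => T e1 (z y) d3).
      exact: (formfun_tri HT (formmap_cst 4 e1) fz (formmap_cst 4 d3)).
    by apply: formfun_eq (formfunM h h) => y; rewrite expr2.
  exact: (formfunM fqz (formfunC 4 (T e1 d3 d3))).
have zW w v : w \in W -> z (w + v) = z v.
  by move=> wW; have [h1 h2 h3] := xW w wW; rewrite /z !lformD h1 h2 !add0r.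
have qW w v : w \in W -> q (w + v) = q v.
  move=> wW; rewrite /q !TE (tri23 HT e1 v w) !(dl_sing HX _ e1W wW).
  by rewrite !add0r.
exists N, (1 + 2 + (2 + 2))%N, R; split.
- by move=> w /xW[h1 h2 h3]; rewrite NE h1 h2 h3 !scale0r !addr0.
- by move=> y; rewrite NE !memvD ?memvZ //; [case: hB1|case: hB2|case: hB3].
- split.
    by apply: formfunM; apply: formfunM => //; apply: formfun_lform.
  apply: (formfun_common_nonzero (formfunM (formfun_lform x1) fqz) (formfunM fdisc fq)).
    have ed1 : z d1 = d1 /\ lform x1 d1 = 1.
      have [h1 h2] : lform x1 d1 = 1 /\ lform x2 d1 = 0.
        rewrite x1E x2E hal hbe /d1 !TE aa bb ba !lformD gaa gab -/ka.
        by rewrite !(add0r, addr0) divff // subrr mulr0 !subr0.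
      by rewrite /z h1 h2 scale1r scale0r addr0.
    by exists d1; rewrite ed1.1 ed1.2 mul1r.
  apply: (formfun_common_nonzero fdisc fq); last by exists d1.
  exists (a - b).
  have ex1 : lform x1 (a - b) = 3%:R.
    rewrite x1E x2E hal hbe !lformB gaa gab !(triD2 HT) -scaleN1r !(triZ2 HT) aa bb ba -/ka.
    by field.
  have ex2 : lform x2 (a - b) = - 2%:R.
    rewrite x2E hal hbe !(triD2 HT) -scaleN1r !(triZ2 HT) aa bb ba -/ka.
    by field.
  have ez : z (a - b) = a - b.
    by rewrite /z ex1 ex2 /d1 /d2; apply/matrixP => i j; rewrite !mxE; ring.
  have -> : disc (T e1) (z (a - b)) d3 = 2%:R * ka * T e1 d3 d3.
    rewrite ez /disc; set Q := T e1 d3 d3.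
    have -> : T e1 (a - b) d3 = 0.
      rewrite /d3 -scaleN1r !TE aa bb ba ac bc -/ka; ring.
    have -> : T e1 (a - b) (a - b) = - 2%:R * ka.
      rewrite -scaleN1r !TE aa bb ba -/ka; ring.
    ring.
  by rewrite !mulf_neq0.
- by move=> w v wW; have [h1 h2 h3] := xW w wW; rewrite /R zW // qW // lformD h1 add0r.
move=> v; rewrite !mulf_eq0 !negb_or => /andP[/andP[x10 qz0] /andP[Dz qv]].
split=> //.
have [w wW ev] := decz v.
have [Bz hBz] := shift_ex qz0.
have ez : z v = lform x1 v *: (d1 + (lform x2 v / lform x1 v) *: d2).
  by rewrite scalerDr scalerA mulrCA divff // mulr1.
have eBz : Bz = lform x1 v *: B1 + lform x2 v *: B2.
  have qn : T e1 (d1 + (lform x2 v / lform x1 v) *: d2) (d1 + (lform x2 v / lform x1 v) *: d2) != 0.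
    by apply: contra qz0 => /eqP h; rewrite /q ez !(triZ2 HT, triZ3 HT) h !mulr0.
  have [Bn hBn] := shift_ex qn.
  have := shiftZ HX bW Hs x10 qn hBn; rewrite -ez => h.
  rewrite (shift_uniq char0 HX bW Hs uM qz0 hBz h) (shift_add D12 nd1 nd2 qn hB1 hB2 hBn).
  by rewrite scalerDr scalerA mulrCA divff // mulr1.
have qn : T e1 (z v + lform ga v *: d3) (z v + lform ga v *: d3) != 0.
  by have := qv; rewrite {1}ev qW.
have [B hB] := shift_ex qn.
have eB := shift_add Dz qz0 qd3 qn hBz hB3 hB.
have := shiftW wW hB; rewrite -ev.
by rewrite eB eBz NE.
Qed.

(** Let N be the linear shift. The matrix M (1 + N) represents the automorphism at
  the points of X where R does not vanish, hence everywhere as X is irreducible;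
  it is invertible since N has square zero. *)
Lemma linear_from_shift : exists M1 : 'M[k]_5,
  [/\ M1 \in unitmx, forall v, v != 0 -> T v v v = 0 -> collinear (M1 *m v) (s v) &
      forall w, w \in W -> M1 *m w = M *m w].
Proof.
have [N [d [R [NW NV [fR [u Ru]] RW hN]]]] := shift_linear.
have NN y : N *m (N *m y) = 0 by apply: NW.
exists (M *m (1%:M + N)); split.
- rewrite unitmx_mul uM /=; have : (1%:M + N) *m (1%:M - N) = 1%:M.
    rewrite mulmxDl mul1mx mulmxBr mulmx1.
    have -> : N *m N = 0.
      apply/matrixP => i j; have := congr1 (fun y : V => y i 0) (NN (delta_mx j 0)).
      by rewrite mulmxA -colE !mxE.
    by rewrite subr0 subrK.
  by case/mulmx1_unit.
- move=> v v0' fv; have [e [H [hH Hv]]] := lift_exists Hs v0' fv.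
  apply: collinear_trans Hv _ (lift_collinear hH v0' fv) => i j.
  set M1 := M *m _; pose minor w := (M1 *m w) i 0 * forms_eval H w j 0 -
    (M1 *m w) j 0 * forms_eval H w i 0.
  have fH l : formfun e (fun w => forms_eval H w l 0).
    by exists (H l); [apply: lift_homog hH l | move=> w; rewrite mxE].
  have fminor : formfun (1 + e) minor.
    by apply: formfunB; apply: formfunM (fH _); apply: formfun_mulmx.
  have := dl_irr HX fR fminor _ => /(_ _)[w fw||/(_ v fv)/eqP].
  - have [->|Rw] := eqVneq (R w) 0; first by rewrite mul0r.
    have [qw [_ hw]] := hN w Rw.
    have w0' : w != 0 by apply: contraNneq qw => ->; rewrite -(scale0r (0 : V)) !TE !mul0r.
    have := hw 0 (mem0v W); rewrite !add0r => /(_ fw).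
    have -> : M *m (N *m w + w) = M1 *m w by rewrite -mulmxA mulmxDl mul1mx addrC.
    move=> h1; have := collinear_trans (reg_neq0 Hs w0' fw) h1
      (collinear_sym (lift_collinear hH w0' fw)).
    by move=> h2; rewrite /minor (h2 i j) subrr mulr0.
  - move=> h; have [qu _] := hN u Ru; case/eqP: Ru.
    have xW : - (T u u u / (3%:R * T e1 u u)) *: e1 \in W by rewrite memvZ.
    rewrite -(RW _ u xW); apply: h.
    by rewrite (sing_cube HX) // !TE; field; apply/andP.
  by rewrite subr_eq0 => /eqP.
by move=> w wW; rewrite -mulmxA mulmxDl mul1mx NW // addr0.
Qed.
End Linear.

(** The matrix is assembled from the image of the double line, the normal derivative
  along it, and the shift on residual lines. *)
Theorem automorphism_linear (k : closedFieldType) (char0 : [pchar k] =i pred0)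
    (T : 'cV[k]_5 -> 'cV[k]_5 -> 'cV[k]_5 -> k) (W : {vspace 'cV[k]_5}) s s' :
  double_line_cubic T W -> regular_map T s -> regular_map T s' ->
  (forall v, v != 0 -> T v v v = 0 -> collinear (s' (s v)) v) ->
  exists M : 'M[k]_5,
  [/\ M \in unitmx, forall v, v != 0 -> T v v v = 0 -> collinear (M *m v) (s v) &
      forall w w' x, w \in W -> w' \in W -> T (M *m w) (M *m w') x = 0].
Proof.
move=> HX Hs Hs' ss'; have [e1 [v0 [w0 [e1W D0]]]] := exists_rank2 HX.
have e10 : e1 != 0.
  apply: contraNneq D0 => ->.
  by rewrite /disc -(scale0r 0) !(triE (dl_tri HX)) !mul0r expr0n subrr.
have [e0 bW] := plane_basis_complete (dl_dim HX) e1W e10.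
have [l0 [l1 [lfree lcol lsing]]] := double_line_image char0 HX Hs Hs' ss' bW D0.
have [M [uM Ml MW Mlift]] := linear_model char0 HX bW D0 Hs Hs' ss' lfree lcol.
have M_neq0 (v : 'cV_5) : v != 0 -> M *m v != 0.
  by apply: contraNneq => /(unitmx_eq0 uM) ->.
have LW : linear_on s W by exists M => v vW v0'; split; [apply: M_neq0 | apply: MW].
have res u := linear_on_residual char0 HX bW D0 Hs LW (u := u).
have sh u := shift_exists char0 HX bW Hs uM MW Mlift res (u := u).
have [M1 [uM1 M1s M1W]] := linear_from_shift char0 HX bW D0 Hs Hs' ss' uM MW sh.
exists M1; split=> // w w' x wW w'W; rewrite !M1W //.
have inl w2 : w2 \in W -> M *m w2 \in (<[l0]> + <[l1]>)%VS.
  move=> /(pb_span bW)[c [r ->]]; rewrite Ml.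
  by rewrite memv_add ?memvZ ?memv_line.
by apply: lsing; apply: inl.
Qed.

(** * Finite groups of linear automorphisms *)
(** Coordinates on k^(r+m) adapted to the column space of B. *)
Lemma complement (k : fieldType) r m (B : 'M[k]_(r + m, r)) :
  (forall x : 'cV_r, B *m x = 0 -> x = 0) ->
  exists (Pi : 'M_(m, r + m)) (S : 'M_(r + m, m)) (X : 'M_(r, r + m)),
    [/\ Pi *m S = 1%:M, Pi *m B = 0, X *m B = 1%:M & S *m Pi + B *m X = 1%:M].
Proof.
move=> injB; pose L := col_ebase B; pose U := row_ebase B.
have rB : \rank B = r.
  rewrite -mxrank_tr; apply/eqP; rewrite -/(row_free B^T) -kermx_eq0.
  apply/eqP/matrixP => i j; have := injB (row i (kermx B^T))^T.
  rewrite -[B in B *m _]trmxK -trmx_mul -row_mul mulmx_ker row0 trmx0 => /(_ erefl).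
  by move/(congr1 trmx); rewrite trmxK trmx0 => /matrixP/(_ 0 j); rewrite !mxE.
have eB : B = lsubmx L *m U.
  rewrite -{1}(mulmx_ebase B) rB pid_mx_col -/L -/U -[L in LHS]hsubmxK.
  by rewrite mul_row_col mulmx1 mulmx0 addr0.
have uL : L \in unitmx := col_ebase_unit B.
have uU : U \in unitmx := row_ebase_unit B.
have := mulVmx uL; have := mulmxV uL; set L' := invmx L => LL' L'L.
exists (dsubmx L'), (rsubmx L), (invmx U *m usubmx L').
have e1 : lsubmx L *m usubmx L' + rsubmx L *m dsubmx L' = 1%:M.
  by rewrite -mul_row_col hsubmxK vsubmxK.
move: L'L; rewrite -[L']vsubmxK -[L]hsubmxK mul_col_row scalar_mx_block.
case/eq_block_mx; rewrite !(vsubmxK, hsubmxK) => h1 h2 h3 h4; split=> //.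
- by rewrite eB mulmxA h3 mul0mx.
- by rewrite {1}eB -mulmxA (mulmxA (usubmx _)) h1 mul1mx mulVmx.
by rewrite {1}eB -mulmxA (mulmxA U) mulmxV // mul1mx addrC e1 scalar_mx_block.
Qed.

Section Scalar.
Variables (k : closedFieldType) (char0 : [pchar k] =i pred0).
Notation V := 'cV[k]_5.
Implicit Types (E : {vspace V}) (a b p u v w x y z : V).
Variables (T : V -> V -> V -> k) (W : {vspace V}).
Hypothesis HX : double_line_cubic T W.
Let HT := dl_tri HX.
Let TE := triE HT.
Let three0 : 3%:R != 0 :> k := natS_neq0 char0 2.

Lemma exists_plane_basis : exists e0 e1, plane_basis W e0 e1.
Proof.
have [e1 [v0 [w0 [e1W D0]]]] := exists_rank2 HX.
have e10 : e1 != 0.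
  by apply: contraNneq D0 => ->; rewrite /disc -(scale0r 0) !TE !mul0r expr0n subrr.
by have [e0 bW] := plane_basis_complete (dl_dim HX) e1W e10; exists e0, e1.
Qed.

Lemma plane_basis_neq0 e0 e1 : plane_basis W e0 e1 -> e1 != 0.
Proof.
move=> bW; apply/eqP => z; have := pb_free bW (c := 0) (d := 1).
by rewrite scale0r scale1r add0r => /(_ z)[_ /eqP]; rewrite oner_eq0.
Qed.

(** Join a point to one where R does not vanish. *)
Lemma eq_matrix_generic (N N' : 'M[k]_5) d R : formfun d R -> (exists v, R v != 0) ->
  (forall v, R v != 0 -> N *m v = N' *m v) -> N = N'.
Proof.
move=> hR [u Ru] h; suff hv v : N *m v = N' *m v.
  apply/matrixP => i j; have := congr1 (fun v : V => v i 0) (hv (delta_mx j 0)).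
  by rewrite -!colE !mxE.
apply/matrixP => i j; rewrite (ord1 j) {j}.
pose P t := u + t *: (v - u).
have pP : polypath P := polypath_line u (v - u).
have -> : v = P 1 by rewrite /P scale1r addrC subrK.
apply: (polyfun_ext (polypath_mulmx N pP i) (polypath_mulmx N' pP i)).
have gR : generically (fun t => R (P t) != 0).
  apply: polyfun_generic (polyfun_formfun hR pP) _.
  by exists 0; rewrite /P scale0r addr0.
by apply: generically_imp gR => t /h ->.
Qed.

(** A linear map that induces the identity of X is scalar: X spans the space, and
  contains a line through a general point that meets the double line. *)
Lemma scalar_of_collinear (N : 'M[k]_5) :
  (forall v, v != 0 -> T v v v = 0 -> collinear (N *m v) v) ->
  exists c, N = c%:M.
Proof.
move=> hN; have [e0 [e1 bW]] := exists_plane_basis.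
have e0W := pb_mem1 bW; have e1W := pb_mem2 bW; have e10 := plane_basis_neq0 bW.
have Ncol v : v != 0 -> T v v v = 0 -> exists c : k, N *m v = c *: v.
  by move=> v0 fv; apply/collinearP => //; apply: hN.
have NW w : w \in W -> exists c : k, N *m w = c *: w.
  move=> wW; have [->|w0] := eqVneq w 0; first by exists 0; rewrite mulmx0 scaler0.
  by apply: Ncol => //; apply: (dl_sing HX).
have [c0 ec0] := NW _ e0W; have [c ec] := NW _ e1W.
have cc : c0 = c.
  have [c' ec'] := NW _ (memvD e0W e1W).
  have : (c0 - c') *: e0 + (c - c') *: e1 = 0.
    by rewrite !scalerBl addrACA -opprD -scalerDr -ec' -ec0 -ec mulmxDr subrr.
  by case/(pb_free bW) => /eqP + /eqP; rewrite !subr_eq0 => /eqP-> /eqP->.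
have {c0 ec0 cc NW}NW w : w \in W -> N *m w = c *: w.
  move=> /(pb_span bW)[x [r ->]].
  by rewrite mulmxDr -!scalemxAr ec0 ec cc scalerDr !scalerA ![c * _]mulrC.
have [u qu] := dl_cone HX e10.
have fq : formfun 2 (fun y : V => T e1 y y).
  exact: (formfun_tri HT (formmap_cst 4 e1) (@formmap_id k _) (@formmap_id k _)).
exists c; apply: (eq_matrix_generic fq (ex_intro _ u qu)) => y qy.
rewrite mul_scalar_mx.
pose x := - (T y y y / (3%:R * T e1 y y)) *: e1.
have xW : x \in W by rewrite memvZ.
have yW : y \notin W by apply: contra qy => yW; rewrite (dl_sing HX).
have fv : T (x + y) (x + y) (x + y) = 0.
  by rewrite (sing_cube HX) // /x !TE; field; apply/andP.
clearbody x.
have nW w : w \in W -> w + (x + y) \notin W.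
  move=> wW; apply: contra yW => h; rewrite -[y](addKr x) -[x + y](addKr w).
  by rewrite memvD ?memvN // memvD ?memvN.
have nz v : v \notin W -> v != 0 by apply: contraNneq => ->; rewrite mem0v.
have xyW : x + y \notin W by rewrite -[x + y]add0r nW ?mem0v.
pose p := T e1 y y *: e0 + (- T e0 y y) *: e1.
have pW : p \in W by apply: (pb_mem bW).
have Txyp w : w \in W -> T w (x + y) (x + y) = T w y y.
  by move=> wW; rewrite !TE (tri23 HT w y x) !(dl_sing HX _ wW xW) !add0r.
have fp : T (p + (x + y)) (p + (x + y)) (p + (x + y)) = 0.
  by rewrite (sing_cube HX) // fv Txyp // /p !TE; ring.
have [a ea] := Ncol _ (nz _ xyW) fv.
have [b eb] := Ncol _ (nz _ (nW _ pW)) fp.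
have p0 : p != 0.
  by apply/eqP => /(pb_free bW)[/eqP]; rewrite (negPf qy).
have h : (c - b) *: p = (b - a) *: (x + y).
  have e : c *: p + a *: (x + y) = b *: p + b *: (x + y).
    by rewrite -ea -(NW _ pW) -mulmxDr eb scalerDr.
  by apply/eqP; rewrite !scalerBl subr_eq addrAC [_ + b *: p]addrC -e addrK.
have ab : b = a.
  apply/eqP; rewrite -subr_eq0; apply: contraNT xyW => ba.
  by rewrite -[x + y]scale1r -(mulVf ba) -scalerA -h !memvZ.
have cb : c = b.
  move/eqP: h; rewrite ab subrr scale0r scaler_eq0 (negPf p0) orbF -ab subr_eq0.
  by move/eqP.
apply: (addrI (c *: x)); rewrite -{1}(NW _ xW) -mulmxDr ea -ab -cb.
by rewrite -scalerDr.
Qed.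

End Scalar.

(** Matrices that represent the elements of a group of automorphisms of X. They are
  determined up to scalars only, so they form a projective representation. *)
Record linear_group (k : closedFieldType) (gT : finGroupType)
    (T : 'cV[k]_5 -> 'cV[k]_5 -> 'cV[k]_5 -> k) (W : {vspace 'cV[k]_5})
    (M : gT -> 'M[k]_5) : Prop := LinearGroup {
  lg_unit : forall g, M g \in unitmx;
  lg_mul : forall g h, exists c, M g *m M h = c *: M (g * h)%g;
  lg_cubic : forall g v, T v v v = 0 -> T (M g *m v) (M g *m v) (M g *m v) = 0;
  lg_sing : forall g w w' x, w \in W -> w' \in W -> T (M g *m w) (M g *m w') x = 0 }.

Section LinearGroup.
Variables (k : closedFieldType) (char0 : [pchar k] =i pred0).
Notation V := 'cV[k]_5.
Implicit Types (E : {vspace V}) (a b p u v w x y z : V).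
Variables (T : V -> V -> V -> k) (W : {vspace V}).
Hypothesis HX : double_line_cubic T W.
Let HT := dl_tri HX.
Let TE := triE HT.
Variables (gT : finGroupType) (M : gT -> 'M[k]_5).
Hypothesis HM : linear_group T W M.
Implicit Types (g h : gT).

Lemma lg_neq0 g v : v != 0 -> M g *m v != 0.
Proof. by apply: contraNneq => /(unitmx_eq0 (lg_unit HM g)) ->. Qed.

Lemma lg_mul_neq0 g h : exists2 c, c != 0 & M g *m M h = c *: M (g * h)%g.
Proof.
have [c ec] := lg_mul HM g h; exists c => //; apply/eqP => c0.
have u : M g *m M h \in unitmx by rewrite unitmx_mul !(lg_unit HM).
have v0 : (const_mx 1 : V) != 0.
  by apply/eqP => /matrixP/(_ 0 0)/eqP; rewrite !mxE oner_eq0.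
by case/eqP: v0; apply: (unitmx_eq0 u); rewrite ec c0 scale0r mul0mx.
Qed.

Lemma lg_one : exists2 c, c != 0 & M 1%g = c%:M.
Proof.
have [c c0] := lg_mul_neq0 1 1; rewrite mulg1 => ec; exists c => //.
have := congr1 (mulmx (invmx (M 1%g))) ec.
by rewrite mulKmx ?(lg_unit HM) // -scalemxAr mulVmx ?(lg_unit HM) // scalemx1.
Qed.

Lemma lg_mulV g : exists2 c, c != 0 & M g^-1%g *m M g = c%:M.
Proof.
have [c c0 ec] := lg_mul_neq0 g^-1%g g; have [d d0 ed] := lg_one.
by exists (c * d); rewrite ?mulf_neq0 // ec mulVg ed scale_scalar_mx.
Qed.

Lemma lg_cubic_iff g v : T (M g *m v) (M g *m v) (M g *m v) = 0 -> T v v v = 0.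
Proof.
move/(lg_cubic HM g^-1%g); rewrite !mulmxA; have [c c0 ->] := lg_mulV g.
rewrite !mul_scalar_mx !TE => /(mulf_cancel0 c0)/(mulf_cancel0 c0).
exact: mulf_cancel0.
Qed.

Lemma lg_free g a b : plane_basis W a b -> forall c r : k,
  c *: (M g *m a) + r *: (M g *m b) = 0 -> c = 0 /\ r = 0.
Proof.
move=> bW c r; rewrite !scalemxAr -mulmxDr => /(unitmx_eq0 (lg_unit HM g)).
exact: (pb_free bW).
Qed.

(** The image of the double line under an element of the group that does not
  preserve it is a line of singular points; it has to meet the double line. *)
Lemma moved_line g w : w \in W -> M g *m w \notin W ->
  exists n w1 w2, [/\ n \in W, n != 0, w1 \in W & n = M g *m w1] /\
    [/\ w2 \in W, M g *m w2 \notin W, forall x, T n (M g *m w2) x = 0 &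
        forall x, x \in W -> (forall v, T x (M g *m w2) v = 0) -> x \in <[n]>%VS].
Proof.
move=> wW Mw; have [a [b bW]] := exists_plane_basis HX.
have aW := pb_mem1 bW; have bbW := pb_mem2 bW.
pose L t := M g *m a + t *: (M g *m b).
have LE t : L t = M g *m (a + t *: b) by rewrite /L mulmxDr scalemxAr.
have inW t : a + t *: b \in W by rewrite memvD ?memvZ.
have Ls t v : T (L t) (L t) v = 0 by rewrite LE (lg_sing HM).
have [LW|[s1 [n [z1 nW nz [nker Ln]]]]] := singular_path char0 HX (polypath_line _ _) Ls.
  case/negP: Mw; have [c [r ->]] := pb_span bW wW.
  have aW' : M g *m a \in W by have := LW 0; rewrite scale0r addr0.
  have bW' : M g *m b \in W.
    by rewrite -[M g *m b](addKr (M g *m a)) memvD ?memvN // -[M g *m b]scale1r LW.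
  by rewrite mulmxDr -!scalemxAr memvD ?memvZ.
have n0 : n != 0.
  apply/eqP => n0; have L1 t : exists c, L t = c *: L s1.
    have : L t \in (<[n]> + <[L s1]>)%VS := Ln t; rewrite n0 => /mem_add_vector[_ /vlineP[c ->] [r ->]].
    by exists r; rewrite scaler0 add0r.
  have [c0 e0] := L1 s1; have [c1 e1] := L1 (s1 + 1).
  have [] := lg_free (g := g) bW (c := 1 - c1) (r := s1 + 1 - c1 * s1).
    move: e1; rewrite /L scalerDr scalerA => /eqP; rewrite -subr_eq0 => /eqP e1.
    rewrite -[RHS]e1 !scalerBl scale1r; move: (M g *m a) (M g *m b) => u v.
    by apply/matrixP => i j; rewrite !mxE; ring.
  move/eqP; rewrite subr_eq0 => /eqP <-; rewrite mul1r addrAC subrr add0r.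
  by move/eqP; rewrite oner_eq0.
have [t [c [r [c0 eL]]]] : exists t c r, c != 0 /\ L t = c *: n + r *: L s1.
  have dec t : exists c r, L t = c *: n + r *: L s1.
    have : L t \in (<[n]> + <[L s1]>)%VS := Ln t.
    by case/mem_add_vector => _ /vlineP[c ->] [r ->]; exists c, r.
  have [c [r e1]] := dec (s1 + 1).
  have [c0|c0] := eqVneq c 0; last by exists (s1 + 1), c, r.
  have [] := lg_free (g := g) bW (c := 1 - r) (r := s1 + 1 - r * s1).
    move: e1; rewrite c0 scale0r add0r /L scalerDr scalerA => /eqP.
    rewrite -subr_eq0 => /eqP e1.
    rewrite -[RHS]e1 !scalerBl scale1r; move: (M g *m a) (M g *m b) => u v.
    by apply/matrixP => i j; rewrite !mxE; ring.
  move/eqP; rewrite subr_eq0 => /eqP <-; rewrite mul1r addrAC subrr add0r.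
  by move/eqP; rewrite oner_eq0.
exists n, (c^-1 *: (a + t *: b - r *: (a + s1 *: b))), (a + s1 *: b); split.
  split=> //; first by rewrite memvZ // memvB // memvZ.
  rewrite -scalemxAr mulmxBr -scalemxAr -!LE eL addrK scalerA mulVf // scale1r.
  by [].
by rewrite -LE; split.
Qed.

(** If z1 and z2 are dependent modulo W, then n1 and n2 satisfy the same equations.
  Otherwise n1 and n2 would span W if they differed, and then X would contain
  the hyperplane spanned by W, z1 and z2. *)
Lemma moved_lines_meet z1 z2 n1 n2 : z1 \notin W -> z2 \notin W ->
  (forall x, T z1 z1 x = 0) -> (forall x, T z2 z2 x = 0) ->
  n1 \in W -> n2 \in W -> n1 != 0 -> n2 != 0 ->
  (forall x, T n1 z1 x = 0) -> (forall x, T n2 z2 x = 0) ->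
  (forall x, x \in W -> (forall v, T x z1 v = 0) -> x \in <[n1]>%VS) ->
  n2 \in <[n1]>%VS.
Proof.
move=> z1W z2W s1 s2 n1W n2W n10 n20 k1 k2 ker1.
have [/mem_add_vector[w wW [r e2]]|z2E] := boolP (z2 \in (W + <[z1]>)%VS).
  have r0 : r != 0.
    by apply: contraNneq z2W => r0; rewrite e2 r0 scale0r addr0.
  apply: ker1 => // v; have := k2 v; rewrite e2 !TE (dl_sing HX) // add0r.
  exact: mulf_cancel0.
apply: contraT => n12; have bW := plane_basis_pair (dl_dim HX) n2W n1W n10 n12.
have T0 w : w \in W -> T w z1 z2 = 0.
  move=> /(pb_span bW)[c [r ->]].
  by rewrite !TE k1 (tri23 HT) k2 !mulr0 addr0.
case: (@no_hyperplane _ char0 _ _ HX (W + <[z1]> + <[z2]>)%VS).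
  by rewrite !dim_add_vector // (dl_dim HX).
move=> _ /mem_add_vector[_ /mem_add_vector[w wW [a ->]] [b ->]].
have w11 := s1 w; have w22 := s2 w; rewrite (tri_rot HT) (tri_rot HT) in w11.
rewrite (tri_rot HT) (tri_rot HT) in w22.
rewrite -addrA (sing_cube HX) // !TE (tri23 HT w z2 z1) T0 // w11 w22.
rewrite (tri23 HT z1 z2 z1) (tri_rot HT z2 z1 z1) (tri_rot HT z1 z2 z2).
rewrite (tri23 HT z2 z1 z2).
by rewrite !s1 !s2 !(mulr0, addr0) //.
Qed.

(** If the double line is moved, its images all pass through one of its points p,
  which is then fixed: p is the intersection of all images. *)
Lemma fixed_or_invariant :
  (exists p, [/\ p \in W, p != 0 & forall g, exists c : k, M g *m p = c *: p]) \/
  (forall g w, w \in W -> M g *m w \in W).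
Proof.
have [inv|] := classic (forall g w, w \in W -> M g *m w \in W); first by right.
move=> no; left; have [g0 [w0 [w0W Mw0]]] : exists g0 w0, w0 \in W /\ M g0 *m w0 \notin W.
  apply: NNPP => no2; apply: no => g w wW; apply: contraT => Mw.
  by case: no2; exists g, w.
have [p [w1 [w2 [[pW p0 w1W ep] [w2W Mw2 kp kerp]]]]] := moved_line w0W Mw0.
exists p; split=> // h.
have onall g : exists2 w, w \in W & p = M g *m w.
  have [gW|] := classic (forall w, w \in W -> M g *m w \in W); last first.
    move=> ngW; have [w [wW Mw]] : exists w, w \in W /\ M g *m w \notin W.
      by apply: NNPP => no2; apply: ngW => w wW; apply: contraT => Mw; case: no2; exists w.
    have [n [x1 [x2 [[nW n0 x1W en] [x2W Mx2 kn kern]]]]] := moved_line wW Mw.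
    have s1 x := lg_sing HM g0 x w2W w2W; have s2 x := lg_sing HM g x x2W x2W.
    have /vlineP[c ec] := moved_lines_meet Mx2 Mw2 s2 s1 nW pW n0 p0 kn kp kern.
    by exists (c *: x1); rewrite ?memvZ // -scalemxAr -en ec.
  have [a [b bW]] := exists_plane_basis HX.
  have bW' : plane_basis W (M g *m a) (M g *m b).
    have nb : M g *m b != 0 by rewrite lg_neq0 // (plane_basis_neq0 bW).
    apply: (plane_basis_pair (dl_dim HX)) => //; try by rewrite gW ?(pb_mem1 bW) ?(pb_mem2 bW).
    apply/vlineP => -[c /eqP]; rewrite -subr_eq0 -scaleNr -[M g *m a]scale1r => /eqP.
    by case/(lg_free bW) => /eqP; rewrite oner_eq0.
  have [c [r ->]] := pb_span bW' pW; exists (c *: a + r *: b); first exact: (pb_mem bW).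
  by rewrite mulmxDr -!scalemxAr.
have [x1 x1W e1] := onall (h^-1)%g.
have [c1 _ ec1] := lg_mul_neq0 h h^-1%g; have [d _ ed] := lg_one.
have MpW : M h *m p \in W.
  by rewrite e1 mulmxA ec1 mulgV ed -scalemxAl mul_scalar_mx !memvZ.
have [x2 x2W e2] := onall (h^-1 * g0)%g.
have [c2 _ ec2] := lg_mul_neq0 h (h^-1 * g0)%g.
have Mp2 : exists2 w, w \in W & M h *m p = M g0 *m w.
  exists (c2 *: x2); first by rewrite memvZ.
  by rewrite e2 mulmxA ec2 mulKVg -scalemxAl -scalemxAr.
have [x3 x3W e3] := Mp2.
apply/vlineP; apply: contraT => Mpp.
have bW := plane_basis_pair (dl_dim HX) MpW pW p0 Mpp.
have bW3 : plane_basis W x3 w1.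
  have w10 : w1 != 0 by apply: contraNneq p0 => z; rewrite ep z mulmx0.
  apply: (plane_basis_pair (dl_dim HX)) => //; apply: contra Mpp => /vlineP[c ec].
  by rewrite e3 ec -scalemxAr -ep memvZ ?memv_line.
have [c [r ew]] := pb_span bW3 w0W.
by case/negP: Mw0; rewrite ew mulmxDr -!scalemxAr -e3 -ep (pb_mem bW).
Qed.

End LinearGroup.

(** * Projection from a fixed point *)
(** Forms that define mutually inverse rational maps between X and the projective
  space of a representation, defined where D and E do not vanish. *)
Record equivariant_forms (k : closedFieldType) (gT : finGroupType)
    (T : 'cV[k]_5 -> 'cV[k]_5 -> 'cV[k]_5 -> k) (M : gT -> 'M[k]_5)
    (rG : mx_representation k [set: gT] 4) (F : 'cV[k]_5 -> 'cV[k]_4)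
    (G : 'cV[k]_4 -> 'cV[k]_5) (D : 'cV[k]_5 -> k) (E : 'cV[k]_4 -> k) : Prop :=
  EquivariantForms {
  ef_F : exists2 d, (0 < d)%N & forall i, formfun d (fun v => F v i 0);
  ef_G : exists2 d, (0 < d)%N & forall i, formfun d (fun z => G z i 0);
  ef_D : exists d, formfun d D;
  ef_E : exists d, formfun d E;
  ef_GF : forall v, T v v v = 0 -> G (F v) = D v *: v;
  ef_cubic : forall z, T (G z) (G z) (G z) = 0;
  ef_FG : forall z, F (G z) = E z *: z;
  ef_E_neq0 : exists z, E z != 0;
  ef_equivariant : forall g v, collinear (F (M g *m v)) (rG g *m F v) }.

Lemma formmap_mulmx (k : closedFieldType) m n d l (A : 'M[k]_(l, m))
    (F : 'cV[k]_n.+1 -> 'cV[k]_m) :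
  (forall i, formfun d (fun v => F v i 0)) ->
  forall i, formfun d (fun v => (A *m F v) i 0).
Proof.
move=> hF i; apply: (@formfun_eq _ _ _ (fun v => \sum_j A i j * F v j 0)) => [v|].
  by rewrite mxE.
by apply: formfun_sum => j; apply: formfunZ.
Qed.

Section Projection.
Variables (k : closedFieldType) (char0 : [pchar k] =i pred0).
Notation V := 'cV[k]_5.
Implicit Types (a b p u v w x y : V).
Variables (T : V -> V -> V -> k) (W : {vspace V}).
Hypothesis HX : double_line_cubic T W.
Let HT := dl_tri HX.
Let TE := triE HT.
Let three0 : 3%:R != 0 :> k := natS_neq0 char0 2.
Variables (gT : finGroupType) (M : gT -> 'M[k]_5).
Hypothesis HM : linear_group T W M.
Implicit Types (g h : gT).

(** Projection from a fixed point of the double line. A line through this point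
  meets X in one further point, so the projection is birational; dividing the
  matrices by their eigenvalue at the point turns the projective action on the
  target into a linear one. *)
Lemma project_fixed_point p : p \in W -> p != 0 ->
  (forall g, exists c : k, M g *m p = c *: p) ->
  exists rG F G D E, @equivariant_forms k gT T M rG F G D E.
Proof.
move=> pW p0 fixp.
have injp (x : 'cV_1) : (p : 'M_(1 + 4, 1)) *m x = 0 -> x = 0.
  move=> px; apply/matrixP => i j; rewrite (ord1 i) (ord1 j) mxE.
  have [l pl] := cV_neq0 p0; apply: (mulf_cancel0 pl).
  by have := congr1 (fun v : V => v l 0) px; rewrite !mxE big_ord1.
have [Pi [S [X [PiS Pip Xp dec]]]] : exists (Pi : 'M[k]_(4, 5)) (S : 'M[k]_(5, 4))
    (X : 'M[k]_(1, 5)), [/\ Pi *m S = 1%:M, Pi *m p = 0, X *m p = 1%:M &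
      S *m Pi + p *m X = 1%:M] by apply: complement injp.
pose xi v := (X *m v) 0 0.
have xip : xi p = 1 by rewrite /xi Xp mxE eqxx.
have vdec v : v = S *m (Pi *m v) + xi v *: p.
  have e : p *m (X *m v) = xi v *: p.
    by apply/matrixP => i j; rewrite (ord1 j) !mxE big_ord1 mulrC.
  by rewrite -e !mulmxA -mulmxDl dec mul1mx.
have vlin (v : V) c : Pi *m (v + c *: p) = Pi *m v.
  by rewrite mulmxDr -scalemxAr Pip scaler0 addr0.
pose chi g := xi (M g *m p).
have echi g : M g *m p = chi g *: p.
  by have [c ec] := fixp g; rewrite /chi ec /xi -scalemxAr Xp !mxE eqxx mulr1.
have chi0 g : chi g != 0.
  by have := lg_neq0 HM g p0; rewrite echi scaler_eq0 negb_or => /andP[].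
have PiM g v : Pi *m (M g *m (S *m (Pi *m v))) = Pi *m (M g *m v).
  rewrite {2}[v]vdec mulmxDr -scalemxAr echi scalerA vlin //.
pose r g := (chi g)^-1 *: (Pi *m M g *m S).
have rE g (z : 'cV_4) : r g *m z = (chi g)^-1 *: (Pi *m (M g *m (S *m z))).
  by rewrite /r -scalemxAl -!mulmxA.
have rP : mx_repr [set: gT] r.
  split=> [|g h _ _].
    have [c c0 ec] := lg_one HM; rewrite /r.
    have -> : chi 1%g = c by rewrite /chi ec mul_scalar_mx /xi -scalemxAr Xp !mxE eqxx mulr1.
    by rewrite ec mul_mx_scalar -scalemxAl PiS scalerA mulVf // scale1r.
  have [c c0 ec] := lg_mul_neq0 HM g h.
  have echi2 : chi g * chi h = c * chi (g * h)%g.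
    have : M g *m (M h *m p) = c *: (M (g * h)%g *m p) by rewrite mulmxA ec -scalemxAl.
    rewrite !echi -scalemxAr echi !scalerA => /eqP; rewrite -subr_eq0 -scalerBl.
    by rewrite scaler_eq0 (negPf p0) orbF subr_eq0 mulrC => /eqP.
  apply/matrixP => i j; have rd (z : 'cV_4) : r (g * h)%g *m z = r g *m (r h *m z).
    rewrite !rE -!scalemxAr PiM scalerA (mulmxA (M g)) ec -!scalemxAl -scalemxAr scalerA.
    congr (_ *: _); have -> : chi (g * h)%g = c^-1 * (chi g * chi h) by rewrite echi2 mulKf.
    by field; rewrite c0 !chi0.
  have := congr1 (fun v : 'cV_4 => v i 0) (rd (delta_mx j 0)).
  by rewrite mulmxA -!colE !mxE.
pose q v := T p v v; pose C v := T v v v.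
pose G (z : 'cV[k]_4) := - C (S *m z) *: p + (3%:R * q (S *m z)) *: (S *m z).
have fS i : formfun 1 (fun z : 'cV[k]_4 => (S *m z) i 0) by apply: formfun_mulmx.
have qv v : q (S *m (Pi *m v)) = q v.
  rewrite /q {3 4}[v]vdec !TE (tri23 HT p _ p) !(dl_sing HX _ pW pW).
  by rewrite !(mulr0, addr0).
have fqS : formfun 2 (fun z : 'cV[k]_4 => q (S *m z)).
  exact: (formfun_tri HT (formmap_cst 3 p) fS fS).
have fC : formfun 3 (fun z : 'cV[k]_4 => C (S *m z)) by exact: (formfun_tri HT fS fS fS).
exists (MxRepresentation rP), (fun v => Pi *m v), G, (fun v => 3%:R * q v),
  (fun z => 3%:R * q (S *m z)); split.
- by exists 1%N => // i; apply: formfun_mulmx.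
- exists 3%N => // i; apply: (@formfun_eq _ _ 3 (fun z => - C (S *m z) * p i 0 +
     3%:R * q (S *m z) * (S *m z) i 0)) => [z|]; first by rewrite !mxE.
  apply: formfunD; first exact: (formfunM (formfunN fC) (formfunC _ _)).
  exact: (formfunM (formfunZ _ fqS) (fS i)).
- exists 2%N; apply: formfunZ.
  exact: (formfun_tri HT (formmap_cst 4 p) (@formmap_id k _) (@formmap_id k _)).
- by exists 2%N; apply: formfunZ.
- move=> v fv; rewrite /G qv; set u := S *m _.
  have ev : v = u + xi v *: p by apply: vdec.
  have eC : - C u = 3%:R * xi v * q v.
    move: fv; rewrite {1 2 3}ev addrC (sing_cube HX) ?memvZ // TE -/(C u) -/(q u) qv.
    by move=> h; apply/eqP; rewrite eq_sym -addr_eq0 -h; apply/eqP; ring.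
  rewrite eC [X in _ = _ *: X]ev scalerDr scalerA [LHS]addrC; congr (_ + _ *: _); ring.
- by move=> z; rewrite /G (sing_cube HX) ?memvZ // !TE -/(q _) -/(C _); ring.
- by move=> z; rewrite /G addrC vlin -scalemxAr mulmxA PiS mul1mx.
- have [y qy] := dl_cone HX p0; exists (Pi *m y).
  by rewrite qv mulf_neq0.
move=> g v; rewrite /= rE PiM; apply: collinear_sym.
exact/collinearZ/collinear_refl.
Qed.

End Projection.

(** * Averaging over the group when the double line is invariant *)
Lemma formfun_cancel (k : closedFieldType) n d e (g h : 'cV[k]_n.+1 -> k) :
  formfun d g -> formfun e h -> (exists v, g v != 0) ->
  (forall v, g v * h v = 0) -> forall v, h v = 0.
Proof.
move=> hg hh g0 gh v; apply/eqP; apply: contraT => hv.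
by have [u] := formfun_common_nonzero hg hh g0 (ex_intro _ v hv); rewrite gh eqxx.
Qed.

Lemma formfun_exp (k : closedFieldType) n d (g : 'cV[k]_n.+1 -> k) m :
  formfun d g -> exists e, formfun e (fun v => g v ^+ m).
Proof.
move=> hg; elim: m => [|m [e IH]].
  by exists 0%N; apply: formfun_eq (formfunC _ 1) => v; rewrite expr0.
by exists (d + e)%N; apply: formfun_eq (formfunM hg IH) => v; rewrite exprS.
Qed.

Lemma formfun_prod_neq0 (k : closedFieldType) n d (I : finType)
    (G : I -> 'cV[k]_n.+1 -> k) :
  (forall i, formfun d (G i)) -> (forall i, exists v, G i v != 0) ->
  exists v, \prod_i G i v != 0.
Proof.
move=> hG G0.
suff hs (r : seq I) : exists e, formfun e (fun v => \prod_(i <- r) G i v) /\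
    exists v, \prod_(i <- r) G i v != 0.
  by have [e [_ h]] := hs (index_enum I).
elim: r => [|i r [e [IH IH0]]].
  exists 0%N; split; first by apply: formfun_eq (formfunC _ 1) => v; rewrite big_nil.
  by exists 0; rewrite big_nil oner_neq0.
exists (d + e)%N; split.
  by apply: formfun_eq (formfunM (hG i) IH) => v; rewrite big_cons.
have [v hv] := formfun_common_nonzero (hG i) IH (G0 i) IH0.
by exists v; rewrite big_cons.
Qed.

Section Invariant.
Variables (k : closedFieldType) (char0 : [pchar k] =i pred0).
Notation V := 'cV[k]_5.
Implicit Types (a b p u v w x y : V).
Variables (T : V -> V -> V -> k) (W : {vspace V}).
Hypothesis HX : double_line_cubic T W.
Let HT := dl_tri HX.
Let TE := triE HT.
Let two0 : 2%:R != 0 :> k := natS_neq0 char0 1.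
Let three0 : 3%:R != 0 :> k := natS_neq0 char0 2.
Variables (e0 e1 v0 w0 : V).
Hypotheses (bW : plane_basis W e0 e1) (D0 : disc (T e1) v0 w0 != 0).
Variables (gT : finGroupType) (M : gT -> 'M[k]_5).
Hypothesis HM : linear_group T W M.
Hypothesis inv : forall g w, w \in W -> M g *m w \in W.
Implicit Types (g h : gT).
Notation P := (residual_point T e0 e1).

Let e0W : e0 \in W := pb_mem1 bW.
Let e1W : e1 \in W := pb_mem2 bW.

Let e1_neq0 : e1 != 0 := plane_basis_neq0 bW.

Let formq : formfun 2 (fun y : V => T e1 y y).
Proof.
exact: (formfun_tri HT (formmap_cst 4 e1) (@formmap_id k _) (@formmap_id k _)).
Qed.

(** The residual line of X in the plane over y has the direction x in W exactly when
  T x y y = 0, and the group permutes the residual lines. If the plane over y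
  contains no point of X off the double line, neither does the plane over M g y. *)
Lemma residual_transport g x y : x \in W -> T x y y = 0 ->
  T (M g *m x) (M g *m y) (M g *m y) = 0.
Proof.
move=> xW xy; have imc w : w \in W ->
    T (M g *m (w + y)) (M g *m (w + y)) (M g *m (w + y)) =
    3%:R * T (M g *m w) (M g *m y) (M g *m y) + T (M g *m y) (M g *m y) (M g *m y).
  by move=> wW; rewrite mulmxDr (sing_cube HX) // inv.
have [[w [wW fw]]|no] := classic (exists w, w \in W /\ T (w + y) (w + y) (w + y) = 0).
  have h1 := lg_cubic HM g fw; have xwW : x + w \in W by rewrite memvD.
  have fxw : T (x + w + y) (x + w + y) (x + w + y) = 0.
    by rewrite (sing_cube HX) // TE xy add0r -(sing_cube HX).
  have h2 := lg_cubic HM g fxw; rewrite imc // in h1; rewrite imc // mulmxDr TE in h2.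
  apply: (mulf_cancel0 three0); apply: (lin_comb2 h2 h1 (x := 1) (y := -1)); ring.
apply/eqP; apply: contraT => a0; case: no.
set a := T _ _ _ in a0; pose t := - T (M g *m y) (M g *m y) (M g *m y) / (3%:R * a).
exists (t *: x); split; first by rewrite memvZ.
apply: (lg_cubic_iff HX HM (g := g)); rewrite imc ?memvZ // -scalemxAr TE -/a /t.
by field; apply/andP.
Qed.

Lemma disc_nonzero_partner : exists v v', disc (T e1) v v' != 0 /\ T e1 v' v' != 0.
Proof.
have [b0|] := eqVneq (T e1 w0 w0) 0; last by exists v0, w0.
have [a0|a0] := eqVneq (T e1 v0 v0) 0; last first.
  by exists w0, v0; move: D0; rewrite /disc (tri23 HT e1 w0 v0) [_ v0 v0 * _]mulrC.
have c0 : T e1 v0 w0 != 0.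
  by apply: contraNneq D0 => c0; rewrite /disc c0 a0 mul0r expr0n subrr.
exists w0, (v0 + w0); split.
  have -> : disc (T e1) w0 (v0 + w0) = T e1 v0 w0 ^+ 2.
    by rewrite /disc !TE (tri23 HT e1 w0 v0) b0; ring.
  by rewrite expf_neq0.
rewrite !TE (tri23 HT e1 w0 v0) a0 b0 add0r addr0 -[X in X + _]mul1r.
by rewrite -[X in _ + X]mul1r -mulrDl mulf_neq0.
Qed.

(** The two quadratic forms y |-> T (M e1) (M y) (M y) and T e1 y y are proportional
  because the second has rank at least two and the first vanishes at its zeros:
  on a line where the second has two distinct zeros both are determined up to a
  factor. The remaining forms of the pencil have the same factor since the
  direction P y is transported. *)
Lemma residual_scalar g : exists2 mu, mu != 0 & forall w y, w \in W ->
  T (M g *m w) (M g *m y) (M g *m y) = mu * T w y y.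
Proof.
pose q' w y := T (M g *m w) (M g *m y) (M g *m y).
have q'E : forall w a (t : k) b, q' w (a + t *: b) = q' w a + 2%:R * t *
    T (M g *m w) (M g *m a) (M g *m b) + t ^+ 2 * q' w b.
  move=> w a t b; rewrite /q' mulmxDr -scalemxAr !TE (tri23 HT _ (M g *m b)); ring.
have prop v v' : disc (T e1) v v' != 0 -> T e1 v' v' != 0 ->
    q' e1 v * T e1 v' v' = q' e1 v' * T e1 v v.
  move=> D b0; have [de hde] := exists_sqrt (disc (T e1) v v').
  have de0 : de != 0 by apply: contraNneq D => z; rewrite -hde z expr0n.
  pose t1 := (- T e1 v v' + de) / T e1 v' v'; pose t2 := (- T e1 v v' - de) / T e1 v' v'.
  have tt : t1 - t2 != 0.
    have -> : t1 - t2 = 2%:R * de / T e1 v' v' by rewrite /t1 /t2; field.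
    by rewrite !mulf_neq0 ?invr_neq0.
  have rt (s : k) : s ^+ 2 = disc (T e1) v v' ->
      q' e1 (v + ((- T e1 v v' + s) / T e1 v' v') *: v') = 0.
    move=> hs; apply: residual_transport => //.
    rewrite !TE (tri23 HT e1 v' v).
    have : s ^+ 2 - (T e1 v v' ^+ 2 - T e1 v v * T e1 v' v') = 0 by rewrite hs subrr.
    move=> h; apply: (mulf_cancel0 b0); rewrite -[RHS]h; field => //.
  have r1 := rt de hde; have r2 : q' e1 (v + t2 *: v') = 0 by apply: rt; rewrite sqrrN.
  have s12 : t1 + t2 = - (2%:R * T e1 v v') / T e1 v' v' by rewrite /t1 /t2; field.
  have p12 : t1 * t2 * T e1 v' v' = T e1 v v.
    rewrite /t1 /t2; have : de ^+ 2 - disc (T e1) v v' = 0 by rewrite hde subrr.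
    rewrite /disc => h; apply/eqP; rewrite -subr_eq0; apply/eqP.
    apply: (mulf_cancel0 b0); rewrite -[RHS]oppr0 -h; field => //.
  rewrite q'E -/t1 in r1; rewrite q'E in r2.
  have key : q' e1 v = q' e1 v' * (t1 * t2).
    apply/eqP; rewrite -subr_eq0; apply/eqP; apply: (mulf_cancel0 tt).
    apply: (lin_comb2 r1 r2 (x := - t2) (y := t1)); ring.
  by rewrite key -p12; ring.
have [v [v' [D b0]]] := disc_nonzero_partner.
have fM : forall i, formfun 1 (fun y : V => (M g *m y) i 0) by move=> i; apply: formfun_mulmx.
have fq' w : formfun 2 (q' w) by exact: (formfun_tri HT (formmap_cst 4 (M g *m w)) fM fM).
have h1 y : q' e1 y * T e1 v' v' - q' e1 v' * T e1 y y = 0.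
  move: y; apply: (@formfun_cancel _ _ 2 2 (fun y => disc (T e1) y v')).
  - apply: formfunB; last exact: (formfunM formq (formfunC _ (T e1 v' v'))).
    have h : formfun 1 (fun y : V => T e1 y v').
      exact: (formfun_tri HT (formmap_cst 4 e1) (@formmap_id k _) (formmap_cst 4 v')).
    by apply: formfun_eq (formfunM h h) => y; rewrite expr2.
  - by apply: formfunB; [apply: (formfunM (fq' e1) (formfunC _ _)) | apply: formfunZ].
  - by exists v.
  move=> y; have [->|Dy] := eqVneq (disc (T e1) y v') 0; first by rewrite mul0r.
  by rewrite prop // subrr mulr0.
pose mu := q' e1 v' / T e1 v' v'.
have mu1 y : q' e1 y = mu * T e1 y y.
  apply: (mulIf b0); apply/eqP; rewrite -subr_eq0; apply/eqP.
  by rewrite -[RHS](h1 y) /mu; field.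
have mu0 y : q' e0 y = mu * T e0 y y.
  apply/eqP; rewrite -subr_eq0; apply/eqP; move: y.
  have fq0 : formfun 2 (fun y : V => T e0 y y).
    exact: (formfun_tri HT (formmap_cst 4 e0) (@formmap_id k _) (@formmap_id k _)).
  apply: (formfun_cancel formq (formfunB (fq' e0) (formfunZ mu fq0))); first by exists v'.
  move=> y; have pW : P y \in W by rewrite memvB // memvZ.
  have py : T (P y) y y = 0 by rewrite /residual_point -scaleN1r !TE; ring.
  have := residual_transport g pW py; rewrite /residual_point mulmxBr -!scalemxAr.
  rewrite -scaleN1r !TE -/(q' e0 y) -/(q' e1 y) mu1 => h.
  by rewrite -[RHS]h; ring.
exists mu.
  apply/eqP => z; have [y hy] := dl_cone HX (lg_neq0 HM g e1_neq0).
  case/eqP: hy; have [c c0 ec] := lg_mulV HM g^-1%g; rewrite invgK in ec.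
  have ey : y = M g *m (c^-1 *: (M g^-1%g *m y)).
    by rewrite -scalemxAr mulmxA ec mul_scalar_mx scalerA mulVf // scale1r.
  by rewrite ey; have := mu1 (c^-1 *: (M g^-1%g *m y)); rewrite z mul0r.
move=> w y /(pb_span bW)[c [r ->]]; rewrite mulmxDr -!scalemxAr !TE.
by rewrite -/(q' e0 y) -/(q' e1 y) mu0 mu1; ring.
Qed.

(** This is Cramer's rule for the action of M g on W: the factor is mu divided by
  the determinant of that action. *)
Lemma residual_point_image g :
  exists2 chi, chi != 0 & forall y, P (M g *m y) = chi *: (M g *m P y).
Proof.
have [mu mu0 hmu] := residual_scalar g.
have [a00 [a10 E0]] := pb_span bW (inv g e0W).
have [a01 [a11 E1]] := pb_span bW (inv g e1W).
pose det := a00 * a11 - a01 * a10.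
have key y : mu *: (M g *m P y) = det *: P (M g *m y).
  have h0 := hmu e0 y e0W; have h1 := hmu e1 y e1W.
  rewrite E0 !TE in h0; rewrite E1 !TE in h1.
  rewrite /residual_point mulmxBr -!scalemxAr scalerBr !scalerA -h0 -h1 E0 E1 /det.
  by apply/matrixP => i j; rewrite !mxE; ring.
have det0 : det != 0.
  apply/eqP => z; have [u qu] := dl_cone HX e1_neq0.
  have := key u; rewrite z scale0r => /eqP; rewrite scaler_eq0 (negPf mu0) /= => /eqP.
  move/(unitmx_eq0 (lg_unit HM g)); rewrite /residual_point -scaleNr.
  by case/(pb_free bW) => /eqP; rewrite (negPf qu).
exists (mu / det) => [|y]; first by rewrite mulf_neq0 ?invr_neq0.
by rewrite mulrC -scalerA key scalerA mulVf // scale1r.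
Qed.

(** Rescaling so that residual points are permuted without factors makes the
  projective representation a linear one. *)
Lemma normalized_representation : exists N : gT -> 'M[k]_5,
  [/\ N 1%g = 1%:M, forall g h, N (g * h)%g = N g *m N h,
      forall g, exists c, M g = c *: N g,
      forall g w, w \in W -> N g *m w \in W &
      forall g y, P (N g *m y) = N g *m P y].
Proof.
have : forall g, exists c : k, c != 0 /\ forall y, P (M g *m y) = c *: (M g *m P y).
  by move=> g; have [c c0 hc] := residual_point_image g; exists c.
move/fin_all_exists => [chi hchi].
have chi0 g : chi g != 0 by case: (hchi g).
have PZ (c : k) y : P (c *: y) = c ^+ 2 *: P y.
  by rewrite /residual_point !TE scalerBr !scalerA expr2 !mulrA.
have [u qu] := dl_cone HX e1_neq0.
have Pu : P u != 0.
  apply/eqP; rewrite /residual_point -scaleNr => /(pb_free bW)[/eqP].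
  by rewrite (negPf qu).
have chiM g h (c : k) : c != 0 -> M g *m M h = c *: M (g * h)%g ->
    chi g * chi h = c * chi (g * h)%g.
  move=> c0 ec; have := (hchi g).2 (M h *m u).
  rewrite (hchi h).2 mulmxA ec -scalemxAl PZ (hchi _).2 -scalemxAr mulmxA ec.
  rewrite -scalemxAl !scalerA => /eqP; rewrite -subr_eq0 -scalerBl scaler_eq0.
  rewrite (negPf (lg_neq0 HM _ Pu)) orbF subr_eq0 => /eqP h1.
  by apply: (mulIf c0); rewrite -mulrA -h1; ring.
exists (fun g => (chi g)^-1 *: M g); split.
- have [c c0 e] := lg_one HM; have ec : M 1%g *m M 1%g = c *: M (1 * 1)%g.
    by rewrite mulg1 {1}e mul_scalar_mx.
  have := chiM 1%g 1%g c c0 ec; rewrite mulg1 => /(mulIf (chi0 _)) e1'.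
  by rewrite e e1' scale_scalar_mx mulVf.
- move=> g h; have [c c0 ec] := lg_mul_neq0 HM g h.
  rewrite -scalemxAl -scalemxAr ec !scalerA; congr (_ *: _).
  have -> : chi (g * h)%g = c^-1 * (chi g * chi h) by rewrite (chiM g h c c0 ec) mulKf.
  by field; rewrite c0 !chi0.
- by move=> g; exists (chi g); rewrite scalerA divff // scale1r.
- by move=> g w wW; rewrite -scalemxAl memvZ // inv.
move=> g y; rewrite -!scalemxAl PZ (hchi g).2 scalerA; congr (_ *: _).
by field.
Qed.

End Invariant.

Lemma formfun_lform_comp (k : closedFieldType) m n d (xi : 'rV[k]_m)
    (F : 'cV[k]_n.+1 -> 'cV[k]_m) :
  (forall i, formfun d (fun v => F v i 0)) -> formfun d (fun v => lform xi (F v)).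
Proof. by move=> hF; apply: formmap_mulmx hF 0. Qed.

Section Average.
Variables (k : closedFieldType) (char0 : [pchar k] =i pred0).
Notation V := 'cV[k]_5.
Implicit Types (a b p u v w x y : V) (c : k).
Variables (T : V -> V -> V -> k) (W : {vspace V}).
Hypothesis HX : double_line_cubic T W.
Let HT := dl_tri HX.
Let TE := triE HT.
Let three0 : 3%:R != 0 :> k := natS_neq0 char0 2.
Variables (e0 e1 : V) (bW : plane_basis W e0 e1).
Notation P := (residual_point T e0 e1).
Variables (gT : finGroupType) (N : gT -> 'M[k]_5).
Hypotheses (N1 : N 1%g = 1%:M) (NM : forall g h, N (g * h)%g = N g *m N h).
Hypothesis (NW : forall g w, w \in W -> N g *m w \in W).
Hypothesis (NP : forall g y, P (N g *m y) = N g *m P y).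
Implicit Types (g h : gT).

Let e0W : e0 \in W := pb_mem1 bW.
Let e1W : e1 \in W := pb_mem2 bW.
Let r := #|gT|.-1.

Let card_gT : #|gT| = r.+1.
Proof. by rewrite prednK //; apply/card_gt0P; exists 1%g. Qed.

Let card_others g : #|[pred h | h != g]| = r.
Proof. by rewrite /r -(cardC1 g); apply: eq_card => h; rewrite !inE. Qed.

Let PW y : P y \in W. Proof. by rewrite memvB // memvZ. Qed.

Let P_shift w y : w \in W -> P (w + y) = P y.
Proof.
move=> wW; rewrite /residual_point !TE (tri23 HT e1 y w) (tri23 HT e0 y w).
by rewrite !(dl_sing HX _ e1W wW) !(dl_sing HX _ e0W wW) !add0r.
Qed.

Let PZ c y : P (c *: y) = c ^+ 2 *: P y.
Proof. by rewrite /residual_point !TE scalerBr !scalerA expr2 !mulrA. Qed.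

Let TP y : T (P y) y y = 0.
Proof. by rewrite /residual_point -scaleN1r !TE; ring. Qed.

Variable xi : 'rV[k]_5.
Hypothesis xi_e0 : lform xi e0 = 1.

Let l g v := lform xi (N g *m v).

Let lD g v w : l g (v + w) = l g v + l g w. Proof. by rewrite /l mulmxDr lformD. Qed.
Let lZ g c v : l g (c *: v) = c * l g v. Proof. by rewrite /l -scalemxAr lformZ. Qed.

(** A coordinate on the residual line over y, averaged over the group, is the
  quotient of these two: translating v by t times the direction P y adds t times
  the order of the group to it. *)
Let Den y := \prod_g l g (P y).
Let Num v y := \sum_g l g v * \prod_(h | h != g) l h (P y).

Let Den_shift w y : w \in W -> Den (w + y) = Den y.
Proof. by move=> wW; rewrite /Den P_shift. Qed.

Let Num_shift v w y : w \in W -> Num v (w + y) = Num v y.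
Proof. by move=> wW; rewrite /Num P_shift. Qed.

Let DenZ c y : Den (c *: y) = (c ^+ 2) ^+ r.+1 * Den y.
Proof.
rewrite /Den PZ -card_gT -prodr_const -big_split; apply: eq_bigr => g _.
by rewrite lZ.
Qed.

Let NumZ v c y : Num v (c *: y) = (c ^+ 2) ^+ r * Num v y.
Proof.
rewrite /Num PZ big_distrr; apply: eq_bigr => g _ /=; rewrite mulrCA; congr (_ * _).
rewrite -(card_others g) -prodr_const -big_split; apply: eq_bigr => h _.
by rewrite lZ.
Qed.

Let NumD v w y : Num (v + w) y = Num v y + Num w y.
Proof. by rewrite /Num -big_split; apply: eq_bigr => g _; rewrite lD mulrDl. Qed.

Let NumlZ c v y : Num (c *: v) y = c * Num v y.
Proof. by rewrite /Num big_distrr; apply: eq_bigr => g _; rewrite lZ /= mulrA. Qed.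

Let NumP y : Num (P y) y = r.+1%:R * Den y.
Proof.
rewrite /Num -card_gT -sum1_card natr_sum big_distrl; apply: eq_bigr => g _ /=.
by rewrite mul1r /Den [in RHS](bigD1 g).
Qed.

Let lN g h v : l h (N g *m v) = l (h * g)%g v.
Proof. by rewrite /l mulmxA -NM. Qed.

Let DenN g y : Den (N g *m y) = Den y.
Proof.
rewrite /Den NP [RHS](reindex_inj (mulIg g)); apply: eq_bigr => h _.
by rewrite lN.
Qed.

Let NumN g v y : Num (N g *m v) (N g *m y) = Num v y.
Proof.
rewrite /Num NP [RHS](reindex_inj (mulIg g)); apply: eq_bigr => h _.
rewrite lN [in RHS](reindex_inj (mulIg g)); congr (_ * _).
by apply: eq_big => h'; rewrite ?(inj_eq (mulIg g)) // lN.
Qed.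

Let formP : forall i, formfun 2 (fun y => P y i 0).
Proof.
move=> i; apply: (@formfun_eq _ _ 2 (fun y => T e1 y y * e0 i 0 - T e0 y y * e1 i 0)) => [y|].
  by rewrite !mxE.
by apply: formfunB; [exact: (formfunM (formfun_tri HT (formmap_cst 4 e1)
    (@formmap_id k _) (@formmap_id k _)) (formfunC _ _)) |
  exact: (formfunM (formfun_tri HT (formmap_cst 4 e0)
    (@formmap_id k _) (@formmap_id k _)) (formfunC _ _))].
Qed.

Let form_l n d g (F : 'cV[k]_n.+1 -> V) :
  (forall i, formfun d (fun z => F z i 0)) -> formfun d (fun z => l g (F z)).
Proof. by move=> hF; apply/formfun_lform_comp/formmap_mulmx. Qed.

Let form_P n d (F : 'cV[k]_n.+1 -> V) :
  (forall i, formfun d (fun z => F z i 0)) -> forall i, formfun (d + d) (fun z => P (F z) i 0).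
Proof.
move=> hF i; apply: (@formfun_eq _ _ _ (fun z => T e1 (F z) (F z) * e0 i 0 -
    T e0 (F z) (F z) * e1 i 0)) => [z|]; first by rewrite !mxE.
rewrite -[(d + d)%N]addn0; apply: formfunB; apply: formfunM (formfunC _ _).
  exact: (formfun_tri HT (formmap_cst _ e1) hF hF).
exact: (formfun_tri HT (formmap_cst _ e0) hF hF).
Qed.

Let form_Den n d (F : 'cV[k]_n.+1 -> V) :
  (forall i, formfun d (fun z => F z i 0)) ->
  formfun ((d + d) * r.+1) (fun z => Den (F z)).
Proof. by move=> hF; rewrite -card_gT; apply: formfun_prod => g; apply/form_l/form_P. Qed.

Let form_Num n d d' (F F' : 'cV[k]_n.+1 -> V) :
  (forall i, formfun d' (fun z => F' z i 0)) ->
  (forall i, formfun d (fun z => F z i 0)) ->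
  formfun (d' + (d + d) * r) (fun z => Num (F' z) (F z)).
Proof.
move=> hF' hF; apply: formfun_sum => g; rewrite -(card_others g).
apply: formfunM; first exact: form_l.
by apply: formfun_prod => h; apply/form_l/form_P.
Qed.

Let e1_neq0 : e1 != 0 := plane_basis_neq0 bW.

Let formq : formfun 2 (fun y : V => T e1 y y).
Proof.
exact: (formfun_tri HT (formmap_cst 4 e1) (@formmap_id k _) (@formmap_id k _)).
Qed.

Let Den_neq0 : exists y, Den y != 0.
Proof.
apply: (@formfun_prod_neq0 _ _ 2) => g; first by apply: form_l; apply: formP.
pose x := l g e0 *: e1 - l g e1 *: e0.
have lx y : l g (P y) = T x y y.
  by rewrite /residual_point /x -!scaleN1r !TE !(lD, lZ); ring.
have x0 : x != 0.
  apply/eqP; rewrite /x addrC -scaleNr => /(pb_free bW)[/eqP]; rewrite oppr_eq0 => /eqP l1 l0.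
  have [c [d e]] := pb_span bW (NW g^-1%g e0W).
  have : l g (N g^-1%g *m e0) = 1 by rewrite lN mulgV /l N1 mul1mx.
  by rewrite e lD !lZ l1 l0 !mulr0 addr0 => /eqP; rewrite eq_sym oner_eq0.
have [y hy] := dl_cone HX x0; exists y; by rewrite lx.
Qed.

(** The quotient Num / Den, homogeneous of degree -1, trivializes the family of
  residual lines over the plane P(V / W) equivariantly. So X is birational to
  k^3 = V / W: a point v corresponds to the multiple of its class whose factor is
  this quotient. *)
Lemma average_coordinate : exists rG F G D E, @equivariant_forms k gT T N rG F G D E.
Proof.
have rowE (x : 'cV_(1 + 1)) :
    row_mx e0 e1 *m x = usubmx x 0 0 *: e0 + dsubmx x 0 0 *: e1.
  rewrite -[x in LHS]vsubmxK mul_row_col.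
  by congr (_ + _); apply/matrixP => i j; rewrite (ord1 j) mxE big_ord1 !mxE mulrC.
have injB (x : 'cV_2) : (row_mx e0 e1 : 'M_(2 + 3, 1 + 1)) *m x = 0 -> x = 0.
  rewrite (rowE x) => /(pb_free bW)[h0 h1]; rewrite -[x](@vsubmxK _ 1 1).
  have z1 (z : 'cV[k]_1) : z 0 0 = 0 -> z = 0.
    by move=> hz; apply/matrixP => i j; rewrite (ord1 i) (ord1 j) mxE.
  by rewrite (z1 _ h0) (z1 _ h1) col_mx0.
have [Pi [S [X [PiS PiB _ dec]]]] : exists (Pi : 'M[k]_(3, 5)) (S : 'M[k]_(5, 3))
    (X : 'M[k]_(2, 5)), [/\ Pi *m S = 1%:M, Pi *m (row_mx e0 e1 : 'M_(5, 2)) = 0,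
      X *m (row_mx e0 e1 : 'M_(5, 2)) = 1%:M &
      S *m Pi + (row_mx e0 e1 : 'M_(5, 2)) *m X = 1%:M] by apply: complement injB.
have PiW w : w \in W -> Pi *m w = 0.
  move/(pb_span bW) => [c [d ->]]; rewrite mulmxDr -!scalemxAr.
  have : Pi *m (row_mx e0 e1 : 'M_(5, 1 + 1)) = 0 := PiB.
  rewrite mul_mx_row => h; have := congr1 lsubmx h; have := congr1 rsubmx h.
  by rewrite row_mxKl row_mxKr !linear0 => -> ->; rewrite !scaler0 addr0.
have vdec v : exists2 w, w \in W & v = w + S *m (Pi *m v).
  exists ((row_mx e0 e1 : 'M_(5, 2)) *m (X *m v)); last first.
    by rewrite addrC !mulmxA -mulmxDl dec mul1mx.
  by have := rowE (X *m v) => ->; apply: (pb_mem bW).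
pose th g := Pi *m N g *m S.
have thE g v : th g *m (Pi *m v) = Pi *m (N g *m v).
  have [w wW ev] := vdec v; rewrite {2}ev mulmxDr mulmxDr (PiW _ (NW g wW)) add0r.
  by rewrite /th -!mulmxA.
have thPi g : th g *m Pi = Pi *m N g.
  apply/matrixP => i j; have := congr1 (fun v : 'cV_3 => v i 0) (thE g (delta_mx j 0)).
  by rewrite !mulmxA -!colE !mxE.
have rP : mx_repr [set: gT] (fun g => block_mx (th g) 0 0 1%:M : 'M[k]_(3 + 1)).
  split=> [|g h _ _]; first by rewrite /th N1 mulmx1 PiS -scalar_mx_block.
  rewrite mulmx_block !(mulmx0, mul0mx, mulmx1, addr0, add0r); congr block_mx.
  by rewrite {3}/th !mulmxA thPi -[Pi *m _ *m _]mulmxA -NM.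
pose F v : 'cV[k]_(3 + 1) := col_mx (Num v v *: (Pi *m v)) (const_mx (Den v)).
pose q y := T e1 y y; pose C y := T y y y.
(* The point z0 y of X lies in the plane over y; moving it in the direction P y
   adjusts the averaged coordinate to a prescribed value. *)
pose z0 y := (3%:R * q y) *: y - C y *: e1.
pose n : k := r.+1%:R.
have n0 : n != 0 := natS_neq0 char0 r.
pose Sz (z : 'cV[k]_(3 + 1)) := S *m usubmx z.
pose s (z : 'cV[k]_(3 + 1)) := dsubmx z 0 0.
pose G z := (n * Den (Sz z) * s z) *: z0 (Sz z) +
  (3%:R * q (Sz z) * Den (Sz z) - s z * Num (z0 (Sz z)) (Sz z)) *: P (Sz z).
pose D v := 3%:R * n * q v * Den v ^+ 2 * ((Num v v ^+ 2) ^+ r * Num v v ^+ 5).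
pose m z := 3%:R * n * Den (Sz z) * s z * q (Sz z).
pose E z := (m z ^+ 2) ^+ r * m z * Den (Sz z) ^+ 2 * (3%:R * n * q (Sz z)).
have fid : forall i, formfun 1 (fun v : V => v i 0) by apply: formfun_coord.
have fSz : forall i, formfun 1 (fun z => Sz z i 0).
  move=> i; apply: formmap_mulmx => j.
  by apply: (formfun_eq (h := fun z : 'cV_(3 + 1) => usubmx z j 0)) (formfun_coord _ (lshift 1 j)) => z; rewrite mxE.
have fs : formfun 1 s.
  by apply: formfun_eq (formfun_coord _ (rshift 3 ord0)) => z; rewrite /s mxE.
have fq n' (F' : 'cV[k]_n'.+1 -> V) : (forall i, formfun 1 (fun z => F' z i 0)) ->
    formfun 2 (fun z => q (F' z)).
  by move=> h; exact: (formfun_tri HT (formmap_cst _ e1) h h).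
have fz0 : forall i, formfun 3 (fun z => z0 (Sz z) i 0).
  move=> i; apply: (@formfun_eq _ _ 3 (fun z => 3%:R * q (Sz z) * Sz z i 0 -
      C (Sz z) * e1 i 0)) => [z|]; first by rewrite !mxE.
  apply: formfunB.
    exact: (formfunM (formfunZ _ (fq _ _ fSz)) (fSz i)).
  exact: (formfunM (formfun_tri HT fSz fSz fSz) (formfunC _ (e1 i 0))).
have qW w v : w \in W -> q (w + v) = q v.
  by move=> wW; rewrite /q !TE (tri23 HT e1 v w) !(dl_sing HX _ e1W wW) !add0r.
pose wz z := (3%:R * q (Sz z) * Den (Sz z) - s z * Num (z0 (Sz z)) (Sz z)) *: P (Sz z) -
  (n * Den (Sz z) * s z * C (Sz z)) *: e1.
have wzW z : wz z \in W by rewrite memvB // memvZ.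
have GE z : G z = wz z + m z *: Sz z.
  rewrite /G {1}/z0 scalerBr !scalerA [LHS]addrC addrA addrAC.
  by congr (_ + _ *: _); rewrite /m; ring.
exists (MxRepresentation rP), F, G, D, E; split.
- exists (2 * r.+1)%N => // i.
  have e : (2 * r.+1 = (1 + (1 + 1) * r) + 1)%N by rewrite mulnS mul2n -addnn; lia.
  case: (@splitP 3 1 i) => j ej.
    have -> : i = lshift 1 j by apply: val_inj.
    apply: (@formfun_eq _ _ _ (fun v => Num v v * (Pi *m v) j 0)) => [v|].
      transitivity ((Num v v *: (Pi *m v)) j 0); first by rewrite [RHS]mxE.
      exact/esym/col_mxEu.
    by rewrite e; apply: formfunM; [apply: form_Num | apply: formfun_mulmx].
  have -> : i = rshift 3 j by apply: val_inj.
  apply: (@formfun_eq _ _ _ Den) => [v|].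
    transitivity ((const_mx (Den v) : 'cV_1) j 0); first by rewrite mxE.
    exact/esym/col_mxEd.
  exact: (form_Den fid).
- exists ((1 + 1) * r.+1 + 1 + 3)%N; first by rewrite addn_gt0 orbT.
  move=> i; apply: (@formfun_eq _ _ _ (fun z => n * Den (Sz z) * s z * z0 (Sz z) i 0 +
    (3%:R * q (Sz z) * Den (Sz z) - s z * Num (z0 (Sz z)) (Sz z)) * P (Sz z) i 0)) => [z|].
    by rewrite !mxE.
  apply: formfunD.
    by apply: formfunM (fz0 i); apply: formfunM fs; apply: formfunZ; apply: form_Den.
  have e : ((1 + 1) * r.+1 + 1 + 3 = (2 + (1 + 1) * r.+1) + (1 + 1))%N by lia.
  rewrite e; apply: formfunM; last exact: form_P.
  apply: formfunB; first by apply: formfunM (form_Den fSz); apply/formfunZ/fq.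
  have -> : (2 + (1 + 1) * r.+1 = 1 + (3 + (1 + 1) * r))%N by lia.
  by apply: formfunM fs _; apply: form_Num.
- have [d1 h1] := formfun_exp 2 (form_Den fid).
  have fN := form_Num fid fid.
  have [d2 h2] := formfun_exp 2 fN; have [d3 h3] := formfun_exp r h2.
  have [d4 h4] := formfun_exp 5 fN.
  exists (2 + d1 + (d3 + d4))%N; apply: formfunM; last exact: formfunM.
  by apply: formfunM h1; apply: formfunZ; apply: fq.
- have fm : exists d, formfun d m.
    exists ((1 + 1) * r.+1 + 1 + 2)%N; apply: formfunM (fq _ _ fSz).
    by apply: formfunM fs; apply/formfunZ/form_Den.
  have [dm hm] := fm; have [d1 h1] := formfun_exp 2 hm.
  have [d2 h2] := formfun_exp r h1; have [d3 h3] := formfun_exp 2 (form_Den fSz).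
  exists (d2 + dm + d3 + 2)%N; apply: formfunM; last by apply/formfunZ/fq.
  by apply: formfunM h3; apply: formfunM.
- move=> v fv; have [w wW ev] := vdec v; set u := S *m _ in ev.
  have [a [b ew]] := pb_span bW wW.
  have [eD eP] : Den u = Den v /\ P u = P v by rewrite ev Den_shift // P_shift.
  have eN x : Num x u = Num x v by rewrite ev Num_shift.
  have eq1 : q u = q v by rewrite ev qW.
  have eq0 : T e0 u u = T e0 v v.
    by rewrite ev !TE (tri23 HT e0 u w) !(dl_sing HX _ e0W wW) !add0r.
  have key : 3%:R * (a * T e0 v v + b * q v) + C u = 0.
    have : T (w + u) (w + u) (w + u) = 0 by rewrite -ev.
    by rewrite (sing_cube HX) // ew !TE eq0 -/(q u) eq1.
  have ez : z0 u = (3%:R * q v) *: v - (3%:R * a) *: P v.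
    have eC : C u = - (3%:R * (a * T e0 v v + b * q v)).
      by apply/eqP; rewrite -addr_eq0 addrC key.
    rewrite /z0 eq1 eC /residual_point -/(q v) [X in _ = _ *: X - _]ev ew.
    by move: (T e0 v v) (q v) => c0 c1; apply/matrixP => i j; rewrite !mxE; ring.
  have eS : Sz (F v) = Num v v *: u by rewrite /Sz /F col_mxKu -scalemxAr.
  have es : s (F v) = Den v by rewrite /s /F col_mxKd mxE.
  rewrite /G eS es; set c := Num v v.
  have ezc : z0 (c *: u) = c ^+ 3 *: z0 u.
    rewrite /z0 /q /C !TE; apply/matrixP => i j; rewrite !mxE; ring.
  rewrite ezc DenZ PZ NumZ NumlZ eD eP eN ez.
  have -> : Num ((3%:R * q v) *: v - (3%:R * a) *: P v) v =
      3%:R * q v * c - 3%:R * a * (n * Den v).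
    by rewrite -scaleNr NumD !NumlZ NumP -/c -/n mulNr.
  have -> : q (c *: u) = c ^+ 2 * q v by rewrite -eq1 /q !TE; ring.
  rewrite /D -/c exprS; move: ((c ^+ 2) ^+ r) (Den v) (q v) (P v) => e de qq p.
  by apply/matrixP => i j; rewrite !mxE; ring.
- move=> z; have Tw : T (wz z) (Sz z) (Sz z) = - (n * Den (Sz z) * s z * C (Sz z)) * q (Sz z).
    by rewrite /wz -scaleNr (triD1 HT) !(triZ1 HT) TP mulr0 add0r.
  rewrite GE (sing_cube HX) ?wzW // !(triZ2 HT, triZ3 HT, triZ1 HT) Tw -/(C _) /m; ring.
- move=> z; move: (z : 'cV_(3 + 1)) => {}z; have eP : Pi *m G z = m z *: usubmx z.
    by rewrite GE mulmxDr PiW ?wzW // add0r -scalemxAr mulmxA PiS mul1mx.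
  have eN : Num (G z) (G z) = (m z ^+ 2) ^+ r * (3%:R * n * q (Sz z) * Den (Sz z) ^+ 2).
    rewrite {2}GE Num_shift ?wzW // NumZ /G NumD !NumlZ NumP -/n; ring.
  have eD : Den (G z) = (m z ^+ 2) ^+ r * m z ^+ 2 * Den (Sz z).
    by rewrite GE Den_shift ?wzW // DenZ exprSr.
  rewrite /F eP eN eD.
  apply/matrixP => i j; rewrite (ord1 j) [RHS]mxE; case: (@splitP 3 1 i) => l' el.
    have -> : i = lshift 1 l' by apply: val_inj.
    apply: etrans (col_mxEu _ _ _ _) _; rewrite !mxE /E; ring.
  have -> : i = rshift 3 l' by apply: val_inj.
  apply: etrans (col_mxEd _ _ _ _) _; rewrite mxE (ord1 l') /E.
  have -> : z (rshift 3 0) 0 = s z by rewrite /s mxE.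
  by move: ((m z ^+ 2) ^+ r) => e; rewrite /m; ring.
- have [y hy] : exists y, Den y * q y != 0.
    apply: (formfun_common_nonzero (form_Den fid) formq Den_neq0).
    exact: (dl_cone HX e1_neq0).
  have [w wW ey] := vdec y.
  exists (col_mx (Pi *m y) (const_mx 1) : 'cV_(3 + 1)).
  have eS : Den (S *m (Pi *m y)) = Den y by rewrite [in RHS]ey Den_shift.
  have eq1 : q (S *m (Pi *m y)) = q y by rewrite [in RHS]ey qW.
  rewrite /E /m /Sz /s col_mxKu col_mxKd mxE eS eq1.
  move: hy; rewrite mulf_eq0 negb_or => /andP[d0 q0].
  rewrite !(mulf_eq0, expf_eq0, oner_eq0) (negPf d0) (negPf q0) (negPf n0).
  by rewrite (negPf three0) !andbF.
move=> g v; have -> : F (N g *m v) = block_mx (th g) 0 0 1%:M *m F v.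
  rewrite /F NumN DenN mul_block_col !mul0mx mul1mx addr0 add0r -scalemxAr thE.
  by [].
exact: collinear_refl.
Qed.

End Average.

Theorem linear_group_model (k : closedFieldType) (char0 : [pchar k] =i pred0)
    (T : 'cV[k]_5 -> 'cV[k]_5 -> 'cV[k]_5 -> k) (W : {vspace 'cV[k]_5})
    (gT : finGroupType) (M : gT -> 'M[k]_5) :
  double_line_cubic T W -> linear_group T W M ->
  exists rG F G D E, @equivariant_forms k gT T M rG F G D E.
Proof.
move=> HX HM; have [[p [pW p0 fixp]]|inv] := fixed_or_invariant char0 HX HM.
  exact: (project_fixed_point char0 HX HM pW p0 fixp).
have [e1 [v0 [w0 [e1W D0]]]] := exists_rank2 HX.
have e10 : e1 != 0.
  apply: contraNneq D0 => ->.
  by rewrite /disc -(scale0r 0) !(triE (dl_tri HX)) !mul0r expr0n subrr.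
have [e0 bW] := plane_basis_complete (dl_dim HX) e1W e10.
have [N [N1 NM MN NW NP]] := normalized_representation char0 HX bW D0 HM inv.
have [xi [_ [xi0 _ _ _]]] := dual_pair bW.
have [rG [F [G [D [E H]]]]] := average_coordinate char0 HX bW N1 NM NW NP xi0.
exists rG, F, G, D, E; case: H => hF hG hD hE GF GX FG E0 eqv; split=> // g v.
have [c ->] := MN g; have [d _ hd] := hF.
have -> : F (c *: N g *m v) = c ^+ d *: F (N g *m v).
  apply/matrixP => i j; rewrite (ord1 j) mxE -scalemxAl.
  exact: (formfun_homog c (N g *m v) (hd i)).
exact/collinearZ.
Qed.

(** * Points, form maps and birational maps *)
Section Points.
Variables (k : closedFieldType) (n : nat).
Implicit Types (p q : 'P[k]_n) (v w : 'cV[k]_n.+1).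

Fact point_subproof : \dim <[delta_mx 0%R 0%R : 'cV[k]_n.+1]>%VS == 1%N.
Proof.
rewrite dim_vline eqb1; apply/eqP => /matrixP/(_ 0 0)/eqP.
by rewrite !mxE oner_eq0.
Qed.

(** The value at v = 0 is an arbitrary point. *)
Definition point v : 'P[k]_n := insubd (PSpace point_subproof) <[v]>%VS.

Lemma pointE v : v != 0 -> point v = <[v]>%VS :> {vspace _}.
Proof. by move=> v0; rewrite /point -[LHS]/(val _) insubdK // unfold_in dim_vline v0. Qed.

Lemma pspace_inj p q : p = q :> {vspace _} -> p = q.
Proof. exact: val_inj. Qed.

Lemma mem_point v : v != 0 -> v \in (point v : {vspace _}).
Proof. by move=> v0; rewrite pointE // memv_line. Qed.

Lemma pspace_line p v : v \in (p : {vspace _}) -> v != 0 -> p = <[v]>%VS :> {vspace _}.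
Proof.
move=> vp v0; apply/eqP; rewrite eq_sym eqEdim dim_vline v0 (eqP (valP p)) andbT.
by rewrite -memvE.
Qed.

Lemma pspace_point p v : v \in (p : {vspace _}) -> v != 0 -> p = point v.
Proof. by move=> vp v0; apply: pspace_inj; rewrite pointE // (pspace_line vp). Qed.

Lemma vpick_neq0 p : vpick p != 0.
Proof. by rewrite vpick0 -dimv_eq0 (eqP (valP p)). Qed.

Lemma point_vpick p : point (vpick p) = p.
Proof. by apply/esym/pspace_point; [apply: memv_pick | apply: vpick_neq0]. Qed.

Lemma pspace_collinear p v w : v \in (p : {vspace _}) -> w \in (p : {vspace _}) ->
  w != 0 -> collinear v w.
Proof.
move=> vp wp w0; move: vp; rewrite (pspace_line wp w0) => /vlineP[c ->].
exact/collinearZ/collinear_refl.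
Qed.

Lemma collinear_line v w : v != 0 -> w != 0 -> collinear v w -> <[v]>%VS = <[w]>%VS.
Proof.
move=> v0 w0 /(collinearP_neq0 w0 v0)[c c0 ->]; apply/eqP.
rewrite eqEdim !dim_vline scaler_eq0 negb_or c0 w0 /= andbT -memvE memvZ ?memv_line //.
Qed.

Lemma collinear_point v w : v != 0 -> w != 0 -> collinear v w -> point v = point w.
Proof.
by move=> v0 w0 vw; apply: pspace_inj; rewrite !pointE // (collinear_line v0 w0 vw).
Qed.

Lemma vanishes_atP (F : {mpoly k[n.+1]}) d p v : F \is d.-homog ->
  v \in (p : {vspace _}) -> v != 0 -> vanishes_at F p <-> peval F v = 0.
Proof.
move=> hF vp v0; split=> [h|Fv w]; first exact: h.
by rewrite (pspace_line vp v0) => /vlineP[c ->]; rewrite (peval_homogZ _ _ hF) Fv mulr0.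
Qed.

Lemma closed_form (F : {mpoly k[n.+1]}) d : F \is d.-homog -> zariski_closed (vanishes_at F).
Proof.
move=> hF; exists (eq F) => [_ <-|p]; first by exists d.
by split=> [h _ <- //|]; apply.
Qed.

Lemma forms_of_map m d (F : 'cV[k]_n.+1 -> 'cV[k]_m.+1) :
  (forall i, formfun d (fun v => F v i 0)) -> exists H : 'I_m.+1 -> {mpoly k[n.+1]},
    (forall i, H i \is d.-homog) /\ forall v, forms_eval H v = F v.
Proof.
move=> hF; have : forall i, exists h : {mpoly k[n.+1]}, h \is d.-homog /\
    forall v, peval h v = F v i 0 by move=> i; have [h h1 h2] := hF i; exists h.
move/fin_all_exists => [H hH]; exists H; split=> [i|v]; first by case: (hH i).
by apply/matrixP => i j; rewrite (ord1 j) mxE (hH i).2.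
Qed.

Lemma map_scale m d (F : 'cV[k]_n.+1 -> 'cV[k]_m.+1) c v :
  (forall i, formfun d (fun v => F v i 0)) -> F (c *: v) = c ^+ d *: F v.
Proof.
move=> hF; apply/matrixP => i j; rewrite (ord1 j) mxE.
exact: (formfun_homog c v (hF i)).
Qed.

Lemma map_zero m d (F : 'cV[k]_n.+1 -> 'cV[k]_m.+1) : (0 < d)%N ->
  (forall i, formfun d (fun v => F v i 0)) -> F 0 = 0.
Proof.
move=> d0 hF; rewrite -(scale0r 0) (map_scale _ _ hF) expr0n.
by rewrite (gtn_eqF d0) scale0r.
Qed.

End Points.

Section FormMaps.
Variables (k : closedFieldType) (n : nat).
Implicit Types (p q : 'P[k]_n) (v w : 'cV[k]_n.+1).

Lemma regular_form_map m (U : 'P[k]_n -> Prop) d (F : 'cV[k]_n.+1 -> 'cV[k]_m.+1)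
    (phi : 'P[k]_n -> 'P[k]_m) :
  (forall i, formfun d (fun v => F v i 0)) ->
  (forall p v, U p -> v \in (p : {vspace _}) -> v != 0 ->
     F v != 0 /\ phi p = point (F v)) ->
  regular_on U phi.
Proof.
move=> hF hphi p Up; have [H [hH eH]] := forms_of_map hF.
have [Fp _] := hphi p (vpick p) Up (memv_pick p) (vpick_neq0 p).
exists d, H; split=> //; first by exists (vpick p); rewrite ?memv_pick ?eH.
move=> q v Uq vq; rewrite eH => Fv.
have [v0|v0] := eqVneq v 0.
  have [Fq eq_phi] := hphi q (vpick q) Uq (memv_pick q) (vpick_neq0 q).
  rewrite eq_phi pointE //; apply: collinear_line => //.
  case: d hF {H hH eH} => [|d] hF.
    have e x : F (0 *: x) = F x by rewrite (map_scale _ _ hF) expr0 scale1r.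
    by rewrite v0 -(scale0r (vpick q)) e; apply: collinear_refl.
  by move: Fv; rewrite v0 (map_zero _ hF) // eqxx.
by have [_ ->] := hphi q v Uq vq v0; rewrite pointE.
Qed.

Lemma form_value (g : 'cV[k]_n.+1 -> k) d p v w : formfun d g ->
  v \in (p : {vspace _}) -> w \in (p : {vspace _}) -> v != 0 -> g w != 0 -> g v != 0.
Proof.
move=> hg vp wp v0; apply: contra => /eqP gv; apply/eqP.
exact: (formfun_scale hg v0 (pspace_collinear wp vp v0) gv).
Qed.

End FormMaps.

Section Birational.
Variables (k : closedFieldType) (gT : finGroupType).
Notation V := 'cV[k]_5.
Variables (T : V -> V -> V -> k) (f : {mpoly k[5]}).
Hypotheses (f_cubic : f \is 3.-homog) (fT : forall v, peval f v = T v v v).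
Notation X := (hypersurface (n := 4) f).
Hypothesis X_irr : irreducible_set X.
Variables (act : gT -> 'P[k]_4 -> 'P[k]_4) (M : gT -> 'M[k]_5).
Hypothesis actM : forall g (v : V), v != 0 -> T v v v = 0 ->
  M g *m v != 0 /\ act g (point v) = point (M g *m v).

Let in_X (p : 'P[k]_4) (v : V) : v \in (p : {vspace _}) -> v != 0 -> X p <-> T v v v = 0.
Proof. by move=> vp v0; rewrite -fT; apply: vanishes_atP f_cubic vp v0. Qed.

(** The open sets are the loci where D and E do not vanish. Composing the two maps
  once more shows that E is nonzero at F v when D is nonzero at v, and conversely,
  so the maps exchange these sets. *)
Lemma linearizable_of_forms rG F G D E :
  @equivariant_forms k gT T M rG F G D E -> linearizable 3 X act.
Proof.
case=> -[dF dF0 hF] [dG dG0 hG] [dD hD] [dE hE] GF GX FG [z0 Ez0] eqv.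
have Ex : exists z, E z * z 0 0 != 0.
  apply: (formfun_common_nonzero hE (formfun_coord _ 0)); first by exists z0.
  by exists (delta_mx 0 0); rewrite mxE !eqxx oner_neq0.
have [z] := Ex; rewrite mulf_eq0 negb_or => /andP[Ez z00].
have {z00}z_neq0 : z != 0 by apply: contraNneq z00 => ->; rewrite mxE.
have F0 := map_zero dF0 hF; have G0 := map_zero dG0 hG.
have F_neq0 v : v != 0 -> T v v v = 0 -> D v != 0 -> F v != 0.
  move=> v0 fv Dv; apply/eqP => z1; have := GF v fv; rewrite z1 G0 => /esym/eqP.
  by rewrite scaler_eq0 (negPf Dv) (negPf v0).
have EF v : v != 0 -> T v v v = 0 -> D v != 0 -> E (F v) != 0.
  move=> v0 fv Dv; have Fv := F_neq0 v v0 fv Dv; apply/eqP => z1.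
  have := FG (F v); rewrite z1 scale0r GF // (map_scale _ _ hF) => /eqP.
  by rewrite scaler_eq0 (negPf Fv) orbF expf_eq0 (negPf Dv) andbF.
have G_neq0 y : y != 0 -> E y != 0 -> G y != 0.
  move=> y0 Ey; apply/eqP => z1; have := FG y; rewrite z1 F0 => /esym/eqP.
  by rewrite scaler_eq0 (negPf Ey) (negPf y0).
have DG y : y != 0 -> E y != 0 -> D (G y) != 0.
  move=> y0 Ey; have Gy := G_neq0 y y0 Ey; apply/eqP => z1.
  have := GF (G y) (GX y); rewrite z1 scale0r FG (map_scale _ _ hG) => /eqP.
  by rewrite scaler_eq0 (negPf Gy) orbF expf_eq0 (negPf Ey) andbF.
pose U (p : 'P[k]_4) := X p /\ D (vpick p) != 0.
pose Y (q : 'P[k]_3) := E (vpick q) != 0.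
have UP (p : 'P[k]_4) (v : V) : U p -> v \in (p : {vspace _}) -> v != 0 -> T v v v = 0 /\ D v != 0.
  move=> [Xp Dp] vp v0; split; first exact/(in_X vp v0).
  exact: (form_value hD vp (memv_pick p) v0).
have VP (q : 'P[k]_3) (y : 'cV_4) : Y q -> y \in (q : {vspace _}) -> y != 0 -> E y != 0.
  by move=> Vq yq y0; apply: (form_value hE yq (memv_pick q) y0).
pose phi (p : 'P[k]_4) := point (F (vpick p)); pose psi (q : 'P[k]_3) := point (G (vpick q)).
have phiE (p : 'P[k]_4) (v : V) : U p -> v \in (p : {vspace _}) -> v != 0 -> F v != 0 /\ phi p = point (F v).
  move=> Up vp v0; have [fv Dv] := UP p v Up vp v0.
  have [fp Dp] := UP p _ Up (memv_pick p) (vpick_neq0 p).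
  have Fv := F_neq0 v v0 fv Dv; split=> //.
  have Fp := F_neq0 _ (vpick_neq0 p) fp Dp; apply: collinear_point => //.
  have /(collinearP v0)[c ->] := pspace_collinear (memv_pick p) vp v0.
  by rewrite (map_scale _ _ hF); apply/collinearZ/collinear_refl.
have psiE (q : 'P[k]_3) (y : 'cV_4) : Y q -> y \in (q : {vspace _}) -> y != 0 -> G y != 0 /\ psi q = point (G y).
  move=> Vq yq y0; have Gy := G_neq0 y y0 (VP q y Vq yq y0); split=> //.
  have Gp := G_neq0 _ (vpick_neq0 q) Vq; apply: collinear_point => //.
  have /(collinearP y0)[c ->] := pspace_collinear (memv_pick q) yq y0.
  by rewrite (map_scale _ _ hG); apply/collinearZ/collinear_refl.
exists (lin_act rG); first by exists rG.
exists U, Y, phi, psi; split.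
- split; split.
  + have [FD hFD eD] := hD; exists (vanishes_at FD); first exact: closed_form hFD.
    move=> p; have pp := memv_pick p; have p0 := vpick_neq0 p.
    by split=> -[Xp Dp]; split=> //; move: Dp; rewrite (vanishes_atP hFD pp p0) eD; move/eqP.
  + have [FD hFD eD] := hD => Z cZ UZ.
    have [|XD|//] := X_irr.2 _ Z (closed_form hFD) cZ.
      move=> p Xp; have [Dp|Dp] := eqVneq (D (vpick p)) 0; last by right; apply: UZ.
      by left; apply/(vanishes_atP hFD (memv_pick p) (vpick_neq0 p)); rewrite eD.
    have Gz := G_neq0 z z_neq0 Ez; have XG : X (point (G z)) by apply/(in_X (mem_point Gz) Gz).
    have := XD _ XG => /(vanishes_atP hFD (mem_point Gz) Gz); rewrite eD.
    by move/eqP; rewrite (negPf (DG z z_neq0 Ez)).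
  + have [FE hFE eE] := hE; exists (vanishes_at FE); first exact: closed_form hFE.
    move=> q; have pp := memv_pick q; have p0 := vpick_neq0 q.
    split=> [Vq|[_ nq]]; last first.
      by apply/eqP => Eq; apply: nq; apply/(vanishes_atP hFE pp p0); rewrite eE.
    by split=> // /(vanishes_atP hFE pp p0); rewrite eE; move/eqP; rewrite (negPf Vq).
  move=> Z [S homS eZ] VZ q _; apply/eZ => h Sh; have [d hh] := homS h Sh.
  have fh : formfun d (peval h) by exists h.
  have fEx : formfun (dE + 1) (fun y : 'cV[k]_4 => E y * y 0 0).
    exact: (formfunM hE (formfun_coord _ 0)).
  move=> v _; move: v; apply: (formfun_cancel fEx fh Ex).
  move=> y; have [->|y0] := eqVneq y 0; first by rewrite mxE mulr0 mul0r.
  have [->|Ey] := eqVneq (E y) 0; first by rewrite !mul0r.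
  have Vy : Y (point y).
    exact: (form_value hE (memv_pick _) (mem_point y0) (vpick_neq0 _)).
  have /eZ/(_ h Sh y (mem_point y0)) -> := VZ _ Vy.
  by rewrite mulr0.
- by split; [apply: (regular_form_map hF phiE) | apply: (regular_form_map hG psiE)].
- move=> p Up; have pp := memv_pick p; have p0 := vpick_neq0 p.
  have [fv Dv] := UP p _ Up pp p0; have [Fv ephi] := phiE p _ Up pp p0.
  have mF := mem_point Fv; rewrite -ephi in mF.
  have Vp : Y (phi p).
    by apply: (form_value hE (memv_pick _) mF (vpick_neq0 _)); apply: EF.
  split=> //; have [GFv ->] := psiE _ _ Vp mF Fv.
  rewrite GF // -[RHS]point_vpick; apply: collinear_point => //.
    by rewrite -GF.
  exact/collinearZ/collinear_refl.
- move=> q Vq; have qq := memv_pick q; have q0 := vpick_neq0 q.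
  have [Gy epsi] := psiE q _ Vq qq q0.
  have mG := mem_point Gy; rewrite -epsi in mG.
  have Uq : U (psi q).
    split; first by apply/(in_X mG Gy).
    by apply: (form_value hD (memv_pick _) mG (vpick_neq0 _)); apply: DG.
  split=> //; have [FGy ->] := phiE _ _ Uq mG Gy.
  rewrite FG -[RHS]point_vpick; apply: collinear_point => //.
    by rewrite -FG.
  exact/collinearZ/collinear_refl.
move=> g p Up Ugp; have pp := memv_pick p; have p0 := vpick_neq0 p.
have [fv Dv] := UP p _ Up pp p0; have [Fv ephi] := phiE p _ Up pp p0.
have [Mv eact] := actM g p0 fv; rewrite point_vpick in eact.
have mM := mem_point Mv; rewrite -eact in mM.
have [FMv ->] := phiE _ _ Ugp mM Mv.
apply: pspace_inj; rewrite pointE // ephi /= pointE // limg_line lfunE /=.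
apply: collinear_line => //.
by apply: contraNneq Fv => /(unitmx_eq0 (repr_mx_unit rG (in_setT g))) ->.
Qed.

End Birational.

(** * The polar form of a cubic *)
Section Polar.
Variables (k : closedFieldType) (char0 : [pchar k] =i pred0).
Notation V := 'cV[k]_5.
Implicit Types (a b c v w x : V).
Variable f : {mpoly k[5]}.
Hypothesis f_cubic : f \is 3.-homog.
Let two0 : 2%:R != 0 :> k := natS_neq0 char0 1.
Let three0 : 3%:R != 0 :> k := natS_neq0 char0 2.

(** The third derivatives of a cubic form are constants. *)
Definition polar a b c : k := (3%:R * 2%:R)^-1 *
  \sum_i a i 0 * \sum_j b j 0 * \sum_l c l 0 * peval f^`M(i)^`M(j)^`M(l) 0.

Lemma polar_symmetric : symmetric_trilinear polar.
Proof.
split=> [a b c|a b c|a b c d|r a b c]; rewrite /polar.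
- congr (_ * _); under eq_bigr do rewrite mulr_sumr.
  rewrite exchange_big; apply: eq_bigr => i _; rewrite mulr_sumr.
  apply: eq_bigr => j _; rewrite mulrCA; congr (_ * (_ * _)).
  by apply: eq_bigr => l _; rewrite (mderiv_comm j i).
- congr (_ * _); apply: eq_bigr => i _; congr (_ * _).
  under eq_bigr do rewrite mulr_sumr.
  rewrite exchange_big; apply: eq_bigr => j _; rewrite mulr_sumr.
  by apply: eq_bigr => l _; rewrite mulrCA (mderiv_comm l j).
- rewrite -mulrDr -big_split; congr (_ * _); apply: eq_bigr => i _.
  by rewrite mxE mulrDl.
rewrite mulrCA; congr (_ * _); rewrite mulr_sumr; apply: eq_bigr => i _.
by rewrite mxE mulrA.
Qed.

(** Euler's relation for the second and the first derivatives. *)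
Lemma polar_diff v x : polar x v v = diff f v x / 3%:R.
Proof.
have h1 i := mderiv_homog i f_cubic; have h2 i j := mderiv_homog j (h1 i).
have h3 i j l := mderiv_homog l (h2 i j).
have cst i j l : peval f^`M(i)^`M(j)^`M(l) 0 = peval f^`M(i)^`M(j)^`M(l) v.
  by have := peval_homogZ 0 v (h3 i j l); rewrite scale0r expr0 mul1r.
have e3 i j : \sum_l v l 0 * peval f^`M(i)^`M(j)^`M(l) 0 = peval f^`M(i)^`M(j) v.
  under eq_bigr do rewrite cst; rewrite -[LHS]/(diff _ v v).
  by rewrite (diff_euler _ (h2 i j)) mul1r.
have e2 i : \sum_j v j 0 * (\sum_l v l 0 * peval f^`M(i)^`M(j)^`M(l) 0) =
    2%:R * peval f^`M(i) v.
  under eq_bigr do rewrite e3; rewrite -[LHS]/(diff _ v v).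
  exact: (diff_euler _ (h1 i)).
rewrite /polar /diff; under eq_bigr do rewrite e2 mulrCA.
rewrite -mulr_sumr invfM -mulrA (mulrA 2%:R^-1) mulVf; last exact: two0.
by rewrite mul1r mulrC.
Qed.

Lemma polar_cube v : peval f v = polar v v v.
Proof. by rewrite polar_diff (diff_euler _ f_cubic); field. Qed.

End Polar.

(** * The geometric hypotheses in terms of the polar form *)
Section Translation.
Variables (k : closedFieldType) (char0 : [pchar k] =i pred0).
Notation V := 'cV[k]_5.
Implicit Types (a b c v w x y z : V) (p q : 'P[k]_4).
Variable f : {mpoly k[5]}.
Hypothesis f_cubic : f \is 3.-homog.
Let two0 : 2%:R != 0 :> k := natS_neq0 char0 1.
Let three0 : 3%:R != 0 :> k := natS_neq0 char0 2.
Notation X := (hypersurface (n := 4) f).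
Notation T := (polar f).
Let HT := polar_symmetric f.
Let TE := triE HT.
Let fT := polar_cube char0 f_cubic.

Lemma hypersurfaceP p v : v \in (p : {vspace _}) -> v != 0 -> X p <-> T v v v = 0.
Proof. by move=> vp v0; rewrite -fT; apply: vanishes_atP f_cubic vp v0. Qed.

Lemma SingP p v : v \in (p : {vspace _}) -> v != 0 ->
  Sing (n := 4) f p <-> forall x, T v v x = 0.
Proof.
move=> vp v0; have Tx x : T v v x = diff f v x / 3%:R.
  by rewrite -(polar_diff char0 f_cubic) [RHS](tri_rot HT).
split=> [[Xp dp] x|h].
  rewrite Tx /diff big1 ?mul0r // => i _.
  by rewrite (dp i v vp) mulr0.
split; first by apply/(hypersurfaceP vp v0); apply: h.
move=> i; apply/(vanishes_atP (mderiv_homog i f_cubic) vp v0).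
have := h (delta_mx i 0); rewrite Tx /diff (bigD1 i) //= big1 => [|j ji].
  rewrite !mxE !eqxx mul1r addr0 => /eqP; rewrite mulf_eq0 invr_eq0 (negPf three0).
  by rewrite orbF => /eqP.
by rewrite !mxE (negPf ji) mul0r.
Qed.

(** A line in E through a point off A and a point off B meets A and B in finitely
  many points. The vector v0 keeps the points of the line away from 0. *)
Lemma irreducible_subspace (E : {vspace V}) : (0 < \dim E)%N ->
  irreducible_set (fun p : 'P[k]_4 => (p <= E)%VS).
Proof.
move=> dE; have [v0 v0E v00] : exists2 v, v \in E & v != 0.
  by exists (vpick E); rewrite ?memv_pick // vpick0 -dimv_eq0 -lt0n.
have inE v : v \in E -> v != 0 -> (point v <= E)%VS.
  by move=> vE nz; rewrite pointE // -memvE.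
split=> [|A B [SA homA cA] [SB homB cB] AB]; first by exists (point v0); apply: inE.
apply: NNPP => no.
have notin (A' : 'P[k]_4 -> Prop) SA' : (forall p, A' p <-> (forall g, SA' g -> vanishes_at g p)) ->
    ~ psubset (fun p => (p <= E)%VS) A' -> exists g v, [/\ SA' g, v \in E & peval g v != 0].
  move=> cA' nA; apply: NNPP => no'; apply: nA => p pE; apply/cA' => g Sg v vp.
  apply/eqP; apply: contraT => gv; case: no'; exists g, v; split=> //.
  exact: (subvP pE).
have [g [v [Sg vE gv]]] : exists g v, [/\ SA g, v \in E & peval g v != 0].
  by apply: (notin A SA cA) => h; apply: no; left.
have [h [w [Sh wE hw]]] : exists h w, [/\ SB h, w \in E & peval h w != 0].
  by apply: (notin B SB cB) => h'; apply: no; right.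
pose P (u u' : V) (t : k) := u + t *: (u' - u).
have gen (u u' : V) (e : {mpoly k[5]}) : peval e u != 0 \/ peval e u' != 0 ->
    generically (fun t => peval e (P u u' t) != 0).
  move=> hu; apply: polyfun_generic (polyfun_peval e (polypath_line _ _)) _.
  case: hu => hu; first by exists 0; rewrite scale0r addr0.
  by exists 1; rewrite scale1r addrC subrK.
have [i v0i] := cV_neq0 v00.
have PE (u u' : V) t : u \in E -> u' \in E -> P u u' t \in E.
  by move=> uE u'E; rewrite memvD // memvZ // memvB.
have [t1 [g1 h1]] := generically_ex (generically_and
  (gen v w g (or_introl gv)) (gen v w h (or_intror hw))).
set x := P v w t1 in g1 h1; have xE : x \in E by apply: PE.
have Xi : peval 'X_i v0 != 0 by rewrite pevalX.
have [t2 [[g2 h2] x2]] := generically_ex (generically_and (generically_and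
  (gen x v0 g (or_introl g1)) (gen x v0 h (or_introl h1))) (gen x v0 'X_i (or_intror Xi))).
set y := P x v0 t2 in g2 h2 x2; have yE : y \in E by apply: PE.
have y0 : y != 0 by apply: contraNneq x2 => ->; rewrite pevalX mxE.
have [/cA/(_ g Sg y (mem_point y0))|/cB/(_ h Sh y (mem_point y0))] := AB _ (inE y yE y0).
  by move/eqP; rewrite (negPf g2).
by move/eqP; rewrite (negPf h2).
Qed.

Hypothesis X_irr : irreducible_set X.
Hypothesis X_not_cone : ~ is_cone X.
Variables (L : 'P[k]_4 -> Prop) (W : {vspace V}).
Hypotheses (dW : \dim W = 2%N) (LW : forall p, L p <-> (p <= W)%VS).
Hypothesis L_comp : irreducible_component L (Sing (n := 4) f).

Let X_point : exists2 v, v != 0 & T v v v = 0.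
Proof.
have [[p Xp] _] := X_irr; exists (vpick p); first exact: vpick_neq0.
exact/(hypersurfaceP (memv_pick p) (vpick_neq0 p)).
Qed.

(** A singular point z off the double line such that T x z v = 0 for all x in W would
  make the plane spanned by them singular; it is irreducible and larger than the
  line. *)
Lemma double_line : double_line_cubic T W.
Proof.
have [_ LS Lmax] := L_comp.
have W1 w x : w \in W -> T w w x = 0.
  move=> wW; have [->|w0] := eqVneq w 0; first exact: tri01.
  apply: (SingP (mem_point w0) w0).1; apply: LS; apply/LW.
  by rewrite pointE // -memvE.
have W2 w w' x : w \in W -> w' \in W -> T w w' x = 0.
  move=> wW w'W; have := W1 (w + w') x (memvD wW w'W).
  rewrite !(triD1 HT, triD2 HT) !W1 // (tri12 HT w' w) add0r addr0.
  by rewrite -mulr2n -mulr_natl; apply: mulf_cancel0.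
split=> //.
- move=> d e g h [F hF eF] [H hH eH] gh.
  have cover p : X p -> vanishes_at F p \/ vanishes_at H p.
    move=> Xp; have pp := memv_pick p; have p0 := vpick_neq0 p.
    have /gh/eqP := (hypersurfaceP pp p0).1 Xp; rewrite mulf_eq0 -eF -eH.
    by case/orP=> /eqP z; [left; apply/(vanishes_atP hF pp p0) | right; apply/(vanishes_atP hH pp p0)].
  have zero (G : {mpoly k[5]}) d' : G \is d'.-homog -> psubset X (vanishes_at G) ->
      forall v, T v v v = 0 -> peval G v = 0.
    move=> hG XG v fv; have key u : u != 0 -> T u u u = 0 -> peval G u = 0.
      move=> u0 fu; apply: (XG (point u)) (mem_point u0).
      exact/(hypersurfaceP (mem_point u0) u0).
    have [->|v0] := eqVneq v 0; last exact: key.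
    have [u u0 fu] := X_point.
    by rewrite -(scale0r u) (peval_homogZ _ _ hG) key // mulr0.
  have [XF|XH] := X_irr.2 _ _ (closed_form hF) (closed_form hH) cover.
    by left=> v fv; rewrite -eF; apply: zero hF XF v fv.
  by right=> v fv; rewrite -eH; apply: zero hH XH v fv.
- move=> w w0; apply: NNPP => no; apply: X_not_cone.
  have Tw y : T w y y = 0 by apply/eqP; apply: contraT => h; case: no; exists y.
  have Tw2 y z : T w y z = 0.
    have := Tw (y + z); rewrite !(triD2 HT, triD3 HT) !Tw (tri23 HT w z y) add0r addr0.
    by rewrite -mulr2n -mulr_natl; apply: mulf_cancel0.
  exists (point w); first by apply/(hypersurfaceP (mem_point w0) w0).
  move=> p Xp q qE; have q0 := vpick_neq0 q.
  apply/(hypersurfaceP (memv_pick q) q0).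
  have : vpick q \in (point w + p)%VS by apply: (subvP qE); apply: memv_pick.
  case/memv_addP=> u1; rewrite pointE // => /vlineP[c ->] [u2 u2p ->].
  have [u20|u20] := eqVneq u2 0; first by rewrite u20 addr0 !TE Tw2 !mulr0.
  have fu := (hypersurfaceP u2p u20).1 Xp.
  rewrite !TE !Tw2 (tri12 HT u2 w) !Tw2 (tri_rot HT u2 u2 w) (tri_rot HT u2 w u2) Tw2 fu.
  by rewrite !(mulr0, addr0).
move=> z zW sz; apply: NNPP => no.
have Tz x v : x \in W -> T x z v = 0.
  by move=> xW; apply/eqP; apply: contraT => h; case: no; exists x, v.
have := Lmax (fun p => (p <= W + <[z]>)%VS) _ _ _ (point z).
have z0 : z != 0 by apply: contraNneq zW => ->; rewrite mem0v.
rewrite pointE // -memvE => h; case/negP: (zW).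
have : L (point z).
  apply: h.
  - by apply: irreducible_subspace; rewrite dim_add_vector.
  - move=> p pE; have p0 := vpick_neq0 p; apply/(SingP (memv_pick p) p0) => x.
    have /mem_add_vector[w wW [c ->]] : vpick p \in (W + <[z]>)%VS.
      by apply: (subvP pE); apply: memv_pick.
    by rewrite !TE W2 // Tz // (tri12 HT z w) Tz // sz !(mulr0, addr0).
  - by move=> p /LW pW; apply: subv_trans pW (addvSl _ _).
  by rewrite (subvP (addvSr _ _)) ?memv_line.
by move/LW; rewrite pointE // -memvE.
Qed.

Lemma regular_automorphism (phi : 'P[k]_4 -> 'P[k]_4) :
  (forall p, X p -> X (phi p)) -> regular_on X phi ->
  regular_map T (fun v => vpick (phi (point v))).
Proof.
move=> Xphi reg; split=> v v0 fv.
- exact: vpick_neq0.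
- apply/(hypersurfaceP (memv_pick _) (vpick_neq0 _))/Xphi.
  exact/(hypersurfaceP (mem_point v0) v0).
have Xv : X (point v) by apply/(hypersurfaceP (mem_point v0) v0).
have [d [F [hF [v1 v1p Fv1] hphi]]] := reg _ Xv; exists d, F; split=> //.
  move: v1p Fv1; rewrite pointE // => /vlineP[c ->].
  by rewrite (forms_evalZ _ _ hF) scaler_eq0 negb_or => /andP[].
move=> w w0 fw; have Xw : X (point w) by apply/(hypersurfaceP (mem_point w0) w0).
have [->|Fw] := eqVneq (forms_eval F w) 0; first exact: collinear0.
have e := hphi _ w Xw (mem_point w0) Fw.
apply: (pspace_collinear (p := phi (point w))); rewrite ?memv_pick ?vpick_neq0 //.
by rewrite e memv_line.
Qed.

Variables (gT : finGroupType) (act : gT -> 'P[k]_4 -> 'P[k]_4).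
Hypothesis G_sub : subgroup_of_Aut X act.

(** Two matrices that represent the same automorphism of X differ by a scalar. *)
Lemma linear_representatives : exists M : gT -> 'M[k]_5,
  linear_group T W M /\
  forall g v, v != 0 -> T v v v = 0 ->
    M g *m v != 0 /\ act g (point v) = point (M g *m v).
Proof.
have HX := double_line; have [aut actM _] := G_sub.
pose s g v := vpick (act g (point v)).
have Hs g : regular_map T (s g).
  by have [h1 h2 _] := aut g; apply: regular_automorphism.
have XP v : v != 0 -> T v v v = 0 -> X (point v).
  by move=> v0 fv; apply/(hypersurfaceP (mem_point v0) v0).
have : forall g, exists M : 'M[k]_5,
    [/\ M \in unitmx, forall v, v != 0 -> T v v v = 0 -> collinear (M *m v) (s g v) &
        forall w w' x, w \in W -> w' \in W -> T (M *m w) (M *m w') x = 0].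
  move=> g; have [h1 h2 [t [h3 h4 ts st]]] := aut g.
  apply: (automorphism_linear char0 HX (Hs g) (regular_automorphism h3 h4)).
  move=> v v0 fv; rewrite /s point_vpick ts; last exact: XP.
  by apply: (pspace_collinear (p := point v)); rewrite ?memv_pick ?mem_point.
move/fin_all_exists => [M hM].
have M0 g v : v != 0 -> M g *m v != 0.
  by have [uM _ _] := hM g; apply: contraNneq => /(unitmx_eq0 uM) ->.
have Ms g v : v != 0 -> T v v v = 0 -> collinear (M g *m v) (s g v) by have [_ h _] := hM g; apply: h.
have actE g v : v != 0 -> T v v v = 0 -> act g (point v) = point (M g *m v).
  move=> v0 fv; rewrite -[LHS]point_vpick; apply: collinear_point (vpick_neq0 _) (M0 g v v0) _.
  exact/collinear_sym/Ms.
have cub g v : T v v v = 0 -> T (M g *m v) (M g *m v) (M g *m v) = 0.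
  move=> fv; have [->|v0] := eqVneq v 0; first by rewrite mulmx0 tri01.
  apply/(hypersurfaceP (mem_point (M0 g v v0)) (M0 g v v0)); rewrite -actE //.
  by have [h1 _ _] := aut g; apply/h1/XP.
exists M; split=> [|g v v0 fv]; last by split; [apply: M0 | apply: actE].
split=> //; try by move=> g; case: (hM g).
move=> g h; pose N := invmx (M (g * h)%g) *m (M g *m M h).
have uM g' : M g' \in unitmx by case: (hM g').
have [c ec] : exists c : k, N = c%:M.
  apply: (scalar_of_collinear char0 HX) => v v0 fv.
  apply: (collinear_mulmx_inj (uM (g * h)%g)); rewrite /N !mulmxA mulmxV // mul1mx -mulmxA.
  have hv := M0 h v v0; have fh := cub h v fv.
  have e : point (M g *m (M h *m v)) = point (M (g * h)%g *m v).
    by rewrite -(actE _ v) // (actM g h _ (XP v v0 fv)) (actE h v) // (actE g).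
  apply: (pspace_collinear (p := point (M (g * h)%g *m v))); rewrite ?M0 // ?mem_point ?M0 //.
  by rewrite -e mem_point ?M0.
exists c; rewrite -mul_mx_scalar -ec /N mulKVmx //.
Qed.

End Translation.

Theorem theorem3p1 (k : closedFieldType) (char0 : [pchar k] =i pred0)
  (f : {mpoly k[5]}) (f_neq0 : f != 0) (f_cubic : f \is 3.-homog)
  (X_irreducible : irreducible_set (hypersurface (n := 4) f))
  (X_not_cone : ~ is_cone (hypersurface (n := 4) f))
  (X_sing_line : exists2 L : 'P[k]_4 -> Prop,
     is_line L & irreducible_component L (Sing (n := 4) f))
  (gT : finGroupType) (act : gT -> 'P[k]_4 -> 'P[k]_4)
  (G_sub_Aut : subgroup_of_Aut (hypersurface (n := 4) f) act) :
  linearizable 3 (hypersurface (n := 4) f) act.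
Proof.
have [L [W dW LW] L_comp] := X_sing_line.
have HX := double_line char0 f_cubic X_irreducible X_not_cone dW LW L_comp.
have [M [HM actM]] := linear_representatives char0 f_cubic X_irreducible
  X_not_cone dW LW L_comp G_sub_Aut.
have [rG [F [G [D [E H]]]]] := linear_group_model char0 HX HM.
exact: (linearizable_of_forms f_cubic (polar_cube char0 f_cubic) X_irreducible actM H).
Qed.
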